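(* Let $\phi=\tilde p/p$ satisfy (A1) and fix $\mu\in\mathbb{T}$. Then there are a positive integer $L_\mu$, power series $\psi^\mu_1,\dots,\psi^\mu_{L_\mu}$ (centered at $1$) that converge in a neighborhood of $1$, and an open set $\mathcal{V}\subseteq\mathbb{C}^2$ containing $(1,1)$ such that the components of $\mathcal{L}_\mu(\phi)\cap\mathcal{V}$ consist of the sets described by the formulas $$z_1=\psi^\mu_1(z_2),\ \dots,\ z_1=\psi^\mu_{L_\mu}(z_2),$$ where $\psi^\mu_j(1)=1$ for $j=1,\dots,L_\mu$, and, for at most one value of $\mu\in\mathbb{T}$, possibly also a straight line $\{z_2=1\}$.
   Context: $\mathbb{D}$ is the open unit disk and $\mathbb{T}$ the unit circle. For a polynomial $p\in\mathbb{C}[z_1,z_2]$ of bidegree $(m,n)$ (largest powers of $z_1$ and $z_2$ appearing), its reflection is $\tilde p(z_1,z_2)=z_1^mz_2^n\overline{p(1/\bar z_1,1/\bar z_2)}$. A rational inner function (RIF) on $\mathbb{D}^2$ is a rational function that is holomorphic and bounded on $\mathbb{D}^2$ with $|\phi|=1$ a.e. on $\mathbb{T}^2$. (A1): $\phi=\tilde p/p$ is an RIF on $\mathbb{D}^2$, where $p$ has no zeros in $\mathbb{D}^2$ and $p,\tilde p$ have no common factor; $\phi$ has a singularity at $(1,1)$ (i.e. $p(1,1)=0$, hence also $\tilde p(1,1)=0$); and the non-tangential value of $\phi$ at $(1,1)$ is $1$, i.e. $\phi(z_k)\to 1$ whenever $z_k\in\mathbb{D}^2$ approaches $(1,1)$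 non-tangentially. For $\mu\in\mathbb{T}$, $\mathcal{L}_\mu(\phi)=\{(z_1,z_2)\in\mathbb{C}^2:\tilde p(z_1,z_2)=\mu\, p(z_1,z_2)\}$. *)

(* Defs.v *)
From HB Require Import structures.
From mathcomp Require Import all_boot all_order all_algebra polyXY.
From mathcomp Require Import complex.
From mathcomp Require Import all_classical all_reals all_analysis.
From mathcomp Require Import ring.

Set Implicit Arguments.
Unset Strict Implicit.
Unset Printing Implicit Defensive.

Import Order.TTheory GRing.Theory Num.Theory.
Import numFieldNormedType.Exports.
Local Open Scope classical_set_scope.
Local Open Scope ring_scope.

(* The packaged type, rather than R[i] itself, is what gives access to the
   topology and the norm that MathComp-Analysis puts on a numClosedFieldType. *)
Definition CC (R : realType) : numClosedFieldType := R[i].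

Section Bipoly.
Variable C : numClosedFieldType.

(* C[z1, z2] is {poly {poly C}}: the outer variable 'X is z1, the inner one 'Y
   is z2, so p.[z1, z2] is the value of p, p`_i`_j is the coefficient of
   z1 ^+ i * z2 ^+ j, and a nonzero p has bidegree ((size p).-1, (sizeY p).-1). *)
Definition reflection (p : {poly {poly C}}) : {poly {poly C}} :=
  \poly_(i < size p) \poly_(j < sizeY p)
    (p`_((size p).-1 - i)`_((sizeY p).-1 - j))^*.

Lemma horner_coef_sizeY (p : {poly {poly C}}) (x y : C) :
  p.[x, y] = \sum_(i < size p) \sum_(j < sizeY p) p`_i`_j * x ^+ i * y ^+ j.
Proof.
rewrite (horner_coef p x%:P) horner_sum; apply: eq_bigr => i _.
rewrite hornerM -rmorphXn hornerC (@horner_coef_wide _ (sizeY p)); last first.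
  exact: max_size_coefXY.
by rewrite big_distrl; apply: eq_bigr => j _; rewrite mulrAC.
Qed.

Lemma reflectionE (p : {poly {poly C}}) (x y : C) : x != 0 -> y != 0 ->
  (reflection p).[x, y] = x ^+ (size p).-1 * y ^+ (sizeY p).-1 *
    (p.[(x^*)^-1, (y^*)^-1])^*.
Proof.
move=> x0 y0.
have subE (n : nat) (k : 'I_n) : (n.-1 - (n - k.+1))%N = k.
  by case: n k => [[]//|n] k /=; rewrite subSS subKn // -ltnS.
have expE (u : C) (n : nat) (k : 'I_n) :
    u != 0 -> u ^+ (n - k.+1) = u ^+ n.-1 * u^-1 ^+ k.
  move=> u0; case: n k => [[]//|n] k /=.
  by rewrite subSS exprVn expfB_cond // (negPf u0) add0n -ltnS.
rewrite (horner_coef_sizeY p) raddf_sum big_distrr /=.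
rewrite (horner_poly _ _ x%:P) horner_sum (reindex_inj rev_ord_inj) /=.
apply: eq_bigr => i _; rewrite hornerM -rmorphXn hornerC horner_poly.
rewrite raddf_sum big_distrl big_distrr /= (reindex_inj rev_ord_inj) /=.
apply: eq_bigr => j _ /=.
rewrite !rmorphM !rmorphXn !fmorphV /= !subE !expE //.
have cK (u : C) : u^*^* = u by exact: conjCK.
by rewrite !cK; move: (_`__)^* => a; ring.
Qed.

Definition no_common_factor (p q : {poly {poly C}}) : Prop :=
  forall d u v : {poly {poly C}}, p = d * u -> q = d * v ->
    exists c : C, d = c%:P%:P.

End Bipoly.

Section RIF.
Variable R : realType.
Local Notation C := (CC R).

Definition bidisk : set (C * C) := [set z | `|z.1| < 1 /\ `|z.2| < 1].

Definition holomorphic_on (V : normedModType C) (D : set V) (f : V -> C) : Prop :=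
  forall z, D z -> differentiable f z.

Definition expi (t : R) : C := (cos t +i* sin t)%C.

Definition is_rational (phi : C * C -> C) : Prop :=
  exists q r : {poly {poly C}}, r != 0 /\
    forall z, r.[z.1, z.2] != 0 -> phi z = q.[z.1, z.2] / r.[z.1, z.2].

Definition RIF (phi : C * C -> C) : Prop :=
  [/\ is_rational phi,
      holomorphic_on bidisk phi,
      [bounded phi z | z in bidisk] &
      {ae (@lebesgue_measure R \x @lebesgue_measure R)%E,
        forall st, `|phi (expi st.1, expi st.2)| = 1}].

(* The norm of C * C is the maximum norm, so 1 - `|z| measures the distance
   from z to the boundary of the bidisk. *)
Definition nontangential_to11 (z : nat -> C * C) : Prop :=
  [/\ forall k, bidisk (z k),
      z @ \oo --> ((1, 1) : C * C) &
      exists c : C, forall k, `|z k - (1, 1)| <= c * (1 - `|z k|)].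

(* At the zeros of p, which form a null subset of the torus and do not meet the
   bidisk under A1, the quotient has the conventional value 0. *)
Definition rif_of (p : {poly {poly C}}) (z : C * C) : C :=
  (reflection p).[z.1, z.2] / p.[z.1, z.2].

Definition A1 (p : {poly {poly C}}) : Prop :=
  RIF (rif_of p) /\
  (forall z, bidisk z -> p.[z.1, z.2] != 0) /\
  no_common_factor p (reflection p) /\
  p.[1, 1] = 0 /\
  (forall z : nat -> C * C, nontangential_to11 z ->
    rif_of p (z k) @[k --> \oo] --> (1 : C)).

Definition level_set (p : {poly {poly C}}) (mu : C) : set (C * C) :=
  [set z | (reflection p).[z.1, z.2] = mu * p.[z.1, z.2]].

Definition pseries_at1 (a : nat -> C) (w : C) : nat -> C :=
  [series a k * (w - 1) ^+ k]_k.

(* z1 = psi(z2), where psi is the sum of the power series, wherever it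
   converges. *)
Definition pseries_graph (a : nat -> C) : set (C * C) :=
  [set z | pseries_at1 a z.2 @ \oo --> z.1].

(* z is a regular point of A when A is, in a neighbourhood of z, a complex
   submanifold (of dimension 0, 1 or 2); a submanifold of dimension 1 of C^2
   is locally the graph of a holomorphic function of one of the coordinates. *)
Definition regular_point (A : set (C * C)) (z : C * C) : Prop :=
  A z /\ exists U : set (C * C), [/\ open U, U z &
    [\/ A `&` U = [set z],
        exists f : C -> C, holomorphic_on [set x.2 | x in U] f /\
          A `&` U = [set x | x.1 = f x.2] `&` U,
        exists f : C -> C, holomorphic_on [set x.1 | x in U] f /\
          A `&` U = [set x | x.2 = f x.1] `&` U |
        U `<=` A]].

(* The irreducible components of an analytic subset A of an open set V are the
   closures in V of the connected components of its set of regular points. *)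
Definition irreducible_component (V A S : set (C * C)) : Prop :=
  exists2 x, regular_point A x &
    S = closure (connected_component (regular_point A) x) `&` V.

End RIF.

(* Main.v *)
Require Import Defs.
From mathcomp Require Import all_boot all_order all_algebra polyXY.
From mathcomp Require Import complex.
From mathcomp Require Import all_classical all_reals all_analysis.
From mathcomp Require Import ring lra zify.
Import Order.TTheory GRing.Theory Num.Theory.
Import numFieldNormedType.Exports.
Local Open Scope classical_set_scope.
Local Open Scope ring_scope.
Set Implicit Arguments.
Unset Strict Implicit.
Unset Printing Implicit Defensive.

(** Near (1, 1), the Cayley transform of both variables turns p~ = mu p into a polynomial
    equation H(x, y) = 0.  Stability of p gives |p~| <= |p| on the bidisk, and this forces every
    x with H(x, y) = 0 to be real when y is real and small.  As in Rellich's theorem, such a curve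
    has no fractional Puiseux exponents: its Newton polygon at a point (a, 0) has no edge of slope
    < 1, so that the blow-up x = a + y x1 again yields a polynomial with real roots, and after
    finitely many blow-ups the roots are simple and given by the implicit function theorem.
    The line z2 = 1 lies in the level set only when p~(., 1) = mu p(., 1), which fails for two
    different mu since p and p~ are coprime; even then a graph through (1, 1) remains, since
    otherwise |p~| <= |p| would bound the argument of a monomial on a product of half-planes.
    Off (1, 1) the pieces are disjoint, and punctured discs are connected, so the pieces are the
    irreducible components. *)

(** * Power series with geometrically bounded coefficients *)

(** Three obstacles shape the argument. Stability gives only the weak inequality |p~| <= |p|, and
    only over the open bidisk, while the roots to be located lie over real y, that is, over the
    boundary. Replacing mu by mu (1 + e) and y by y + i e with e > 0 makes the inequality strict,
    continuity of the roots carries a root of the limit equation back to such an e, and conjugation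
    symmetry of H settles the other half-plane. Blowing up need not lower the multiplicity, so
    termination is measured elsewhere: in an identity U G + V G' = D(y), a blow-up at a root of
    multiplicity N >= 2 divides D by y^(N - 1). The point (1, 1) itself may or may not be regular.
    If it is, the level set near it is parametrised by a single disc, and connectedness of the
    punctured disc shows that there is only one piece. Branches are coefficient sequences with
    geometric bounds, so that composing with the Cayley transform, solving implicit equations and
    undoing a blow-up are all operations on such sequences. *)

Section GeometricSeries.
Variable R : realType.
Local Notation C := (CC R).
Implicit Types (c d : nat -> C) (y : C).

(** In the partial order of [C], being comparable with 0 forces a vanishing imaginary part; this is
    how estimates pass between [C] and [R]. *)
Lemma pos_complexE (e : C) : 0 < e -> exists2 r : R, 0 < r & e = r%:C%C.
Proof.
case: e => a b; rewrite ltcE /= => /andP[/eqP b0 a0]; exists a => //.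
by rewrite b0.
Qed.

Lemma nneg_complexE (e : C) : 0 <= e -> exists2 r : R, 0 <= r & e = r%:C%C.
Proof.
case: e => a b; rewrite lecE /= => /andP[/eqP b0 a0]; exists a => //.
by rewrite b0.
Qed.

Lemma cvg_real_complex T (F : set_system T) (FF : Filter F) (u : T -> R) (l : R) :
  u @ F --> l -> (fun n => (u n)%:C%C : C) @ F --> (l%:C%C : C).
Proof.
move=> /cvgrPdist_lt ul; apply/cvgrPdist_lt => e /pos_complexE[r r0 ->].
have := ul r r0; apply: filterS => n.
by rewrite -rmorphB normc_def /= expr0n addr0 sqrtr_sqr -ltcR.
Qed.

Lemma cvg_complexI T (F : set_system T) (FF : Filter F) (u v : T -> R) (a b : R) :
  u @ F --> a -> v @ F --> b ->
  (fun n => (u n +i* v n)%C : C) @ F --> ((a +i* b)%C : C).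
Proof.
move=> ua vb; have cE (x y : R) : (x +i* y)%C = (x%:C%C : C) + (0 +i* 1)%C * (y%:C%C : C) :> C.
  by rewrite /GRing.add /GRing.mul /=; congr (_ +i* _)%C; ring.
rewrite cE; under eq_fun do rewrite cE.
apply: cvgD; first exact: cvg_real_complex.
by apply: cvgM; [exact: cvg_cst|exact: cvg_real_complex].
Qed.

Lemma cvg_geometric0 (M t : C) : 0 <= t -> t < 1 -> M * t ^+ n @[n --> \oo] --> (0 : C).
Proof.
move=> /nneg_complexE[r r0 ->]; rewrite (_ : 1 = 1%:C%C :> C) // ltcR => r1.
rewrite -[X in _ --> X](mulr0 M); apply: cvgM; first exact: cvg_cst.
suff : (fun n => (r ^+ n)%:C%C : C) @ \oo --> ((0 : R)%:C%C : C).
  by apply: cvg_trans; apply: near_eq_cvg; near=> n; rewrite rmorphXn.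
apply: cvg_real_complex.
by apply: cvg_expr; rewrite ger0_norm.
Unshelve. all: by end_near. Qed.

Definition psum c y : nat -> C := [series c k * y ^+ k]_k.
Fact pval_key : unit. Proof. by []. Qed.
(** The lock keeps the limit folded under simplification and unification. *)
Definition pval : (nat -> C) -> C -> C := locked_with pval_key (fun c y => limn (psum c y)).
Definition geom (M K : C) c := forall k, `|c k| <= M * K ^+ k.
(** By the Cauchy-Hadamard formula this is a positive radius of convergence; the pair (M, K) is what
    the estimates handle. *)
Definition analytic c := exists M K : C, [/\ 0 < M, 0 < K & geom M K c].

Lemma pvalE c y : pval c y = limn (psum c y).
Proof. by rewrite /pval unlock. Qed.

Lemma psumE c y n : psum c y n = \sum_(k < n) c k * y ^+ k.
Proof. by rewrite /psum /series /= big_mkord. Qed.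

(** The real and imaginary parts are absolutely convergent real series, dominated by a geometric
    series of ratio K |y|. *)
Lemma cvgn_psum M K c y : 0 <= M -> 0 < K -> geom M K c -> K * `|y| < 1 -> cvgn (psum c y).
Proof.
move=> M0 K0 gc Ky.
have /nneg_complexE[t t0 tE] : 0 <= K * `|y| by rewrite mulr_ge0 // ltW.
have /nneg_complexE[m m0 mE] := M0.
have t1 : t < 1 by move: Ky; rewrite tE (_ : 1 = 1%:C%C :> C) // ltcR.
have uM (u : R^nat) : (forall k, `|u k|%:C%C <= `|c k * y ^+ k| :> C) -> cvgn (series u).
  move=> uc; suff : cvgn (series (fun n => `|u n|)) by exact: normed_cvg.
  have := @series_le_cvg _ (fun n => `|u n|) (geometric m t); apply => [n|n|n|] //.
  - by rewrite /geometric /= mulr_ge0 // exprn_ge0.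
  - rewrite /= -lecR; apply: le_trans (uc n) _.
    rewrite rmorphM rmorphXn /= -tE -mE normrM normrX exprMn mulrA.
    by rewrite ler_wpM2r ?exprn_ge0.
  - by apply: is_cvg_geometric_series; rewrite ger0_norm.
have /uM/cvg_ex[/= a ca] : forall k, `|complex.Re (c k * y ^+ k : R[i])|%:C%C <= `|c k * y ^+ k| :> C.
  by move=> k; exact: (@normc_ge_Re R (c k * y ^+ k : R[i])).
have /uM/cvg_ex[/= b cb] : forall k, `|complex.Im (c k * y ^+ k : R[i])|%:C%C <= `|c k * y ^+ k| :> C.
  move=> k; case: (c k * y ^+ k : R[i]) => p q.
  by rewrite normc_def lecR /= -sqrtr_sqr ler_wsqrtr // lerDr sqr_ge0.
apply: (cvgP ((a +i* b)%C : C)).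
suff -> : psum c y = fun n => (series (fun k => complex.Re (c k * y ^+ k : R[i])) n +i*
    series (fun k => complex.Im (c k * y ^+ k : R[i])) n)%C by exact: cvg_complexI.
apply/funext=> n; rewrite /psum /series /=.
elim/big_rec3: _ => //= k x1 x2 x3 _ ->; case: (c k * _) => p q.
by rewrite /GRing.add /=.
Qed.

Lemma cvg_psum M K c y : 0 <= M -> 0 < K -> geom M K c -> K * `|y| < 1 ->
  psum c y @ \oo --> pval c y.
Proof. by move=> M0 K0 gc Ky; rewrite pvalE; exact: (cvgn_psum M0 K0 gc Ky). Qed.

Lemma cvg_norm_le (u : nat -> C) (l a e : C) n0 :
  u @ \oo --> l -> (forall n, (n0 <= n)%N -> `|u n - a| <= e) -> `|l - a| <= e.
Proof.
move=> ul ue; have er : e \is Num.real.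
  by apply: ger0_real; apply: le_trans (ue n0 _).
rewrite real_leNgt ?normr_real //; apply/negP; rewrite -subr_gt0 => e0.
have [m _ /(_ (maxn m n0))] := cvgr_dist_lt _ _ ul _ e0.
rewrite /= leq_maxl => /(_ isT); rewrite ltrBrDr; apply/negP.
rewrite -real_leNgt ?normr_real ?realD ?normr_real //.
have := ler_distD (u (maxn m n0)) l a; move=> /le_trans; apply.
by rewrite lerD2l; apply: ue; rewrite leq_maxr.
Qed.

Lemma geometric_sum_le (t : C) n : 0 <= t -> t <= 2^-1 -> \sum_(k < n) t ^+ k <= 2.
Proof.
move=> t0 t2; have t1 : t < 1 by apply: le_lt_trans t2 _; rewrite invf_lt1 ?ltr1n.
have t10 : 0 < 1 - t by rewrite subr_gt0.
have tE : (1 - t) * \sum_(k < n) t ^+ k = 1 - t ^+ n.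
  by rewrite -opprB mulNr -subrX1 opprB.
rewrite -(ler_pM2l t10) tE; apply: (@le_trans _ _ 1).
  by rewrite gerBl exprn_ge0.
have h2 : 1 - 2^-1 = 2^-1 :> C by field.
have : 2^-1 <= 1 - t by rewrite -h2 lerB.
by rewrite -(ler_pM2r (ltr0n C 2)) mulVf ?pnatr_eq0.
Qed.

(** Half of the guaranteed radius 1 / K keeps the ratio at most 1/2, so that the geometric remainder
    sums to at most 2. *)
Lemma psum_tail M K c y n m : 0 <= M -> 0 < K -> geom M K c -> K * `|y| <= 2^-1 ->
  (n <= m)%N -> `|psum c y m - psum c y n| <= M * 2 * (K * `|y|) ^+ n.
Proof.
move=> M0 K0 gc Ky nm.
have t0 : 0 <= K * `|y| by rewrite mulr_ge0 // ltW.
rewrite /psum /series /= (big_cat_nat (n := n)) //= addrAC subrr add0r.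
apply: le_trans (ler_norm_sum _ _ _) _.
rewrite -{1}[n]add0n big_addn big_mkord.
apply: (@le_trans _ _ (\sum_(k < m - n) M * (K * `|y|) ^+ n * (K * `|y|) ^+ k)).
  apply: ler_sum => k _; rewrite normrM normrX -mulrA -exprD [(n + k)%N]addnC exprMn mulrA.
  by rewrite ler_wpM2r ?exprn_ge0.
rewrite -big_distrr /= -!mulrA; apply: ler_wpM2l => //.
rewrite [X in _ <= X]mulrC; apply: ler_wpM2l; first by rewrite exprn_ge0.
exact: geometric_sum_le.
Qed.

Lemma half_lt1 : (2^-1 : C) < 1.
Proof. by rewrite invf_lt1 ?ltr1n. Qed.

Lemma pval_tail M K c y n : 0 <= M -> 0 < K -> geom M K c -> K * `|y| <= 2^-1 ->
  `|pval c y - psum c y n| <= M * 2 * (K * `|y|) ^+ n.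
Proof.
move=> M0 K0 gc Ky; apply: (@cvg_norm_le (psum c y) _ _ _ n).
  by apply: cvg_psum gc _ => //; exact: le_lt_trans half_lt1.
by move=> m; exact: psum_tail.
Qed.

End GeometricSeries.

(** * Zeros, differences and derivatives of analytic series *)

Section AnalyticSeries.
Variable R : realType.
Local Notation C := (CC R).
Implicit Types (c d : nat -> C) (y : C).

Lemma geom_ge0 (M K : C) c : 0 < K -> geom M K c -> 0 <= M.
Proof. by move=> K0 /(_ 0); rewrite expr0 mulr1; apply: le_trans. Qed.

Lemma geom_weaken (M K M' K' : C) c : 0 <= M -> 0 <= K -> M <= M' -> K <= K' ->
  geom M K c -> geom M' K' c.
Proof.
move=> M0 K0 MM KK gc k; apply: le_trans (gc k) _.
by rewrite ler_pM ?exprn_ge0 // lerXn2r ?nnegrE // (le_trans K0).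
Qed.

Lemma near0_mul_le (K e : C) : 0 < K -> 0 < e -> \forall y \near (0 : C), K * `|y| <= e.
Proof.
move=> K0 e0; have eK : 0 < e / K by rewrite divr_gt0.
have := @nbhs0_le C C _ eK; apply: filterS => y.
by rewrite ler_pdivlMr // mulrC.
Qed.

Lemma near0_mul_lt (K e : C) : 0 < K -> 0 < e -> \forall y \near (0 : C), K * `|y| < e.
Proof.
move=> K0 e0; have eK : 0 < e / K by rewrite divr_gt0.
have := @nbhs0_lt C C _ eK; apply: filterS => y.
by rewrite ltr_pdivlMr // mulrC.
Qed.

Lemma cvg_at_dist_le (f : C -> C) (a l : C) : (f y @[y --> a] --> l) <->
  (forall e : C, 0 < e -> \forall y \near a, `|l - f y| <= e).
Proof. exact: (@cvgrPdist_le C C C (nbhs a) _ f l). Qed.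

Lemma analytic_near_cvg c : analytic c ->
  \forall y \near (0 : C), psum c y @ \oo --> pval c y.
Proof.
case=> M [K [M0 K0 gc]]; have := near0_mul_lt K0 ltr01; apply: filterS => y.
by apply: (cvg_psum _ K0 gc); exact: ltW.
Qed.

Lemma psum0 c n : psum c 0 n.+1 = c 0.
Proof.
rewrite psumE big_ord_recl expr0 mulr1 big1 ?addr0 // => i _.
by rewrite expr0n mulr0.
Qed.

Lemma cvg_psum0 c : psum c 0 @ \oo --> c 0.
Proof.
rewrite -(cvg_shiftS (psum c 0)); under eq_fun do rewrite psum0.
exact: cvg_cst.
Qed.

Lemma pvalP c y (l : C) : psum c y @ \oo --> l -> pval c y = l.
Proof. by move=> cl; rewrite pvalE; apply: cvg_lim => //; exact: norm_hausdorff. Qed.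

Lemma pval0 c : pval c 0 = c 0.
Proof. exact: pvalP (@cvg_psum0 c). Qed.

Lemma analytic_cvg0 c : analytic c -> pval c y @[y --> (0 : C)] --> c 0.
Proof.
case=> M [K [M0 K0 gc]]; apply/cvg_at_dist_le => e e0.
have MK : 0 < M * 2 * K by rewrite !mulr_gt0.
have h0 : 0 < 2^-1 :> C by rewrite invr_gt0.
move: (near0_mul_le K0 h0) (near0_mul_le MK e0); apply: filterS2 => y Ky2 /=.
apply: le_trans; have := pval_tail 1 (ltW M0) K0 gc Ky2.
by rewrite psumE big_ord1 !expr0 mulr1 expr1 -!mulrA distrC.
Qed.

(** The term of least degree with a nonzero coefficient dominates the tail, which is smaller by a
    factor of order |y|. *)
Lemma near_pval_neq0 c m : analytic c -> c m != 0 ->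
  \forall y \near (0 : C), y != 0 -> pval c y != 0.
Proof.
case=> M [K [M0 K0 gc]] cm0.
have [{cm0}m cm0 mmin] := ex_minnP (ex_intro (fun m => c m != 0) m cm0).
have cmp : 0 < `|c m| by rewrite normr_gt0.
have h0 : 0 < 2^-1 :> C by rewrite invr_gt0.
have MK : 0 < M * 2 * K ^+ m.+1 by rewrite !mulr_gt0 // exprn_gt0.
move: (near0_mul_le K0 h0) (near0_mul_lt MK cmp); apply: filterS2 => y.
move=> Ky2 yc y0; have := pval_tail m.+1 (ltW M0) K0 gc Ky2.
rewrite psumE big_ord_recr /= big1 ?add0r => [|i _]; last first.
  have [->|/mmin] := eqVneq (c i) 0; first by rewrite mul0r.
  by rewrite leqNgt ltn_ord.
apply: contraTneq => ->; rewrite sub0r normrN normrM normrX.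
have -> : M * 2 * (K * `|y|) ^+ m.+1 = M * 2 * K ^+ m.+1 * `|y| * `|y| ^+ m.
  by rewrite exprMn [`|y| ^+ m.+1]exprS; ring.
by rewrite lt_geF // ltr_pM2r // exprn_gt0 // normr_gt0.
Qed.

Lemma geomB (M K M' K' : C) c d : 0 < K -> 0 < K' -> geom M K c -> geom M' K' d ->
  geom (M + M') (K + K') (fun k => c k - d k).
Proof.
move=> K0 K0' gc gd k; have M0 := geom_ge0 K0 gc; have M0' := geom_ge0 K0' gd.
apply: le_trans (ler_normB _ _) _; rewrite mulrDl lerD //.
  have gc' : geom M (K + K') c by apply: geom_weaken gc; rewrite ?lerDl // ltW.
  exact: gc'.
have gd' : geom M' (K + K') d by apply: geom_weaken gd; rewrite ?lerDr // ltW.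
exact: gd'.
Qed.

Lemma analyticB c d : analytic c -> analytic d -> analytic (fun k => c k - d k).
Proof.
case=> M [K [M0 K0 gc]] [M' [K' [M0' K0' gd]]]; exists (M + M'), (K + K').
by split; rewrite ?addr_gt0 //; exact: geomB.
Qed.

(** The difference c - d has isolated zeros; this is why two different branches meet only over y =
    0. *)
Lemma near_pval_neq c d : analytic c -> analytic d -> c <> d ->
  \forall y \near (0 : C), y != 0 -> pval c y != pval d y.
Proof.
move=> ac ad cd; have [m] : exists m, c m - d m != 0.
  apply: contrapT => /forallNP cd0; apply: cd; apply/funext => m.
  by apply/eqP; rewrite -subr_eq0; apply: contrapT => /negP; exact: cd0.
move=> /(near_pval_neq0 (analyticB ac ad)).
move: (analytic_near_cvg ac) (analytic_near_cvg ad); apply: filterS3 => y yc yd + y0.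
move=> /(_ y0); suff -> : pval (fun k => c k - d k) y = pval c y - pval d y.
  by rewrite subr_eq0.
apply: pvalP; suff -> : psum (fun k => c k - d k) y = (fun n => psum c y n - psum d y n).
  exact: (cvgB yc yd).
apply/funext => n; rewrite !psumE -sumrB.
by apply: eq_bigr => i _; rewrite mulrBl.
Qed.

(** The series a + y c(y). It turns a branch u = c(y) of a blow-up into the branch x = a + y u of
    the original equation. *)
Definition cons_series (a : C) c k := if k is k'.+1 then c k' else a.

Lemma analytic_cons a c : analytic c -> analytic (cons_series a c).
Proof.
case=> M [K [M0 K0 gc]]; exists (`|a| + M * K^-1), K.
split=> //; first by rewrite ltr_wpDl // divr_gt0.
case=> [|k] /=; first by rewrite expr0 mulr1 lerDl divr_ge0 // ltW.
apply: le_trans (gc k) _; rewrite exprS mulrA ler_pM2r ?exprn_gt0 // mulrDl mulfVK.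
  by rewrite lerDr mulr_ge0 // ltW.
by rewrite gt_eqF.
Qed.

Lemma pval_cons a c : analytic c ->
  \forall y \near (0 : C), pval (cons_series a c) y = a + y * pval c y.
Proof.
move=> /analytic_near_cvg; apply: filterS => y yc; apply: pvalP.
rewrite -(cvg_shiftS (psum _ y)).
suff -> : (fun n => psum (cons_series a c) y n.+1) = (fun n => a + y * psum c y n).
  exact: (cvgD (cvg_cst a) (cvgM (cvg_cst y) yc)).
apply/funext => n; rewrite !psumE big_ord_recl expr0 mulr1 big_distrr; congr (_ + _).
by apply: eq_bigr => i _; rewrite /= exprS; ring.
Qed.

Definition deriv_series c k : C := k.+1%:R * c k.+1.

(** The factor k + 1 is at most 2^k, which doubling [K] absorbs. *)
Lemma geom_deriv (M K : C) c : 0 < K -> geom M K c ->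
  geom (M * K) (K * 2) (deriv_series c).
Proof.
move=> K0 gc k; rewrite normrM normr_nat.
apply: le_trans (ler_wpM2l (ler0n _ _) (gc k.+1)) _.
rewrite exprS exprMn mulrCA [X in _ <= X](_ : _ = M * (2 ^+ k * (K * K ^+ k))); last by ring.
apply: ler_wpM2l; first exact: geom_ge0 gc.
apply: ler_wpM2r; first by rewrite mulr_ge0 ?exprn_ge0 ?ltW.
by rewrite -natrX ler_nat ltn_expl.
Qed.

(** Induction: multiplying the remainder for k by y + h costs 2 r and the new term k y^(k-1) h^2
    costs r, whence the base 3 r. The factor r^2 on the left avoids a division. *)
Lemma taylor_exp_le (y h r : C) k : `|y| <= r -> `|h| <= r ->
  r ^+ 2 * `|(y + h) ^+ k - y ^+ k - k%:R * y ^+ k.-1 * h| <= (3 * r) ^+ k * `|h| ^+ 2.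
Proof.
move=> yr hr; have r0 : 0 <= r by apply: le_trans yr.
elim: k => [|k IH]; first by rewrite !expr0 subrr !mul0r subr0 normr0 mulr0 mul1r exprn_ge0.
have -> : (y + h) ^+ k.+1 - y ^+ k.+1 - k.+1%:R * y ^+ k.+1.-1 * h =
   (y + h) * ((y + h) ^+ k - y ^+ k - k%:R * y ^+ k.-1 * h) + k%:R * y ^+ k.-1 * h ^+ 2.
  by case: k {IH} => [|k] /=; rewrite ?expr0 ?expr1 ?(exprS (y + h)) ?(exprS y k.+1) ?(exprS y k) -?[in LHS]natr1; ring.
apply: le_trans (ler_wpM2l (exprn_ge0 _ r0) (ler_normD _ _)) _.
rewrite mulrDr !normrM normr_nat !normrX mulrCA.
have yh : `|y + h| <= 2 * r.
  by apply: le_trans (ler_normD _ _) _; rewrite mulr2n mulrDl mul1r lerD.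
have l1 : `|y + h| * (r ^+ 2 * `|(y + h) ^+ k - y ^+ k - k%:R * y ^+ k.-1 * h|)
    <= 2 * r * ((3 * r) ^+ k * `|h| ^+ 2) by apply: ler_pM => //; rewrite mulr_ge0 ?exprn_ge0.
have l2 : r ^+ 2 * (k%:R * `|y| ^+ k.-1 * `|h| ^+ 2) <= r * ((3 * r) ^+ k * `|h| ^+ 2).
  rewrite [X in X <= _]mulrA [X in _ <= X]mulrA ler_wpM2r ?exprn_ge0 // mulrA.
  case: k {IH l1} => [|k]; first by rewrite mulr0 mul0r mulr_ge0 ?exprn_ge0 ?mulr_ge0.
  rewrite /= exprMn (_ : r * (_ * _) = r ^+ 2 * 3 ^+ k.+1 * r ^+ k); last by rewrite (exprS r k); ring.
  apply: ler_pM; rewrite ?mulr_ge0 ?exprn_ge0 //; last by rewrite lerXn2r ?nnegrE.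
  by apply: ler_wpM2l; rewrite ?exprn_ge0 // -natrX ler_nat ltnW // ltn_expl.
apply: le_trans (lerD l1 l2) _; rewrite (exprS (3 * r)) le_eqVlt; apply/orP; left.
by apply/eqP; ring.
Qed.

Lemma pval_taylor (M K : C) c y h : 0 < K -> geom M K c ->
  6 * (K * `|y|) <= 1 -> 6 * (K * `|h|) <= 1 ->
  `|pval c (y + h) - pval c y - h * pval (deriv_series c) y| <= 72 * M * K ^+ 2 * `|h| ^+ 2.
Proof.
move=> K0 gc Ky Kh; have M0 := geom_ge0 K0 gc.
(* The 6 makes the ratio 3 K r of the remainders equal to 1/2; then r^-2 = 36 K^2 and a geometric
   sum at most 2 give the constant 72. *)
pose r := (6 * K)^-1.
have K60 : 0 < 6 * K by rewrite mulr_gt0.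
have r0 : 0 < r by rewrite invr_gt0.
have rE (z : C) : 6 * (K * `|z|) <= 1 -> `|z| <= r.
  by rewrite mulrA -ler_pdivlMl // mulr1.
have Kr : K * r = 6^-1 by rewrite /r invfM mulrCA divff ?mulr1 // gt_eqF.
have lt1' (z : C) : `|z| <= 2 * r -> K * `|z| < 1.
  move=> zr; have zr' : K * `|z| <= 2 * 6^-1 by rewrite -Kr mulrCA ler_pM2l.
  by apply: le_lt_trans zr' _; rewrite ltr_pdivrMr // mul1r ltr_nat.
have r2 : r <= 2 * r by rewrite mulr2n mulrDl mul1r lerDl ltW.
have yr := rE _ Ky; have hr := rE _ Kh.
have yh : `|y + h| <= 2 * r.
  by apply: le_trans (ler_normD _ _) _; rewrite mulr2n mulrDl mul1r lerD.
have c1 := cvg_psum M0 K0 gc (lt1' _ yh).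
have c2 := cvg_psum M0 K0 gc (lt1' _ (le_trans yr r2)).
have gd := geom_deriv K0 gc.
have Ky2 : K * 2 * `|y| < 1.
  rewrite mulrAC; have zr' : K * `|y| <= 6^-1 by rewrite -Kr ler_pM2l.
  have : K * `|y| * 2 <= 6^-1 * 2 by rewrite ler_pM2r.
  by move/le_lt_trans; apply; rewrite mulrC ltr_pdivrMr // mul1r ltr_nat.
have MK0 : 0 <= M * K by rewrite mulr_ge0 // ltW.
have K20 : 0 < K * 2 by rewrite mulr_gt0.
have c3 := cvg_psum MK0 K20 gd Ky2.
have := @cvg_norm_le _ (fun n => psum c (y + h) n.+1 - psum c y n.+1
   - h * psum (deriv_series c) y n) (pval c (y + h) - pval c y - h * pval (deriv_series c) y) 0.
move=> /(_ (72 * M * K ^+ 2 * `|h| ^+ 2) 0); rewrite subr0; apply.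
  move: c1 c2; rewrite -(cvg_shiftS (psum c (y + h))) -(cvg_shiftS (psum c y)) => c1 c2.
  exact: (cvgB (cvgB c1 c2) (cvgM (cvg_cst h) c3)).
move=> n _; rewrite subr0 !psumE.
rewrite big_ord_recl [X in _ - X - _]big_ord_recl !expr0 !mulr1 big_distrr /=.
rewrite opprD addrACA subrr add0r -!sumrB.
rewrite (eq_bigr (fun i : 'I_n => c i.+1 * ((y + h) ^+ i.+1 - y ^+ i.+1 - i.+1%:R * y ^+ i * h))); last first.
  by move=> i _; rewrite /deriv_series /bump /=; ring.
apply: le_trans (ler_norm_sum _ _ _) _.
apply: (@le_trans _ _ (\sum_(i < n) M * r ^- 2 * `|h| ^+ 2 * 2^-1 ^+ i)).
  apply: ler_sum => i _; rewrite normrM.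
  have := taylor_exp_le i.+1 yr hr; rewrite -ler_pdivlMl ?exprn_gt0 // => tl.
  apply: le_trans (ler_pM _ _ (gc _) tl) _ => //.
  rewrite [X in X <= _](_ : _ = M * r ^- 2 * `|h| ^+ 2 * (3 * (K * r)) ^+ i.+1); last first.
    by rewrite ![(_ * _) ^+ i.+1]exprMn; ring.
  apply: ler_wpM2l; first by rewrite !mulr_ge0 ?invr_ge0 ?exprn_ge0 // ltW.
  rewrite Kr (_ : 3 * 6^-1 = 2^-1); last by field.
  by rewrite exprS ler_piMl ?exprn_ge0 ?invr_ge0 // ltW // half_lt1.
rewrite -big_distrr /=; have h20 : 0 < 2^-1 :> C by rewrite invr_gt0.
have s2 := @geometric_sum_le R (2^-1) n (ltW h20) (lexx _).
apply: le_trans (ler_wpM2l _ s2) _; first by rewrite !mulr_ge0 ?invr_ge0 ?exprn_ge0 // ltW.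
rewrite le_eqVlt; apply/orP; left; apply/eqP; rewrite /r; field.
by rewrite gt_eqF.
Qed.

Lemma differentiable_pval c : analytic c ->
  \forall y \near (0 : C), differentiable (pval c : C -> C) y.
Proof.
case=> M [K [M0 K0 gc]]; have e6 : 0 < 6^-1 :> C by rewrite invr_gt0.
have le6 (z : C) : K * `|z| <= 6^-1 -> 6 * (K * `|z|) <= 1.
  by rewrite -(ler_pM2l (ltr0n C 6)) divff // pnatr_eq0.
have := near0_mul_le K0 e6; apply: filterS => y Ky.
apply/derivable1_diffP; apply: (cvgP (pval (deriv_series c) y)).
apply/(@cvgrPdist_le C C C (0^') _) => e e0.
have BK : 0 < 72 * M * K ^+ 2 by rewrite !mulr_gt0 ?exprn_gt0.
apply: filterS3 (nbhs_dnbhs (near0_mul_le K0 e6)) (nbhs_dnbhs (near0_mul_le BK e0)) (nbhs_dnbhs_neq (0 : C)).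
move=> h /= Kh eh h0; have tl := pval_taylor K0 gc (le6 _ Ky) (le6 _ Kh).
have hp : 0 < `|h| by rewrite normr_gt0.
have l3 : 72 * M * K ^+ 2 * `|h| ^+ 2 <= `|h| * e by rewrite [`|h| ^+ 2]expr2 mulrA [`|h| * e]mulrC ler_pM2r.
rewrite -(ler_pM2l hp) -normrM; apply: le_trans l3.
apply: le_trans tl; rewrite -normrN le_eqVlt; apply/orP; left; apply/eqP; congr `|_|.
rewrite /GRing.scale /= mulr1 mulrBr mulrA divff // mul1r opprB [h + y]addrC.
by ring.
Qed.

End AnalyticSeries.

(** * A weighted l1 norm on polynomials *)

Section PolyNorm.
Variable C : numClosedFieldType.
Implicit Types (p q : {poly C}) (r : C).

(** The l1 norm of radius r. It is submultiplicative and bounds both the values on the closed disc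
    and the coefficients, which replaces the maximum norm together with Cauchy's estimates. *)
Definition pnorm r p : C := \sum_(i < size p) `|p`_i| * r ^+ i.

Lemma pnorm_wide r n p : (size p <= n)%N -> pnorm r p = \sum_(i < n) `|p`_i| * r ^+ i.
Proof.
move=> pn; rewrite /pnorm -!(big_mkord xpredT (fun i => `|p`_i| * r ^+ i)).
rewrite (big_cat_nat (n := size p) (p := n)) //= [X in _ + X]big_nat_cond.
rewrite [X in _ + X]big1 ?addr0 // => i; rewrite andbT => /andP[pi _].
by rewrite nth_default // normr0 mul0r.
Qed.

Lemma pnorm_ge0 r p : 0 <= r -> 0 <= pnorm r p.
Proof. by move=> r0; apply: sumr_ge0 => i _; rewrite mulr_ge0 ?exprn_ge0. Qed.

Lemma pnormD r p q : 0 <= r -> pnorm r (p + q) <= pnorm r p + pnorm r q.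
Proof.
move=> r0; have n1 := leq_maxl (size p) (size q); have n2 := leq_maxr (size p) (size q).
rewrite (pnorm_wide r n1) (pnorm_wide r n2) (pnorm_wide r (size_polyD p q)) -big_split /=.
apply: ler_sum => i _; rewrite coefD -mulrDl ler_wpM2r ?exprn_ge0 //.
exact: ler_normD.
Qed.

Lemma pnormZ r (a : C) p : pnorm r (a *: p) = `|a| * pnorm r p.
Proof.
rewrite (pnorm_wide r (size_scale_leq a p)) big_distrr; apply: eq_bigr => i _.
by rewrite coefZ normrM -mulrA.
Qed.

Lemma pnormN r p : pnorm r (- p) = pnorm r p.
Proof. by rewrite -scaleN1r pnormZ normrN1 mul1r. Qed.

Lemma pnorm0 r : pnorm r 0 = 0.
Proof. by rewrite /pnorm size_poly0 big_ord0. Qed.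

Lemma pnorm1 r : pnorm r 1 = 1.
Proof. by rewrite /pnorm size_poly1 big_ord1 coef1 normr1 mul1r. Qed.

Lemma pnorm_sum r (I : Type) (s : seq I) (P : pred I) (F : I -> {poly C}) : 0 <= r ->
  pnorm r (\sum_(i <- s | P i) F i) <= \sum_(i <- s | P i) pnorm r (F i).
Proof.
move=> r0; elim/big_rec2: _ => [|i y1 y2 _ IH]; first by rewrite pnorm0.
by apply: le_trans (pnormD _ _ r0) _; rewrite lerD2l.
Qed.

Lemma pnormXnM r n p : pnorm r ('X^n * p) = r ^+ n * pnorm r p.
Proof.
rewrite (@pnorm_wide _ (n + size p)); last first.
  by apply: leq_trans (size_polyMleq _ _) _; rewrite size_polyXn.
rewrite big_split_ord /= big1 ?add0r => [|i _]; last first.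
  by rewrite coefXnM ltn_ord normr0 mul0r.
rewrite big_distrr; apply: eq_bigr => i _.
by rewrite coefXnM ltnNge leq_addr /= addKn exprD mulrCA.
Qed.

Lemma pnormM r p q : 0 <= r -> pnorm r (p * q) <= pnorm r p * pnorm r q.
Proof.
move=> r0; rewrite -{1}(coefK p) poly_def big_distrl /=.
apply: le_trans (pnorm_sum _ _ _ r0) _; rewrite [pnorm r p]/pnorm big_distrl /=.
by apply: ler_sum => i _; rewrite -scalerAl pnormZ pnormXnM mulrA.
Qed.

Lemma pnormX r p n : 0 <= r -> pnorm r (p ^+ n) <= pnorm r p ^+ n.
Proof.
move=> r0; elim: n => [|n IH]; first by rewrite !expr0 pnorm1.
by rewrite !exprS; apply: le_trans (pnormM _ _ r0) _; rewrite ler_wpM2l ?pnorm_ge0.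
Qed.

Lemma horner_le_pnorm r p x : `|x| <= r -> `|p.[x]| <= pnorm r p.
Proof.
move=> xr; rewrite horner_coef; apply: le_trans (ler_norm_sum _ _ _) _.
apply: ler_sum => i _; rewrite normrM normrX ler_wpM2l // lerXn2r ?nnegrE //.
by apply: le_trans xr.
Qed.

Lemma coef_le_pnorm r p k : 0 <= r -> `|p`_k| * r ^+ k <= pnorm r p.
Proof.
move=> r0; have [kp|pk] := ltnP k (size p); last first.
  by rewrite nth_default // normr0 mul0r pnorm_ge0.
rewrite /pnorm (bigD1 (Ordinal kp)) //= lerDl.
by apply: sumr_ge0 => i _; rewrite mulr_ge0 ?exprn_ge0.
Qed.

(** For k >= n, |x|^k is at most r^k (|x| / r)^n, so one norm controls the whole tail. *)
Lemma horner_tail_le r p n x : 0 < r -> `|x| <= r ->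
  `|p.[x] - \sum_(k < n) p`_k * x ^+ k| <= pnorm r p * (`|x| / r) ^+ n.
Proof.
move=> r0 xr; have n1 : (size p <= n + size p)%N by rewrite leq_addl.
have rn0 := ltW r0; have xr1 : `|x| / r <= 1 by rewrite ler_pdivrMr // mul1r.
rewrite (horner_coef_wide _ n1) (pnorm_wide r n1) big_split_ord /= addrAC subrr add0r.
apply: le_trans (ler_norm_sum _ _ _) _.
rewrite big_split_ord /= mulrDl big_distrl /= [X in _ <= _ + X]big_distrl /=.
rewrite -[X in X <= _]add0r; apply: lerD.
  by apply: sumr_ge0 => i _; rewrite !mulr_ge0 ?exprn_ge0 // mulr_ge0 ?invr_ge0.
apply: ler_sum => i _; rewrite normrM normrX -mulrA ler_wpM2l //.
have -> : r ^+ (n + i) * (`|x| / r) ^+ n = `|x| ^+ n * r ^+ i.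
  have rn : r ^+ n != 0 by rewrite expf_neq0 ?gt_eqF.
  by rewrite exprMn exprVn exprD; move: (r ^+ n) rn => t t0; field.
by rewrite exprD ler_wpM2l ?exprn_ge0 // lerXn2r ?nnegrE.
Qed.

Lemma pnorm_poly r n (E : nat -> C) : pnorm r (\poly_(i < n) E i) = \sum_(i < n) `|E i| * r ^+ i.
Proof.
rewrite (pnorm_wide r (size_poly n E)).
by apply: eq_bigr => i _; rewrite coef_poly ltn_ord.
Qed.

End PolyNorm.

(** * Composition of power series *)

Section Composition.
Variable R : realType.
Local Notation C := (CC R).
Implicit Types (c d : nat -> C) (y s : C).

Lemma coef_dvdXn (p : {poly C}) m k : 'X^m %| p -> (k < m)%N -> p`_k = 0.
Proof. by move=> /dvdpP[q ->] km; rewrite coefMXn km. Qed.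

Lemma dvdXn_trunc (n : nat) d m : (forall k, (k < m)%N -> d k = 0) ->
  'X^m %| \poly_(k < n) d k.
Proof.
move=> d0; rewrite poly_def; apply: (big_ind (fun p : {poly C} => ('X^m %| p)%R)) => [|x y|i _]; first exact: dvdp0.
  exact: dvdp_add.
have [im|mi] := ltnP i m; first by rewrite d0 // scale0r dvdp0.
by rewrite -mul_polyC dvdp_mull // dvdp_exp2l.
Qed.

Lemma horner_trunc n c x : (\poly_(k < n) c k).[x] = psum c x n.
Proof. by rewrite horner_poly psumE. Qed.

(** If d 0 = 0, the i-th power of d starts in degree i: coefficient k of the composite involves only
    i <= k and the first k + 1 terms of d. Hence the choice n = k + 1 in [comp_series]. *)
Definition comp_trunc c d n : {poly C} := \sum_(i < n) c i *: (\poly_(k < n) d k) ^+ i.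
Definition comp_series c d k : C := (comp_trunc c d k.+1)`_k.

Lemma coef_comp_trunc c d n k : d 0 = 0 -> (k < n)%N ->
  (comp_trunc c d n)`_k = comp_series c d k.
Proof.
move=> d0 kn; rewrite /comp_series /comp_trunc !coef_sum -(subnKC kn).
rewrite big_split_ord /= [X in _ + X]big1 ?addr0 => [|i _]; last first.
  rewrite coefZ; have Xd : 'X %| \poly_(j < k.+1 + (n - k.+1)) d j.
    by rewrite -['X]expr1; apply: dvdXn_trunc => -[].
  have := dvdp_exp2r (k.+1 + i) Xd => /coef_dvdXn -> //; first by rewrite mulr0.
  by rewrite ltnS leq_addr.
apply: eq_bigr => i _; rewrite !coefZ; congr (_ * _); apply/eqP; rewrite -subr_eq0 -coefB.
apply/eqP/(@coef_dvdXn _ k.+1) => //; rewrite subrXX; apply: dvdp_mulr.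
rewrite (_ : _ - _ = \poly_(j < k.+1 + (n - k.+1)) (if (j < k.+1)%N then 0 else d j)).
  by apply: dvdXn_trunc => j ->.
apply/polyP => j; rewrite coefB !coef_poly.
have [jk|kj] := ltnP j k.+1; last by rewrite subr0.
by rewrite (leq_trans jk (leq_addr _ _)) subrr.
Qed.

(** With d 0 = 0 the sum starts in degree 1, which yields the small factor K' r. *)
Lemma pnorm_trunc_le (M' K' r : C) d n : 0 < K' ->
  geom M' K' d -> d 0 = 0 -> 0 <= r -> K' * r <= 2^-1 ->
  pnorm r (\poly_(k < n) d k) <= M' * 2 * (K' * r).
Proof.
move=> K0' gd d0 r0 K'r; have M0' := geom_ge0 K0' gd; rewrite pnorm_poly.
case: n => [|n]; first by rewrite big_ord0 !mulr_ge0 // ltW.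
rewrite big_ord_recl /= d0 normr0 mul0r add0r.
apply: (@le_trans _ _ (\sum_(i < n) M' * (K' * r) * (K' * r) ^+ i)).
  by apply: ler_sum => i _; rewrite -mulrA -exprS exprMn mulrA ler_wpM2r ?exprn_ge0.

rewrite -big_distrr /= -!(mulrA M') ler_wpM2l // mulrC.
by rewrite ler_wpM2r ?geometric_sum_le ?mulr_ge0 // ltW.
Qed.

(** For r small the truncations of d have norm at most 1 / (2 K), so that all truncated composites
    have norm at most 2 M; the coefficient bound follows from this uniform estimate. *)
Lemma analytic_comp c d : analytic c -> analytic d -> d 0 = 0 ->
  analytic (comp_series c d) /\
  \forall s \near (0 : C), pval (comp_series c d) s = pval c (pval d s).
Proof.
move=> ac [M' [K' [M0' K0' gd]]] d0; have [M [K [M0 K0 gc]]] := ac.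
have /nbhs_ballP[rho /= rho0 rhoc] := differentiable_pval ac.
(* The radius [r] has three duties: d converges, its truncations stay within half the radius of c,
   and its values stay in the disc of radius [rho] where [pval c] is continuous. *)
have [r [r0 Kr rK rr]] : exists r : C, [/\ 0 < r, K' * r <= 2^-1,
    K * (M' * 2 * (K' * r)) <= 2^-1 & M' * 2 * (K' * r) < rho].
  have h0 : 0 < 2^-1 :> C by rewrite invr_gt0.
  have A0 : 0 < K * (M' * 2 * K') by rewrite !mulr_gt0.
  have B0 : 0 < M' * 2 * K' by rewrite !mulr_gt0.
  have [e /= e0] := (nbhs_ballP _ _).1 (filterI (near0_mul_le K0' h0)
    (filterI (near0_mul_le A0 h0) (near0_mul_lt B0 rho0))).
  move=> /(_ (e / 2)) [|r1 [r2 r3]].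
    by rewrite /ball /= sub0r normrN gtr0_norm ?divr_gt0 // ltr_pdivrMr // ltr_pMr // ltr1n.
  have e20 : 0 < e / 2 by rewrite divr_gt0.
  by exists (e / 2); move: r1 r2 r3; rewrite gtr0_norm // !mulrA.
have r0' := ltW r0.
have pD n := pnorm_trunc_le n K0' gd d0 r0' Kr.
have pQ n : pnorm r (comp_trunc c d n) <= M * 2.
  apply: le_trans (pnorm_sum _ _ _ r0') _.
  apply: (@le_trans _ _ (\sum_(i < n) M * 2^-1 ^+ i)); last first.
    rewrite -big_distrr /=; apply: ler_wpM2l; first exact: ltW.
    by apply: geometric_sum_le; rewrite ?invr_ge0.
  apply: ler_sum => i _; rewrite pnormZ.
  apply: (@le_trans _ _ (M * K ^+ i * (M' * 2 * (K' * r)) ^+ i)).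
    apply: ler_pM; rewrite ?pnorm_ge0 //.
    by apply: le_trans (pnormX _ _ r0') _; rewrite lerXn2r ?nnegrE ?pnorm_ge0 // !mulr_ge0 // ltW.
  rewrite -mulrA -exprMn; apply: ler_wpM2l; first exact: ltW.
  rewrite lerXn2r ?nnegrE ?invr_ge0 //.
  by rewrite !mulr_ge0 // ltW.
have ge : geom (M * 2) r^-1 (comp_series c d).
  move=> k; rewrite exprVn ler_pdivlMr ?exprn_gt0 //.
  exact: le_trans (coef_le_pnorm _ _ r0') (pQ _).
have Vr0 : 0 < r^-1 by rewrite invr_gt0.
split; first by exists (M * 2), r^-1; rewrite mulr_gt0.
have h0 : 0 < 2^-1 :> C by rewrite invr_gt0.
have := near0_mul_le Vr0 h0; apply: filterS => s sr.
have s1 : r^-1 * `|s| < 1 by apply: le_lt_trans sr (half_lt1 R).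
have sr' : `|s| <= r by move/ltW: (s1); rewrite ler_pdivrMl // mulr1.
apply: pvalP.
have Ks : K' * `|s| < 1 by apply: le_lt_trans (le_trans _ Kr) (half_lt1 R); rewrite ler_pM2l.
have cd := cvg_psum (ltW M0') K0' gd Ks.
have xn n : `|psum d s n| <= M' * 2 * (K' * r).
  by rewrite -horner_trunc; apply: le_trans (horner_le_pnorm _ sr') (pD n).
have x0 : `|pval d s| < rho.
  apply: le_lt_trans rr; rewrite -[pval d s]subr0; apply: (cvg_norm_le (n0 := 0) cd).
  by move=> n _; rewrite subr0.
have /differentiable_continuous : differentiable (pval c : C -> C) (pval d s).
  by apply: rhoc; rewrite /ball /= sub0r normrN.
move=> /(continuous_cvg _)/(_ cd) /= c3.
have c1 : psum c (psum d s n) n - pval c (psum d s n) @[n --> \oo] --> (0 : C).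
  apply/cvgrPdist_le => e e0; have M20 : 0 <= M * 2 by rewrite mulr_ge0 // ltW.
  have := @cvg_geometric0 R (M * 2) 2^-1 (ltW h0) (half_lt1 R).
  move=> /(cvgr_dist_le _ _)/(_ e e0); apply: filterS => n; rewrite !sub0r !normrN.
  apply: le_trans; rewrite distrC; apply: le_trans (pval_tail n (ltW M0) K0 gc _) _.
    by apply: le_trans rK; rewrite ler_pM2l.
  rewrite [X in _ <= X]ger0_norm; last by rewrite mulr_ge0 ?exprn_ge0 // ltW.
  apply: ler_wpM2l => //; apply: lerXn2r; rewrite ?nnegrE.
  - by rewrite mulr_ge0 // ltW.
  - exact: ltW.
  - by apply: le_trans rK; rewrite ler_pM2l.
have c2 : psum (comp_series c d) s n - psum c (psum d s n) n @[n --> \oo] --> (0 : C).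
  apply/cvgrPdist_le => e e0; have M20 : 0 <= M * 2 by rewrite mulr_ge0 // ltW.
  have := @cvg_geometric0 R (M * 2) (`|s| / r) (mulr_ge0 (normr_ge0 _) (ltW Vr0)).
  rewrite mulrC s1 => /(_ isT)/(cvgr_dist_le _ _)/(_ e e0); apply: filterS => n; rewrite !sub0r !normrN.
  apply: le_trans; rewrite distrC.
  have -> : psum c (psum d s n) n = (comp_trunc c d n).[s].
    rewrite psumE /comp_trunc horner_sum; apply: eq_bigr => i _.
    by rewrite hornerZ horner_exp horner_trunc.
  have -> : psum (comp_series c d) s n = \sum_(k < n) (comp_trunc c d n)`_k * s ^+ k.
    by rewrite psumE; apply: eq_bigr => i _; rewrite coef_comp_trunc.
  apply: le_trans (horner_tail_le _ _ r0 sr') _.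
  rewrite [X in _ <= X]ger0_norm; last by rewrite mulr_ge0 ?exprn_ge0 // mulr_ge0 // ltW.
  by rewrite mulrC [X in _ <= X]mulrC mulrC [`|s| / r]mulrC ler_wpM2r ?exprn_ge0 // mulr_ge0 // ltW.
(* Telescoping: the truncated composite against the truncated c at the partial sum of d, then
   against c at that point, then continuity of c. *)
have cc := cvgD (cvgD c2 c1) c3; rewrite !add0r in cc.
suff -> : psum (comp_series c d) s = (fun n => psum (comp_series c d) s n
    - psum c (psum d s n) n + (psum c (psum d s n) n - pval c (psum d s n))
    + pval c (psum d s n)) by exact: cc.
by apply/funext => n; rewrite addrA subrK subrK.
Qed.

End Composition.

(** * Continuity of roots and the implicit function theorem *)

Section Slices.
Variable C : numClosedFieldType.
Implicit Types (G : {poly {poly C}}) (q : {poly C}).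

Definition slice G (y : C) : {poly C} := map_poly (horner_eval y) G.

Lemma horner_slice G x y : (slice G y).[x] = G.[x, y].
Proof.
by rewrite /slice -{1}[x](hornerC x y) -[_.[y]]/(horner_eval y _) horner_map.
Qed.

Lemma coef_slice G y i : (slice G y)`_i = (G`_i).[y].
Proof. by rewrite coef_map. Qed.

Lemma size_slice G y : (size (slice G y) <= size G)%N.
Proof. exact: size_poly. Qed.

Lemma horner2_shift G a x y : (G \Po ('X + a%:P%:P)).[x, y] = G.[x + a, y].
Proof. by rewrite horner_comp !hornerE -polyCD. Qed.

Lemma slice_shift G a y : slice (G \Po ('X + a%:P%:P)) y = slice G y \Po ('X + a%:P).
Proof.
rewrite /slice map_comp_poly rmorphD /= map_polyX map_polyC /=.
by rewrite /horner_eval hornerC.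
Qed.

(** All roots satisfy |z| >= r, so a factor X - z has norm at most r + |z| <= 2 |z|, twice its
    absolute value at 0; multiply over the roots. *)
Lemma coef_le_noroot q (r : C) j : 0 < r -> (forall x, `|x| < r -> q.[x] != 0) ->
  `|q`_j| * r ^+ j <= 2 ^+ (size q).-1 * `|q.[0]|.
Proof.
move=> r0 nr; apply: le_trans (coef_le_pnorm _ _ (ltW r0)) _.
have [rs qE] := closed_field_poly_normal q.
have q0 : q != 0 by apply: contraTneq (nr 0 _) => [->|]; rewrite ?normr0 // horner0 eqxx.
have rsr : all (fun x => r <= `|x|) rs.
  apply/allP => x xrs; rewrite real_leNgt ?normr_real ?gtr0_real //; apply/negP => /nr.
  by rewrite -/(root q x) qE rootZ ?lead_coef_eq0 // root_prod_XsubC xrs.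
have -> : (size q).-1 = size rs.
  by rewrite qE size_scale ?lead_coef_eq0 // size_prod_XsubC.
rewrite qE pnormZ hornerZ normrM mulrCA ler_wpM2l //.
elim: rs rsr {qE} => [_|x rs IH /= /andP[xr rsr]].
  by rewrite big_nil pnorm1 hornerC normr1 mulr1.
rewrite big_cons hornerM normrM; apply: le_trans (pnormM _ _ (ltW r0)) _.
have rn0 := ltW r0; rewrite exprS mulrACA; apply: ler_pM; rewrite ?pnorm_ge0 ?IH //.
apply: le_trans (pnormD _ _ (ltW r0)) _; rewrite pnormN hornerXsubC sub0r normrN.
rewrite -['X]mulr1 -['X]expr1 pnormXnM pnorm1 expr1 mulr1.
move: xr; have [->|x0 xr] := eqVneq x 0; first by rewrite pnorm0 normr0 mulr0 addr0.
rewrite /pnorm size_polyC x0 big_ord1 coefC eqxx expr0 mulr1.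
by rewrite [X in _ <= X](_ : _ = `|x| + `|x|) ?lerD2r //; ring.
Qed.

Lemma pnorm_coef0_le q (r : C) : 0 <= r -> r <= 1 -> q`_0 = 0 -> pnorm r q <= r * pnorm 1 q.
Proof.
move=> r0 r1 q0; rewrite /pnorm big_distrr; apply: ler_sum => -[[|i] ?] _ /=.
  by rewrite q0 normr0 !mul0r mulr0.
by rewrite expr1n mulr1 exprS mulrA [X in _ <= X]mulrC -[X in _ <= X]mulr1 ler_wpM2l ?mulr_ge0 // exprn_ile1.
Qed.

Lemma pnorm_le1 q (r : C) : 0 <= r -> r <= 1 -> pnorm r q <= pnorm 1 q.
Proof.
move=> r0 r1; apply: ler_sum => i _; rewrite expr1n ler_wpM2l // exprn_ile1 //.
Qed.

End Slices.

Section Persistence.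
Variable R : realType.
Local Notation C := (CC R).
Implicit Types (G : {poly {poly C}}) (q : {poly C}).

Lemma cvg_horner q T (F : set_system T) (FF : Filter F) (u : T -> C) (a : C) :
  u @ F --> a -> (fun t => q.[u t]) @ F --> q.[a].
Proof.
move=> ua; elim/poly_ind: q => [|q c IH].
  rewrite horner0 (_ : (fun t => _) = fun=> 0); first exact: cvg_cst.
  by apply/funext => t; rewrite horner0.
rewrite hornerMXaddC (_ : (fun t => _) = fun t => q.[u t] * u t + c).
  exact: (cvgD (cvgM IH ua) (cvg_cst c)).
by apply/funext => t; rewrite hornerMXaddC.
Qed.

Lemma near_horner_norm_gt q (a e : C) : e \is Num.real -> e < `|q.[a]| ->
  \forall y \near a, e < `|q.[y]|.
Proof.
move=> er ea; have d0 : 0 < `|q.[a]| - e by rewrite subr_gt0.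
have dq : \forall y \near a, `|q.[a] - q.[y]| < `|q.[a]| - e.
  exact: cvgr_dist_lt _ _ (@cvg_horner q C (nbhs a) _ id a cvg_id) _ d0.
move: dq; apply: filterS => y.
rewrite ltrBrDr; apply: contraTT; rewrite -!real_leNgt ?realD ?normr_real // => ye.
apply: le_trans (_ : `|q.[a]| - `|q.[y]| + e <= _).
  by rewrite -addrA lerDl addrC subr_ge0.
by rewrite lerD2r; apply: le_trans (lerB_dist _ _).
Qed.

Lemma near_horner_norm_lt q (a e : C) : `|q.[a]| < e -> \forall y \near a, `|q.[y]| < e.
Proof.
move=> ea; have := cvgr_norm_lt _ (@cvg_horner q C (nbhs a) _ id a cvg_id) _ ea; exact.
Qed.

(* Continuity of the roots, from Cauchy-type bounds on the coefficients of a
   polynomial with no root in a disc. *)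
Lemma near_root0 G (r : C) : 0 < r -> slice G 0 != 0 -> G.[0, 0] = 0 ->
  \forall y \near (0 : C), exists2 x, `|x| < r & G.[x, y] = 0.
Proof.
move=> r0 G0 Ga.
have [j gj] : exists j, (G`_j).[0] != 0.
  apply: contrapT => /forallNP g0; move/negP: G0; apply; apply/eqP/polyP => j.
  by rewrite coef0 coef_slice; apply/eqP/negP => /negP; exact: g0.
(* A slice without a root in the disc satisfies [coef_le_noroot], with a j-th coefficient bounded
   away from 0; a constant term smaller than [e] contradicts this. *)
pose e := `|(G`_j).[0]| / 2 * r ^+ j / 2 ^+ size G.
have gp : 0 < `|(G`_j).[0]| by rewrite normr_gt0.
have e0 : 0 < e by rewrite /e !mulr_gt0 ?invr_gt0 ?exprn_gt0.
have h1 : \forall y \near (0 : C), `|(G`_j).[0]| / 2 < `|(G`_j).[y]|.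
  apply: near_horner_norm_gt; first by rewrite gtr0_real // divr_gt0.
  by rewrite ltr_pdivrMr // ltr_pMr // ltr1n.
have h2 : \forall y \near (0 : C), `|(G`_0).[y]| < e.
  apply: near_horner_norm_lt; rewrite -[(G`_0).[0]]coef_slice -horner_coef0 horner_slice.
  by rewrite Ga normr0.
apply: filterS2 h1 h2 => y y1 y2; apply: contrapT => nr.
have := @coef_le_noroot C (slice G y) r j r0.
have nr' x : `|x| < r -> (slice G y).[x] != 0.
  by move=> xr; apply/eqP => x0; apply: nr; exists x => //; rewrite -horner_slice.
move=> /(_ nr'); apply/negP; rewrite -real_ltNge ?realM ?realX ?normr_real ?gtr0_real //.
rewrite horner_coef0 !coef_slice.
apply: (@le_lt_trans _ _ (2 ^+ size G * `|(G`_0).[y]|)).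
  rewrite ler_wpM2r // -!natrX ler_nat leq_exp2l //.
  by apply: leq_trans (leq_pred _) (size_slice _ _).
have p2 : 0 < (2 : C) ^+ size G by rewrite exprn_gt0.
apply: lt_trans (_ : `|(G`_j).[0]| / 2 * r ^+ j < _); last by rewrite ltr_pM2r ?exprn_gt0.
by rewrite mulrC -ltr_pdivlMr.
Qed.

Lemma near_root G (a r : C) : 0 < r -> slice G 0 != 0 -> G.[a, 0] = 0 ->
  \forall y \near (0 : C), exists2 x, `|x - a| < r & G.[x, y] = 0.
Proof.
move=> r0 G0 Ga; pose G1 := G \Po ('X + a%:P%:P).
have : \forall y \near (0 : C), exists2 x, `|x| < r & G1.[x, y] = 0.
  apply: near_root0 => //; last by rewrite horner2_shift add0r.
  by rewrite slice_shift comp_poly_eq0 // size_XaddC.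
apply: filterS => y [x xr Gx]; exists (x + a); first by rewrite addrK.
by rewrite -horner2_shift.
Qed.

End Persistence.

(** * The implicit function theorem by Picard iteration *)

Section ImplicitFunction.
Variable R : realType.
Local Notation C := (CC R).
Implicit Types (G T : {poly {poly C}}) (P : {poly C}).

Lemma horner_horner T P y : T.[P].[y] = T.[P.[y], y].
Proof.
rewrite (horner_coef T P) horner_sum (horner_coef T _%:P) horner_sum.
by apply: eq_bigr => i _; rewrite !hornerM !horner_exp hornerC.
Qed.

Lemma pnormC (r a : C) : pnorm r a%:P = `|a|.
Proof. by rewrite -[a%:P]mulr1 mul_polyC pnormZ pnorm1 mulr1. Qed.

Lemma dvdX_coef0 P : P`_0 = 0 -> 'X %| P.
Proof. by move=> P0; rewrite -['X]subr0 -polyC0 dvdp_XsubCl /root horner_coef0 P0. Qed.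

Definition divdiff T (P P' : {poly C}) : {poly C} :=
  \sum_(i < size T) T`_i * \sum_(j < i) P ^+ (i.-1 - j) * P' ^+ j.

Lemma divdiffE T P P' : T.[P] - T.[P'] = (P - P') * divdiff T P P'.
Proof.
rewrite !horner_coef -sumrB big_distrr; apply: eq_bigr => i _ /=.
by rewrite -mulrBr subrXX mulrCA; congr (_ * (_ * _)).
Qed.

(** The linear coefficient of T vanishes at y = 0 and contributes O(r), while the higher ones carry
    a factor rho: this bounds the Lipschitz constant of the iteration. *)
Lemma pnorm_divdiff_le T P P' (r rho : C) : 0 <= r -> r <= 1 -> 0 <= rho -> rho <= 1 ->
  pnorm r P <= rho -> pnorm r P' <= rho -> T`_1`_0 = 0 ->
  pnorm r (divdiff T P P') <= r * pnorm 1 T`_1 + rho * \sum_(i < size T) pnorm 1 T`_i * i%:R.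
Proof.
move=> r0 r1 rho0 rho1 Pr Pr' T10; apply: le_trans (pnorm_sum _ _ _ r0) _.
have b i : pnorm r (T`_i * \sum_(j < i) P ^+ (i.-1 - j) * P' ^+ j) <=
    pnorm r T`_i * (i%:R * rho ^+ i.-1).
  apply: le_trans (pnormM _ _ r0) _; apply: ler_wpM2l; first exact: pnorm_ge0.
  apply: le_trans (pnorm_sum _ _ _ r0) _.
  apply: (@le_trans _ _ (\sum_(j < i) rho ^+ i.-1)); last by rewrite sumr_const card_ord [i%:R * _]mulr_natl.
  apply: ler_sum => j _; apply: le_trans (pnormM _ _ r0) _.
  have -> : rho ^+ i.-1 = rho ^+ (i.-1 - j) * rho ^+ j.
    by rewrite -exprD subnK //; case: i j => [[]//|n] j /=; rewrite -ltnS.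
  apply: ler_pM; rewrite ?pnorm_ge0 //.
    by apply: le_trans (pnormX _ _ r0) _; rewrite lerXn2r ?nnegrE ?pnorm_ge0.
  by apply: le_trans (pnormX _ _ r0) _; rewrite lerXn2r ?nnegrE ?pnorm_ge0.
apply: (@le_trans _ _ (\sum_(i < size T) pnorm r T`_i * (i%:R * rho ^+ i.-1))).
  by apply: ler_sum => i _; exact: b.
have -> : r * pnorm 1 T`_1 = \sum_(i < size T) (if i == 1 :> nat then r * pnorm 1 T`_1 else 0).
  rewrite -big_mkcond /=; have [T1|T1] := ltnP 1 (size T).
    by rewrite (big_pred1 (Ordinal T1)).
  by rewrite big1 ?nth_default ?pnorm0 ?mulr0.
rewrite [rho * _]big_distrr -big_split /=; apply: ler_sum => -[[|[|i]] ilt] _ /=.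
- by rewrite mul0r !mulr0 addr0.
- rewrite expr0 !mulr1; apply: le_trans (pnorm_coef0_le r0 r1 T10) _.
  by rewrite lerDl mulr_ge0 ?pnorm_ge0.
rewrite add0r [X in _ <= X]mulrCA; apply: ler_pM; rewrite ?mulr_ge0 ?pnorm_ge0 ?exprn_ge0 //.
  exact: pnorm_le1.
by rewrite mulrC ler_wpM2r // exprS ler_piMr // exprn_ile1.
Qed.

(* Contraction of the Picard iteration x := x - G(x, y) / G_x(0, 0), on numbers
   and on polynomials in y alike. *)
Lemma picard_contraction T : T`_0`_0 = 0 -> T`_1`_0 = 0 -> forall rho0 : C, 0 < rho0 ->
  exists r rho : C, [/\ 0 < r, 0 < rho, rho <= rho0,
    (forall P, pnorm r P <= rho -> pnorm r T.[P] <= rho) &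
    (forall P P', pnorm r P <= rho -> pnorm r P' <= rho ->
       pnorm r (T.[P] - T.[P']) <= 2^-1 * pnorm r (P - P'))].
Proof.
move=> T00 T10 rho0 rho00.
pose B := 1 + \sum_(i < size T) pnorm 1 T`_i * i%:R.
have B0 : 0 < B.
  by rewrite ltr_wpDr // sumr_ge0 // => i _; rewrite mulr_ge0 ?pnorm_ge0.
have h4 : 0 < 4^-1 :> C by rewrite invr_gt0.
have h0 : 0 < 2^-1 :> C by rewrite invr_gt0.
have [rho [rhop rhoB rho1 rhorho]] : exists rho : C, [/\ 0 < rho, B * rho <= 4^-1, rho <= 1 & rho <= rho0].
  have [e /= e0] := (nbhs_ballP _ _).1 (filterI (near0_mul_le B0 h4)
    (filterI (near0_mul_le ltr01 ltr01) (near0_mul_le ltr01 rho00))).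
  have e20 : 0 < e / 2 by rewrite divr_gt0.
  move=> /(_ (e / 2)) [|].
    by rewrite /ball /= sub0r normrN gtr0_norm // ltr_pdivrMr // ltr_pMr // ltr1n.
  by move=> r1 [r2 r3]; exists (e / 2); move: r1 r2 r3; rewrite gtr0_norm // !mul1r.
have A0 : 0 < 1 + pnorm 1 T`_1 by rewrite ltr_wpDr ?pnorm_ge0.
have A1 : 0 < 1 + pnorm 1 T`_0 by rewrite ltr_wpDr ?pnorm_ge0.
have rho2 : 0 < rho * 2^-1 by rewrite mulr_gt0.
(* Here [r] depends on [rho]: the constant coefficient of T vanishes at y = 0, so a small r brings
   T(0) within rho / 2, and the contraction supplies the other half of the invariance of the
   ball. *)
have [r [rp r1 rA rA1]] : exists r : C, [/\ 0 < r, r <= 1,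
    (1 + pnorm 1 T`_1) * r <= 4^-1 & (1 + pnorm 1 T`_0) * r <= rho * 2^-1].
  have [e /= e0] := (nbhs_ballP _ _).1 (filterI (near0_mul_le ltr01 ltr01)
    (filterI (near0_mul_le A0 h4) (near0_mul_le A1 rho2))).
  have e20 : 0 < e / 2 by rewrite divr_gt0.
  move=> /(_ (e / 2)) [|].
    by rewrite /ball /= sub0r normrN gtr0_norm // ltr_pdivrMr // ltr_pMr // ltr1n.
  by move=> r1 [r2 r3]; exists (e / 2); move: r1 r2 r3; rewrite gtr0_norm // !mul1r.
have r0 := ltW rp; have rho0' := ltW rhop.
have lip P P' : pnorm r P <= rho -> pnorm r P' <= rho ->
    pnorm r (T.[P] - T.[P']) <= 2^-1 * pnorm r (P - P').
  move=> Pr Pr'; rewrite divdiffE; apply: le_trans (pnormM _ _ r0) _.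
  rewrite mulrC; apply: ler_wpM2r; first exact: pnorm_ge0.
  apply: le_trans (pnorm_divdiff_le r0 r1 rho0' rho1 Pr Pr' T10) _.
  rewrite (_ : 2^-1 = 4^-1 + 4^-1); last by field.
  apply: lerD.
    by apply: le_trans rA; rewrite mulrC ler_wpM2r // lerDr.
  by apply: le_trans rhoB; rewrite mulrC ler_wpM2r // lerDr.
exists r, rho; split=> // P Pr.
have P0 : pnorm r 0 <= rho by rewrite pnorm0.
rewrite -[T.[P]](subrK T.[0]); apply: le_trans (pnormD _ _ r0) _.
rewrite (_ : rho = rho * 2^-1 + rho * 2^-1); last by field.
apply: lerD.
  apply: le_trans (lip _ _ Pr P0) _; rewrite subr0 mulrC.
  by rewrite ler_wpM2r // ltW.
rewrite horner_coef0; apply: le_trans (pnorm_coef0_le r0 r1 T00) _.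
by apply: le_trans rA1; rewrite mulrC ler_wpM2r // lerDr.
Qed.

(** The Picard iterates are polynomials in y that stabilise modulo growing powers of y and stay in a
    ball of [pnorm]; their diagonal coefficients form c. Any root x near 0 is a fixed point of the
    same contraction, hence the limit c(y). Since some root exists by continuity of the roots, c(y)
    is that root, and no limit has to be taken in the equation. *)
Lemma implicit_function0 G : G.[0, 0] = 0 -> (G^`()).[0, 0] != 0 ->
  exists c, [/\ analytic c, c 0 = 0 & exists2 rho : C, 0 < rho &
    \forall y \near (0 : C), forall x, `|x| < rho -> (G.[x, y] = 0 <-> x = pval c y)].
Proof.
move=> G0 G1; pose g := (G^`()).[0, 0].
have coef00 (H : {poly {poly C}}) : H.[0, 0] = H`_0`_0.
  by rewrite -horner_slice horner_coef0 coef_slice horner_coef0.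
pose T := 'X - (g^-1)%:P *: G.
have TE x y : (T.[x, y] = x) <-> (G.[x, y] = 0).
  rewrite /T !hornerE; split=> [/eqP|->]; last by rewrite mulr0 subr0.
  by rewrite -subr_eq0 addrAC subrr add0r oppr_eq0 mulf_eq0 invr_eq0 (negPf G1) => /eqP.
have T00 : T`_0`_0 = 0.
  by rewrite /T coefB coefX coefZ sub0r coefN coefCM -coef00 G0 mulr0 oppr0.
have T10 : T`_1`_0 = 0.
  rewrite /T coefB coefX coefZ coefB coefCM coef1 /=.
  move: (G1); rewrite /g coef00 coef_deriv mulr1n => g0.
  by rewrite mulVf // subrr.
have [r [rho [r0 rhop rho1 stab lip]]] := picard_contraction T00 T10 ltr01.
have r0' := ltW r0.
pose P n := iter n (fun p => T.[p]) (0 : {poly C}).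
have PS n : P n.+1 = T.[P n] by [].
have Pn n : pnorm r (P n) <= rho.
  by elim: n => [|n IH]; [rewrite pnorm0 ltW|rewrite PS; exact: stab].
have P0 n : (P n)`_0 = 0.
  elim: n => [|n IH]; first by rewrite coef0.
  by rewrite PS -horner_coef0 horner_horner [(P n).[0]]horner_coef0 IH coef00.
have D0 (p q : {poly C}) : p`_0 = 0 -> q`_0 = 0 -> (divdiff T p q)`_0 = 0.
  rewrite -!horner_coef0 => p0 q0; rewrite /divdiff horner_sum big1 // => -[i ilt] _ /=.
  rewrite hornerM horner_sum; case: i ilt => [|[|i]] ilt.
  - by rewrite big_ord0 mulr0.
  - by rewrite horner_coef0 T10 mul0r.
  rewrite big1 ?mulr0 // => j _; rewrite hornerM !horner_exp p0 q0 !expr0n.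
  by case: (j : nat) => [|k] /=; rewrite ?subn0 ?mul0r ?mulr0.
(* The divided difference at two iterates vanishes at y = 0, so that each iteration gains one power
   of y. *)
have Pdvd n : 'X^(n.+1) %| P n.+1 - P n.
  elim: n => [|n IH].
    by rewrite subr0 expr1; apply: dvdX_coef0; exact: P0.
  have -> : P n.+2 - P n.+1 = (P n.+1 - P n) * divdiff T (P n.+1) (P n) by rewrite -divdiffE.
  by rewrite exprSr dvdp_mul // dvdX_coef0 // (D0 _ _ (P0 _) (P0 _)).
pose c k := (P k)`_k.
have Pc n k : (k <= n)%N -> (P n)`_k = c k.
  move=> kn; rewrite -(subnK kn); elim: (n - k)%N => [|m IH] //.
  rewrite -[RHS]IH addSn; apply/eqP; rewrite -subr_eq0 -coefB; apply/eqP.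
  by apply: coef_dvdXn (Pdvd _) _; rewrite ltnS leq_addl.
have Vr0 : 0 < r^-1 by rewrite invr_gt0.
have gc : geom rho r^-1 c.
  move=> k; rewrite exprVn ler_pdivlMr ?exprn_gt0 //.
  exact: le_trans (coef_le_pnorm _ _ r0') (Pn _).
exists c; split; [by exists rho, r^-1|exact: P0 0%N|exists rho => //].
have h0 : 0 < 2^-1 :> C by rewrite invr_gt0.
have sl : slice G 0 != 0.
  apply: contraNneq G1 => s0; rewrite coef00 coef_deriv mulr1n.
  by rewrite -horner_coef0 -coef_slice s0 coef0.
move: (near0_mul_le Vr0 h0) (near_root0 rhop sl G0); apply: filterS2 => y yr [x0 x0r Gx0].
have yr' : `|y| <= r.
  by have := ltW (le_lt_trans yr (half_lt1 R)); rewrite ler_pdivrMl // mulr1.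
(* The number x and the values of the iterates at y, viewed as constant polynomials, lie in the ball
   where T contracts, so their distance halves at each iteration. *)
have main x : `|x| < rho -> G.[x, y] = 0 -> pval c y = x.
  move=> xr /TE Tx; apply: pvalP.
  have xP n : `|x - (P n).[y]| <= rho * 2^-1 ^+ n.
    elim: n => [|n IH]; first by rewrite horner0 subr0 expr0 mulr1 ltW.
    have xE : x = T.[x%:P].[y] by rewrite Tx.
    have PE : (P n.+1).[y] = T.[(P n).[y]%:P].[y] by rewrite PS [LHS]horner_horner.
    rewrite {1}xE PE -hornerN -hornerD; apply: le_trans (horner_le_pnorm _ yr') _.
    have Py : pnorm r (P n).[y]%:P <= rho.
      by rewrite pnormC; exact: le_trans (horner_le_pnorm _ yr') (Pn _).
    have Px : pnorm r x%:P <= rho by rewrite pnormC ltW.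
    apply: le_trans (lip _ _ Px Py) _; rewrite -polyCN -polyCD pnormC exprS mulrCA.
    by rewrite ler_wpM2l // ltW.
  apply/cvgrPdist_le => e e0.
  have := @cvg_geometric0 R (rho * 2) 2^-1 (ltW h0) (half_lt1 R).
  move=> /(cvgr_dist_le _ _)/(_ e e0); apply: filterS => n; rewrite sub0r normrN.
  apply: le_trans; rewrite [X in _ <= X]ger0_norm; last by rewrite !mulr_ge0 ?exprn_ge0 ?ltW.
  rewrite -(subrK (P n).[y] x) -addrA; apply: le_trans (ler_normD _ _) _.
  rewrite (_ : rho * 2 * 2^-1 ^+ n = rho * 2^-1 ^+ n + rho * 2^-1 ^+ n); last by ring.
  apply: lerD; first exact: xP.
  have -> : psum c y n = \sum_(k < n) (P n)`_k * y ^+ k.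
    by rewrite psumE; apply: eq_bigr => i _; rewrite Pc // ltnW.
  apply: le_trans (horner_tail_le _ _ r0 yr') _.
  have Vr0' := ltW Vr0; have h0' := ltW h0.
  apply: ler_pM; [exact: pnorm_ge0|by rewrite exprn_ge0 ?mulr_ge0|exact: Pn|].
  by apply: lerXn2r; rewrite ?nnegrE ?mulr_ge0 // mulrC.
move=> x xr; split=> [Gx|xE]; first by rewrite (main x).
by rewrite xE (main _ x0r Gx0).
Qed.

Lemma implicit_function G (a : C) : G.[a, 0] = 0 -> (G^`()).[a, 0] != 0 ->
  exists c, [/\ analytic c, c 0 = a & exists2 rho : C, 0 < rho &
    \forall y \near (0 : C), forall x, `|x - a| < rho -> (G.[x, y] = 0 <-> x = pval c y)].
Proof.
move=> Ga G1; pose H := G \Po ('X + a%:P%:P).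
have H0 : H.[0, 0] = 0 by rewrite horner2_shift add0r.
have H1 : (H^`()).[0, 0] != 0.
  by rewrite deriv_comp derivD derivX derivC addr0 mulr1 horner2_shift add0r.
have [c [ac c0 [rho rho0 cH]]] := implicit_function0 H0 H1.
pose c1 k := c k.+1.
have ac1 : analytic c1.
  have [M [K [M0 K0 gc]]] := ac; exists (M * K), K; split=> //; first by rewrite mulr_gt0.
  by move=> k; apply: le_trans (gc _) _; rewrite exprS mulrA.
have cE : c = cons_series 0 c1 by apply/funext => -[|k].
exists (cons_series a c1); split => //; first exact: analytic_cons.
exists rho => //; move: cH (pval_cons a ac1) (pval_cons 0 ac1); apply: filterS3 => y yH ya y0 x xr.
rewrite ya; have := yH _ xr; rewrite horner2_shift subrK cE y0 add0r => ->.
by split=> [/eqP|->]; [rewrite subr_eq addrC => /eqP|rewrite addrAC subrr add0r].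
Qed.

End ImplicitFunction.

(** * Polynomials with real roots over the real axis *)

Section Weights.
Variable C : numClosedFieldType.
Implicit Types (G : {poly {poly C}}) (p : {poly C}).

Lemma horner2_sum G x y :
  G.[x, y] = \sum_(i < size G) \sum_(j < size G`_i) G`_i`_j * (x ^+ i * y ^+ j).
Proof.
rewrite (horner_coef G) horner_sum; apply: eq_bigr => i _.
rewrite hornerM horner_exp hornerC [(G`_i).[y]]horner_coef big_distrl.
by apply: eq_bigr => j _ /=; ring.
Qed.

Lemma horner_inj (p q : {poly C}) : (forall x, p.[x] = q.[x]) -> p = q.
Proof.
move=> pq; apply/eqP; rewrite -subr_eq0; apply: contraT => /closed_nonrootP[x].
by rewrite /root hornerD hornerN pq subrr eqxx.
Qed.

Lemma horner2_inj G H : (forall x y, G.[x, y] = H.[x, y]) -> G = H.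
Proof.
move=> GH; apply/polyP => i; apply: horner_inj => y; rewrite -!coef_slice.
suff -> : slice G y = slice H y by [].
by apply: horner_inj => x; rewrite !horner_slice.
Qed.

(** The support of G, and hence its Newton polygon, lies on or above the line a i + b j = n. *)
Definition weight_ge (a b n : nat) G :=
  forall i j, G`_i`_j != 0 -> (n <= a * i + b * j)%N.

(* G(t^a u, t^b) / t^n, provided that weight_ge a b n G *)
Definition wblowup (a b n : nat) G : {poly {poly C}} :=
  \poly_(i < size G) \sum_(j < size G`_i) G`_i`_j *: 'X^(a * i + b * j - n).

Lemma horner_wblowup a b n G u t : weight_ge a b n G ->
  G.[t ^+ a * u, t ^+ b] = t ^+ n * (wblowup a b n G).[u, t].
Proof.
move=> wG; rewrite horner2_sum horner_poly horner_sum big_distrr.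
apply: eq_bigr => i _; rewrite hornerM horner_exp hornerC horner_sum big_distrl big_distrr.
apply: eq_bigr => j _ /=; rewrite hornerZ hornerXn.
have [->|ij] := eqVneq (G`_i`_j) 0; first by rewrite !mul0r mulr0.
have E : t ^+ (a * i) * t ^+ (b * j) = t ^+ n * t ^+ (a * i + b * j - n).
  by rewrite -!exprD subnKC // wG.
rewrite exprMn -!exprM mulrAC E; ring.
Qed.

(** At t = 0 only the monomials on the line a i + b j = n survive: the slice is the edge polynomial
    of the Newton polygon. *)
Lemma coef_slice_wblowup a b n G i j0 : (0 < b)%N -> weight_ge a b n G ->
  (a * i + b * j0 = n)%N -> (slice (wblowup a b n G) 0)`_i = G`_i`_j0.
Proof.
move=> b0 wG ij0; rewrite coef_slice coef_poly.
case: ltnP => [iG|Gi]; last by rewrite horner0 (nth_default _ Gi) coef0.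
rewrite horner_sum.
have term (j : 'I_(size G`_i)) : (G`_i`_j *: 'X^(a * i + b * j - n)).[0] = if j == j0 :> nat then G`_i`_j0 else 0.
  rewrite hornerZ hornerXn; case: eqP => [->|/eqP jj0].
    by rewrite ij0 subnn expr0 mulr1.
  have [->|ij] := eqVneq (G`_i`_j) 0; first by rewrite mul0r.
  have := wG _ _ ij; rewrite -ij0 leq_add2l leq_pmul2l // => j0j.
  have {}j0j : (j0 < j)%N by rewrite ltn_neqAle eq_sym jj0.
  by rewrite expr0n subn_eq0 leq_add2l leq_pmul2l // leqNgt j0j mulr0.
under eq_bigr do rewrite term.
rewrite -big_mkcond /=; have [jG|Gj] := ltnP j0 (size G`_i).
  by rewrite (big_pred1 (Ordinal jG)).
by rewrite [G`_i`_j0]nth_default // big1_eq.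
Qed.

(** Over an algebraically closed field, a polynomial without nonzero roots is a monomial. *)
Lemma nonzero_root p i j : (i < j)%N -> p`_i != 0 -> p`_j != 0 -> exists2 x, x != 0 & root p x.
Proof.
move=> ij pi pj; have [rs pE] := closed_field_poly_normal p.
have p0 : p != 0 by apply: contraNneq pi => ->; rewrite coef0.
have [/hasP[x xrs x0]|/hasPn rs0] := boolP (has (fun x => x != 0) rs).
  by exists x => //; rewrite pE rootZ ?lead_coef_eq0 // root_prod_XsubC.
suff pX : p = lead_coef p *: 'X^(size rs).
  have e k : p`_k != 0 -> k = size rs.
    by rewrite {1}pX coefZ coefXn; case: (k =P size rs) => // _; rewrite mulr0 eqxx.
  by move: ij; rewrite (e i pi) (e j pj) ltnn.
rewrite {1}pE; congr (_ *: _); elim: rs rs0 {pE} => [|x rs IH] rs0; first by rewrite big_nil expr0.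
rewrite big_cons IH => [|y yrs]; last by apply: rs0; rewrite inE yrs orbT.
have /negPn/eqP -> := rs0 x (mem_head _ _).
by rewrite subr0 exprS.
Qed.

(** Selects an edge of the Newton polygon ending at (N, 0): o i0 / (N - i0) is the least slope,
    compared in [rat] and stated with denominators cleared. *)
Lemma argmin_slope N (P : pred nat) (o : nat -> nat) i1 : (i1 < N)%N -> P i1 ->
  exists i0, [/\ (i0 < N)%N, P i0 &
    forall i, (i < N)%N -> P i -> (o i0 * (N - i) <= o i * (N - i0))%N].
Proof.
move=> i1N Pi1; pose f (i : 'I_N) : rat := (o i)%:R / (N - i)%:R.
have Pi1' : (fun i : 'I_N => P i) (Ordinal i1N) by [].
case: (@Order.TotalTheory.arg_minP _ _ _ (Ordinal i1N) (fun i : 'I_N => P i) f Pi1') => i0 Pi0 fmin.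
exists i0; split=> // i iN Pi; have := fmin (Ordinal iN) Pi.
have pos (k : 'I_N) : 0 < (N - k)%:R :> rat by rewrite ltr0n subn_gt0.
rewrite /f ler_pdivrMr ?pos // mulrAC ler_pdivlMr; last exact: (pos (Ordinal iN)).
by rewrite -!natrM ler_nat.
Qed.

End Weights.

(** * Newton polygons of real-rooted polynomials *)

Section RealRooted.
Variable R : realType.
Local Notation C := (CC R).
Implicit Types (G : {poly {poly C}}) (q : {poly C}).

Lemma complex_realE (z : C) : (z \is Num.real) = (complex.Im (z : R[i]) == 0).
Proof.
case: z => a b; rewrite realE !lecE /= [0 == b]eq_sym.
by case: (b == 0) => //=; rewrite -realE num_real.
Qed.

Lemma expiD (s t : R) : expi (s + t) = expi s * expi t.
Proof.
rewrite /expi /GRing.mul /= cosD sinD; congr (_ +i* _)%C; ring.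
Qed.

Lemma expi_exp (t : R) n : expi t ^+ n = expi (t *+ n).
Proof.
elim: n => [|n IH]; first by rewrite mulr0n expr0 /expi cos0 sin0.
by rewrite exprS IH mulrS expiD.
Qed.

Lemma norm_expi (t : R) : `|expi t| = 1.
Proof. by rewrite normc_def /= cos2Dsin2 sqrtr1. Qed.

(** Take l = exp(i pi / b): the argument of l^a is pi a / b, strictly between 0 and pi. For t > 0,
    both t^b and (l t)^b = - t^b are real, while l^a turns x off the real axis. *)
Lemma nonreal_exp_root (a b : nat) : (0 < a < b)%N ->
  exists l : C, [/\ `|l| = 1, l ^+ b = -1 & l ^+ a \isn't Num.real].
Proof.
move=> /andP[a0 ab]; have b0 : 0 < b%:R :> R by rewrite ltr0n (leq_trans _ ab).
exists (expi (pi / b%:R)); rewrite norm_expi !expi_exp; split=> //.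
  rewrite -[_ / _ *+ b]mulr_natr mulfVK ?gt_eqF // /expi cospi sinpi.
  by rewrite /GRing.opp /=; congr (_ +i* _)%C; rewrite oppr0.
rewrite complex_realE /= gt_eqF // sin_gt0_pi // -[_ / _ *+ a]mulr_natr.
rewrite mulr_gt0 ?divr_gt0 ?pi_gt0 ?ltr0n //=.
rewrite -mulrA gtr_pMr ?pi_gt0 // mulrC ltr_pdivrMr // mul1r.
  by rewrite ltr_nat.
exact: leq_trans ab.
Qed.

Lemma real_approx (u : C) :
  (forall e : C, 0 < e -> exists2 v, v \is Num.real & `|v - u| < e) -> u \is Num.real.
Proof.
move=> H; apply: contrapT => /negP; rewrite complex_realE => iu.
have /H[v vr] : 0 < (`|complex.Im (u : R[i])|%:C%C : C).
  by rewrite (_ : 0 = 0%:C%C :> C) // ltcR normr_gt0.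
apply/negP; rewrite -real_leNgt ?normr_real //; last by rewrite complex_realE.
move: vr; rewrite complex_realE; case: v u iu {H} => [v1 v2] [u1 u2] /= u0 /eqP ->.
rewrite normc_def /= lecR sub0r sqrrN -sqrtr_sqr ler_wsqrtr // lerDr sqr_ge0 //.
Qed.

Lemma near_exp (P : set C) b : (0 < b)%N -> (\forall y \near (0 : C), P y) ->
  \forall t \near (0 : C), P (t ^+ b).
Proof.
move=> b0 P0; have [e /= e0 eP] := (nbhs_ballP _ _).1 P0.
have h1 := near0_mul_lt (ltr01 : 0 < 1 :> C) e0.
have h2 := near0_mul_le (ltr01 : 0 < 1 :> C) (ltr01 : 0 < 1 :> C).
move: h1 h2; apply: filterS2 => t.
rewrite !mul1r => te t1; apply: eP; rewrite /ball /= sub0r normrN normrX.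
by apply: le_lt_trans te; rewrite -{2}[`|t|]expr1 ler_wiXn2l.
Qed.

(** Extracts one positive real t from statements about complex neighbourhoods, together with a
    rotated point of the same modulus. *)
Lemma near0_pos (P Q : set C) : (\forall y \near (0 : C), P y) -> (\forall y \near (0 : C), Q y) ->
  forall l : C, `|l| = 1 -> exists t : C, [/\ 0 < t, P t & Q (l * t)].
Proof.
move=> P0 Q0 l l1; have [e /= e0 eP] := (nbhs_ballP _ _).1 (filterI P0 Q0).
have e2 : `|e / 2| < e by rewrite gtr0_norm ?divr_gt0 // ltr_pdivrMr // ltr_pMr // ltr1n.
exists (e / 2); split; first by rewrite divr_gt0.
  by apply: (eP (e / 2) _).1; rewrite /ball /= sub0r normrN.
by apply: (eP (l * (e / 2)) _).2; rewrite /ball /= sub0r normrN normrM l1 mul1r.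
Qed.

(** The value y = 0 is excluded, since a factor y^k of G would make every x a root there. *)
Definition real_rooted G := \forall y \near (0 : C), y \is Num.real -> y != 0 ->
  forall x, G.[x, y] = 0 -> x \is Num.real.

(* The Newton polygon has no edge of slope < 1: along such an edge, a root
   u t^a (y = t^b, a < b) that is real for t > 0 is not real for t in l R, where l ^+ b = -1. *)
Lemma real_rooted_order G N : real_rooted G -> G`_N`_0 != 0 ->
  (forall i, (i < N)%N -> G`_i`_0 = 0) -> weight_ge 1 1 N G.
Proof.
move=> rG GN GltN i j ij; rewrite !mul1n leqNgt; apply/negP => ijN.
have iN : (i < N)%N := leq_ltn_trans (leq_addr j i) ijN.
(* [o k] is the order in y of the coefficient of x^k. *)
pose o k := find (fun z => z != 0) G`_k.
have oP k : G`_k != 0 -> G`_k`_(o k) != 0.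
  move=> gk; apply: (nth_find 0 (a := fun z => z != 0)); apply/hasP.
  exists (lead_coef G`_k); last by rewrite lead_coef_eq0.
  by rewrite lead_coefE mem_nth // ltn_predL lt0n size_poly_eq0.
have omin k m : G`_k`_m != 0 -> (o k <= m)%N.
  by move=> gm; rewrite leqNgt; apply: contra gm => /(before_find 0) /negbFE.
have Gi : G`_i != 0 by apply: contraNneq ij => ->; rewrite coef0.
(* The assumed point (i, j) lies strictly below the line i + j = N, so the least slope a / b is less
   than 1. *)
have [i0 [i0N Gi0 slope]] := argmin_slope o iN (P := fun k => G`_k != 0) Gi.
pose a := o i0; pose b := (N - i0)%N.
have a0 : (0 < a)%N.
  rewrite lt0n; apply: contraTneq (oP _ Gi0) => oi0; rewrite -/a oi0 GltN ?eqxx //.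
have ab : (a < b)%N.
  have := slope i iN Gi; rewrite -/a -/b => ab1.
  have : (o i * b < (N - i) * b)%N.
    by rewrite ltn_pmul2r ?subn_gt0 // (leq_ltn_trans (omin _ _ ij)) // ltn_subRL.
  by move/(leq_ltn_trans ab1); rewrite mulnC ltn_pmul2l // subn_gt0.
have b0 : (0 < b)%N by apply: leq_trans ab.
have wG : weight_ge a b (a * N) G.
  move=> k m km; have [kN|Nk] := ltnP k N; last by rewrite (leq_trans _ (leq_addr _ _)) // leq_mul2l Nk orbT.
  have Gk : G`_k != 0 by apply: contraNneq km => ->; rewrite coef0.
  have := slope k kN Gk; rewrite -/a -/b => sl.
  rewrite -{1}(subnKC (ltnW kN)) mulnDr leq_add2l; apply: leq_trans sl _.
  by rewrite mulnC leq_mul2l omin ?orbT.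
pose K := wblowup a b (a * N) G.
have KN : (slice K 0)`_N = G`_N`_0 by apply: coef_slice_wblowup; rewrite ?muln0 ?addn0.
have Ki0 : (slice K 0)`_i0 = G`_i0`_a.
  apply: coef_slice_wblowup => //; rewrite [(b * a)%N]mulnC -mulnDr; congr (_ * _)%N.
  by rewrite subnKC // ltnW.
have [u0 u00 ru0] : exists2 x, x != 0 & root (slice K 0) x.
  by apply: (nonzero_root i0N); [rewrite Ki0 oP|rewrite KN].
have K0 : slice K 0 != 0 by apply: contraNneq GN => k0; rewrite -KN k0 coef0.
have Ku0 : K.[u0, 0] = 0 by rewrite -horner_slice; apply/eqP.
have [l [l1 lb la]] := nonreal_exp_root (introT andP (conj a0 ab)).
(* Roots of the blow-up near [u0], over t and over l t, give real roots of G over t^b and - t^b.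
   Hence both u0 and l^a u0 are limits of real numbers, although l^a is not real. *)
have approx e : 0 < e -> exists t u1 u2 : C, [/\ 0 < t, `|u1 - u0| < e, `|u2 - u0| < e,
   t ^+ a * u1 \is Num.real & (l * t) ^+ a * u2 \is Num.real].
  move=> e0; have nr := near_root e0 K0 Ku0.
  have nG := near_exp b0 rG.
  have [t [t0 [[u1 u1e Ku1] G1] [[u2 u2e Ku2] G2]]] := near0_pos (filterI nr nG) (filterI nr nG) l1.
  have tr : t \is Num.real by rewrite gtr0_real.
  exists t, u1, u2; split=> //.
    apply: G1; rewrite ?realX ?expf_neq0 ?gt_eqF //.
    by rewrite (horner_wblowup _ _ wG) -/K Ku1 mulr0.
  apply: G2; last by rewrite (horner_wblowup _ _ wG) -/K Ku2 mulr0.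
    by rewrite exprMn lb mulN1r realN realX.
  by rewrite exprMn lb mulN1r oppr_eq0 expf_neq0 // gt_eqF.
have realM' (t z : C) : 0 < t -> t ^+ a * z \is Num.real -> z \is Num.real.
  move=> t0 tz; rewrite -[z](mulKf (_ : t ^+ a != 0)) ?expf_neq0 ?gt_eqF //.
  by rewrite realM // realV realX // gtr0_real.
have ur : u0 \is Num.real.
  apply: real_approx => e /approx[t [u1 [u2 [t0 u1e _ u1r _]]]].
  by exists u1 => //; exact: realM' u1r.
have lur : l ^+ a * u0 \is Num.real.
  apply: real_approx => e /approx[t [u1 [u2 [t0 _ u2e _ u2r]]]].
  exists (l ^+ a * u2); last by rewrite -mulrBr normrM normrX l1 expr1n mul1r.
  by apply: (realM' t) => //; rewrite mulrA -exprMn [t * l]mulrC.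
move/negP: la; apply; rewrite -[l ^+ a](mulfK u00).
by rewrite realM // realV.
Qed.

End RealRooted.

(** * Finite systems of branches at a point of the axis y = 0 *)

Section LocalBranches.
Variable R : realType.
Local Notation C := (CC R).
Implicit Types (G H : {poly {poly C}}) (q : {poly C}).

Lemma cvg_horner2 G T (F : set_system T) (FF : Filter F) (u v : T -> C) (a b : C) :
  u @ F --> a -> v @ F --> b -> (fun t => G.[u t, v t]) @ F --> G.[a, b].
Proof.
move=> ua vb; elim/poly_ind: G => [|G q IH].
  rewrite !horner0 (_ : (fun t => _) = fun=> 0); first exact: cvg_cst.
  by apply/funext => t; rewrite !horner0.
have E x y : (G * 'X + q%:P).[x, y] = G.[x, y] * x + q.[y] by rewrite hornerMXaddC !hornerE.
rewrite E (_ : (fun t => _) = fun t => G.[u t, v t] * u t + q.[v t]).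
  exact: (cvgD (cvgM IH ua) (cvg_horner _ _)).
by apply/funext => t; rewrite E.
Qed.

Lemma horner2_neq0_ball G (a b : C) : G.[a, b] != 0 ->
  exists2 d : C, 0 < d & forall x y, `|x - a| < d -> `|y - b| < d -> G.[x, y] != 0.
Proof.
move=> Gab; have e0 : 0 < `|G.[a, b]| by rewrite normr_gt0.
have [] := (nbhs_ballP ((a, b) : C * C) _).1 (cvgr_dist_lt _ _ (@cvg_horner2 G (C * C)%type
  (nbhs ((a, b) : C * C)) _ fst snd a b (@cvg_fst _ _ _ _ _) (@cvg_snd _ _ _ _ _)) _ e0).
move=> d /= d0 dP; exists d => // x y xa yb.
have xyd : ball ((a, b) : C * C) d (x, y) by split; rewrite /ball /= distrC.
have /= := dP _ xyd; apply: contraTneq => ->.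
by rewrite subr0 ltxx.
Qed.

Lemma near0W (P : set C) : (forall y, P y) -> \forall y \near (0 : C), P y.
Proof.
move=> Py; have := near0_mul_le (ltr01 : 0 < 1 :> C) (ltr01 : 0 < 1 :> C).
by apply: filterS.
Qed.

Lemma near_finite_filter (T : choiceType) U (W : set_system U) (WF : Filter W) (B : set T)
    (P : T -> set U) : finite_set B -> (forall b, B b -> W (P b)) ->
  W [set y | forall b, B b -> P b y].
Proof.
move=> /finite_seqP[s ->]; elim: s => [|b s IH] Ps.
  by apply: (filterS _ filterT) => y _ b; rewrite /= in_nil.
have h1 : W (P b) by apply: Ps; rewrite /= inE eqxx.
have h2 : W [set y | forall b, [set` s] b -> P b y].
  by apply: IH => d ds; apply: Ps; rewrite /= inE (ds : d \in s) orbT.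
move: h1 h2; apply: filterS2 => y y1 y2 d /=; rewrite inE => /orP[/eqP -> //|].
exact: y2.
Qed.

Lemma near_finite_set (T : choiceType) (F : set T) (P : T -> set C) : finite_set F ->
  (forall c, F c -> \forall y \near (0 : C), P c y) ->
  \forall y \near (0 : C), forall c, F c -> P c y.
Proof. exact: near_finite_filter. Qed.

(** A bounded root u of G(., y) has |G(u, 0)| <= A |y|, whereas a point at distance at least r from
    all roots of G(., 0) has |G(u, 0)| at least |lead| r^deg. *)
Lemma roots_cluster G (B r : C) : 0 < r -> 0 <= B -> slice G 0 != 0 ->
  \forall y \near (0 : C), forall u, `|u| <= B -> G.[u, y] = 0 ->
    exists2 b, G.[b, 0] = 0 & `|u - b| < r.
Proof.
move=> r0 B0 G0; have [rs GE] := closed_field_poly_normal (slice G 0).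
pose A := 1 + \sum_(i < size G) pnorm 1 G`_i * B ^+ i.
have A0 : 0 < A by rewrite ltr_wpDr // sumr_ge0 // => i _; rewrite mulr_ge0 ?pnorm_ge0 ?exprn_ge0.
have e0 : 0 < `|lead_coef (slice G 0)| * r ^+ size rs.
  by rewrite mulr_gt0 ?exprn_gt0 // normr_gt0 lead_coef_eq0.
have h1 := near0_mul_lt A0 e0.
have h2 := near0_mul_le (ltr01 : 0 < 1 :> C) (ltr01 : 0 < 1 :> C).
move: h1 h2; apply: filterS2 => y yA; rewrite mul1r => y1 u uB Gu.
have up : `|(slice G 0).[u]| <= A * `|y|.
  have -> : (slice G 0).[u] = (slice G 0 - slice G y).[u].
    by rewrite hornerD hornerN [(slice G y).[u]]horner_slice Gu subr0.
  apply: le_trans (horner_le_pnorm _ uB) _.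
  rewrite (@pnorm_wide _ _ (size G)); last first.
    by apply: leq_trans (size_polyD _ _) _; rewrite size_polyN geq_max !size_slice.
  apply: (@le_trans _ _ ((\sum_(i < size G) pnorm 1 G`_i * B ^+ i) * `|y|)); last first.
    by rewrite ler_wpM2r // lerDr.
  rewrite big_distrl; apply: ler_sum => i _ /=; rewrite coefB !coef_slice mulrAC.
  apply: ler_wpM2r; first exact: exprn_ge0.
  have := horner_tail_le G`_i 1 (ltr01 : 0 < 1 :> C) y1.
  by rewrite big_ord1 expr0 mulr1 divr1 expr1 horner_coef0 distrC.
apply: contrapT => nb; move: (le_lt_trans up yA); apply/negP.
rewrite -real_leNgt ?realM ?realX ?normr_real ?gtr0_real // GE hornerZ normrM.
rewrite lead_coefZ; set l := lead_coef (slice G 0); rewrite (monicP (monic_prod_XsubC _ _ _)) mulr1.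
apply: ler_wpM2l => //; have : {in rs, forall b, r <= `|u - b|}.
  move=> b brs; rewrite real_leNgt ?normr_real ?gtr0_real //; apply/negP => ub; apply: nb.
  exists b => //; rewrite -horner_slice; apply/eqP; rewrite -/(root _ _) GE.
  by rewrite rootZ ?lead_coef_eq0 // root_prod_XsubC.
elim: rs {GE e0 yA nb} => [_|b rs IH rb]; first by rewrite big_nil hornerC normr1.
rewrite big_cons hornerM hornerXsubC normrM exprS; apply: ler_pM; rewrite ?exprn_ge0 ?(ltW r0) //.
  by apply: rb; rewrite mem_head.
by apply: IH => d ds; apply: rb; rewrite inE ds orbT.
Qed.

(** The set F may be empty, as happens when G(a, 0) != 0. The radius [rho] comes before y, so that F
    accounts for all roots in a fixed disc; y = 0 is left out because of possible factors y^k. *)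
Definition local_branches G (a : C) := exists F : set (nat -> C), [/\ finite_set F,
  (forall c, F c -> [/\ analytic c, c 0 = a &
     \forall y \near (0 : C), y != 0 -> G.[pval c y, y] = 0]) &
  exists2 rho : C, 0 < rho & \forall y \near (0 : C), y != 0 ->
    forall x, `|x - a| < rho -> G.[x, y] = 0 -> exists2 c, F c & x = pval c y].

Lemma local_branches_none G a : G.[a, 0] != 0 -> local_branches G a.
Proof.
move=> /horner2_neq0_ball[d d0 Gd]; exists set0; split=> //.
exists d => //; have := near0_mul_lt (ltr01 : 0 < 1 :> C) d0.
apply: filterS => y; rewrite mul1r => yd _ x xd /eqP.
by rewrite (negPf (Gd _ _ xd _)) // subr0.
Qed.

Lemma local_branchesM G H K a : (\forall y \near (0 : C), y != 0 ->
    forall x, G.[x, y] = 0 <-> H.[x, y] = 0 \/ K.[x, y] = 0) ->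
  local_branches H a -> local_branches K a -> local_branches G a.
Proof.
move=> GHK [F [Ff Fc [r r0 Fr]]] [F' [Ff' Fc' [r' r0' Fr']]].
exists (F `|` F'); split; first by rewrite finite_setU.
  move=> c [/Fc|/Fc'] [ac c0 cG]; split=> //; move: cG GHK; apply: filterS2 => y cG GHK y0;
    apply/(GHK y0); by [left; exact: cG|right; exact: cG].
have rr : r + r' > 0 by rewrite addr_gt0.
(* A positive number below both r and r', standing in for a minimum in the partially ordered [C]. *)
exists (r * r' / (r + r')); first by rewrite divr_gt0 ?mulr_gt0.
have l1 : r * r' / (r + r') <= r by rewrite ler_pdivrMr // ler_pM2l // lerDr ltW.
have l2 : r * r' / (r + r') <= r' by rewrite ler_pdivrMr // mulrC ler_pM2l // lerDl ltW.
move: GHK Fr Fr'; apply: filterS3 => y GHK Fr Fr' y0 x xa /(GHK y0)[Hx|Kx].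
  have [c Fcc xE] := Fr y0 x (lt_le_trans xa l1) Hx; exists c => //; by left.
have [c Fcc xE] := Fr' y0 x (lt_le_trans xa l2) Kx; exists c => //; by right.
Qed.

Lemma local_branches_simple G a : G.[a, 0] = 0 -> (G^`()).[a, 0] != 0 -> local_branches G a.
Proof.
move=> Ga G1; have [c [ac c0 [r r0 cG]]] := implicit_function Ga G1.
exists [set c]; split; first exact: finite_set1.
  move=> d ->; split=> //; have /cvg_at_dist_le := analytic_cvg0 ac.
  move=> /(_ (r / 2)); rewrite divr_gt0 // => /(_ isT); move: cG; apply: filterS2 => y cG cr y0.
  apply/cG => //; rewrite -c0 distrC; apply: le_lt_trans cr _.
  by rewrite ltr_pdivrMr // ltr_pMr // ltr1n.
exists r => //; move: cG; apply: filterS => y cG y0 x xr /cG -> //; by exists c.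
Qed.

(** Roots x near a correspond to roots u = (x - a) / y of G1. The bound on u confines them to a
    compact disc, where they cluster at the finitely many roots of G1(., 0), and the branches found
    there are collected. *)
Lemma local_branches_blowup G G1 N a : (forall u y, G.[a + y * u, y] = y ^+ N * G1.[u, y]) ->
  slice G1 0 != 0 ->
  (exists d : C, 0 < d /\ forall u y, y != 0 -> `|y * u| < d -> G1.[u, y] = 0 -> `|u| <= d^-1) ->
  (forall b, G1.[b, 0] = 0 -> local_branches G1 b) -> local_branches G a.
Proof.
move=> GG1 G10 [d [d0 bdd]] lb; have [rs GE] := closed_field_poly_normal (slice G1 0).
have rsE b : (b \in rs) = (G1.[b, 0] == 0).
  rewrite -horner_slice -/(root _ _) {1}GE.
  by rewrite rootZ ?lead_coef_eq0 // root_prod_XsubC.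
have [F [Ff Fc [r r0 Fr]]] : exists F : set (nat -> C), [/\ finite_set F,
  (forall c, F c -> analytic c /\
     \forall y \near (0 : C), y != 0 -> G1.[pval c y, y] = 0) &
  exists2 rho : C, 0 < rho & \forall y \near (0 : C), y != 0 ->
    forall u b, b \in rs -> `|u - b| < rho -> G1.[u, y] = 0 -> exists2 c, F c & u = pval c y].
  have : {in rs, forall b, local_branches G1 b} by move=> b; rewrite rsE => /eqP /lb.
  elim: rs {GE rsE lb} => [_|b rs IH rsb].
    exists set0; split=> //; exists 1 => //; apply: near0W => y _ u b.
    by rewrite in_nil.
  have [F [Ff Fc [r r0 Fr]]] : local_branches G1 b by apply: rsb; rewrite mem_head.
  have [|F' [Ff' Fc' [r' r0' Fr']]] := IH.
    by move=> e es; apply: rsb; rewrite inE es orbT.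
  exists (F `|` F'); split; first by rewrite finite_setU.
    by move=> c [/Fc[]|/Fc'[]].
  have rr : r + r' > 0 by rewrite addr_gt0.
  exists (r * r' / (r + r')); first by rewrite divr_gt0 ?mulr_gt0.
  have l1 : r * r' / (r + r') <= r by rewrite ler_pdivrMr // ler_pM2l // lerDr ltW.
  have l2 : r * r' / (r + r') <= r' by rewrite ler_pdivrMr // mulrC ler_pM2l // lerDl ltW.
  move: Fr Fr'; apply: filterS2 => y Fr Fr' y0 u e; rewrite inE => /orP[/eqP ->|ers] ue Gu.
    by have [c Fcc uE] := Fr y0 u (lt_le_trans ue l1) Gu; exists c => //; left.
  by have [c Fcc uE] := Fr' y0 u e ers (lt_le_trans ue l2) Gu; exists c => //; right.
exists (cons_series a @` F); split; first exact: finite_image.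
  move=> _ [c /Fc[ac cG] <-]; split=> //; first exact: analytic_cons.
  move: cG (pval_cons a ac); apply: filterS2 => y cG -> y0.
  by rewrite GG1 cG // mulr0.
exists d => //.
have dV0 : 0 <= d^-1 by rewrite invr_ge0 ltW.
have hc : \forall y \near (0 : C), forall c, F c -> pval (cons_series a c) y = a + y * pval c y.
  by apply: near_finite_set => // c /Fc[ac _]; exact: pval_cons.
move: Fr hc (roots_cluster r0 dV0 G10); apply: filterS3 => y Fr hc cl y0 x xa Gx.
pose u := (x - a) / y.
have xE : x = a + y * u by rewrite /u mulrCA divff // mulr1 addrC subrK.
have Gu : G1.[u, y] = 0.
  move/eqP: Gx; rewrite xE GG1 mulf_eq0 => /orP[|/eqP //].
  by rewrite expf_eq0 (negPf y0) andbF.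
have [|b /eqP Gb ub] := cl u _ Gu.
  by apply: (bdd u y) => //; rewrite /u mulrCA divff // mulr1.
rewrite -rsE in Gb; have [c Fcc uE] := Fr y0 u b Gb ub Gu.
by exists (cons_series a c); [exists c|rewrite hc // -uE].
Qed.

End LocalBranches.

(** * Termination of the blow-ups *)

Section Rellich.
Variable R : realType.
Local Notation C := (CC R).
Implicit Types (G H U V : {poly {poly C}}) (D q : {poly C}).

Lemma near_horner_neq0 q : q != 0 -> \forall y \near (0 : C), y != 0 -> q.[y] != 0.
Proof.
move=> q0; have [m [p]] := multiplicity_XsubC q 0; rewrite q0 /= => p0 qE.
have gp : 0 < `|p.[0]| by rewrite normr_gt0.
have := near_horner_norm_gt (real0 C) gp; apply: filterS => y py y0.
rewrite qE subr0 hornerM hornerXn mulf_neq0 ?expf_neq0 //.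
by rewrite -normr_gt0.
Qed.

(** k is the multiplicity of the line y = 0, read off as a root multiplicity after exchanging the
    variables. *)
Lemma polyY_factor G : G != 0 ->
  exists k H, G = ('X^k)%:P * H /\ slice H 0 != 0.
Proof.
move=> G0; have [m [p]] := multiplicity_XsubC (swapXY G) 0.
rewrite swapXY_eq0 G0 /= => p0 GE; exists m, (swapXY p); split.
  rewrite -[LHS]swapXYK GE subr0 rmorphM rmorphXn /= swapXY_X mulrC.
  by rewrite polyC_exp.
apply: contraNneq p0 => s0; rewrite /root; apply/eqP/horner_inj => x.
have : (swapXY p).[x, 0] = 0 by rewrite -horner_slice s0 horner0.
by rewrite horner2_swapXY polyC0 horner0.
Qed.

(** This is the other chart of the blow-up, y = x v with v = 1 / u: since the pure power x^N occurs
    in G, the transform does not vanish at the origin of that chart, and v stays away from 0. *)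
Lemma blowup_bounded G N : weight_ge 1 1 N G -> G`_N`_0 != 0 ->
  exists d : C, 0 < d /\ forall u y, y != 0 -> `|y * u| < d -> G.[y * u, y] = 0 -> `|u| <= d^-1.
Proof.
move=> wG GN; have wS : weight_ge 1 1 N (swapXY G).
  by move=> i j; rewrite coef_swapXY addnC; exact: wG.
pose L := wblowup 1 1 N (swapXY G).
have L0 : L.[0, 0] != 0.
  have c0 : (slice L 0)`_0 = (swapXY G)`_0`_N.
    by apply: coef_slice_wblowup; rewrite ?muln0 ?mul1n.
  by rewrite -horner_slice horner_coef0 c0 coef_swapXY.
have [d d0 Ld] := horner2_neq0_ball L0.
exists d; split=> // u y y0 yud Gyu.
have [->|u0] := eqVneq u 0; first by rewrite normr0 invr_ge0 ltW.
pose x := y * u; have x0 : x != 0 by rewrite mulf_neq0.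
have Lv : L.[u^-1, x] = 0.
  have := horner_wblowup u^-1 x wS; rewrite !expr1 -/L.
  have -> : x * u^-1 = y by rewrite /x mulfK.
  rewrite horner2_swapXY Gyu => /esym/eqP.
  by rewrite mulf_eq0 expf_eq0 (negPf x0) andbF => /eqP.
have : d <= `|u^-1|.
  rewrite real_leNgt ?normr_real ?gtr0_real //; apply/negP => ud.
  have := Ld u^-1 x; rewrite !subr0 => /(_ ud yud).
  by rewrite Lv eqxx.
by rewrite normfV -lef_pV2 ?invrK // posrE ?invr_gt0 ?normr_gt0.
Qed.

Lemma real_rooted_root G a : real_rooted G -> slice G 0 != 0 -> G.[a, 0] = 0 -> a \is Num.real.
Proof.
move=> rG G0 Ga; apply: real_approx => e e0.
have [t [t0 [[x xe Gx] Gr] _]] := near0_pos (filterI (near_root e0 G0 Ga) rG)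
  (near0W (fun=> I)) (normr1 C).
exists x => //; apply: Gr Gx; first exact: gtr0_real.
by rewrite gt_eqF.
Qed.

(** Induction on the size of D, which bounds the number of successive blow-ups. Substituting x = a +
    y u gives an identity of the same kind for G1, with D divided by y^(N - 1); and N >= 2 where G
    and its derivative both vanish. *)
Lemma local_branches_separable n G U V D : (size D <= n)%N -> D != 0 ->
  U * G + V * G^`() = D%:P -> real_rooted G -> slice G 0 != 0 ->
  forall a, local_branches G a.
Proof.
elim: n G U V D => [|n IH] G U V D sD D0 UV rG G0 a.
  by move: sD; rewrite leqn0 size_poly_eq0 (negPf D0).
have [Ga|] := eqVneq G.[a, 0] 0; last exact: local_branches_none.
have [Ga'|] := eqVneq (G^`()).[a, 0] 0; last exact: local_branches_simple.
pose H := G \Po ('X + a%:P%:P).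
have HE x y : H.[x, y] = G.[x + a, y] by exact: horner2_shift.
have sH : slice H 0 != 0 by rewrite slice_shift comp_poly_eq0 // size_XaddC.
have H00 : H`_0`_0 = 0.
  by rewrite -[LHS]horner_coef0 -coef_slice -horner_coef0 horner_slice HE add0r.
have H10 : H`_1`_0 = 0.
  have : (H^`()).[0, 0] = 0.
    by rewrite deriv_comp derivD derivX derivC addr0 mulr1 horner2_shift add0r.
  by rewrite -horner_slice horner_coef0 coef_slice coef_deriv mulr1n horner_coef0.
have [N HN HltN] : exists2 N, H`_N`_0 != 0 & forall i, (i < N)%N -> H`_i`_0 = 0.
  have ex : exists i, H`_i`_0 != 0.
    exists (size (slice H 0)).-1; rewrite -horner_coef0 -coef_slice.
    by rewrite -lead_coefE lead_coef_eq0.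
  have [N HN Nmin] := ex_minnP ex; exists N => // i iN.
  by apply: contraTeq iN => /Nmin; rewrite -leqNgt.
(* The centre a must be real for x = a + y u to carry real roots x to real u. *)
have ar := real_rooted_root rG G0 Ga.
have rH : real_rooted H.
  move: rG; apply: filterS => y rG yr y0 x; rewrite HE => /(rG yr y0) xa.
  by rewrite -[x](addrK a) realB.
have wH := real_rooted_order rH HN HltN.
pose G1 := wblowup 1 1 N H.
have GG1 u y : G.[a + y * u, y] = y ^+ N * G1.[u, y].
  by rewrite -(horner_wblowup u y wH) !expr1 HE addrC.
have G10 : slice G1 0 != 0.
  apply: contraNneq HN => s0; rewrite -(@coef_slice_wblowup _ 1 1 N H N 0) ?muln0 ?addn0 ?mul1n //.
  by rewrite -/G1 s0 coef0.
apply: (local_branches_blowup GG1 G10).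
  have [d [d0 dP]] := blowup_bounded wH HN; exists d; split=> // u y y0 yu Gu.
  by apply: (dP u y) => //; rewrite HE addrC GG1 Gu mulr0.
move=> b _; pose Y : {poly {poly C}} := ('X)%:P.
pose S := Y * 'X + a%:P%:P.
have GS : G \Po S = Y ^+ N * G1.
  apply: horner2_inj => x y; rewrite horner_comp horner_horner.
  have -> : S.[x, y] = a + y * x by rewrite /S /Y !hornerE addrC.
  by rewrite GG1 /Y !hornerE.
(* The chain rule supplies a factor Y, which is why U gains a factor Y in the identity for G1 and V
   does not. *)
have GS' : (G^`() \Po S) * Y = Y ^+ N * G1^`().
  have : (G \Po S)^`() = (Y ^+ N * G1)^`() by rewrite GS.
  rewrite deriv_comp derivM {2}/Y -polyC_exp derivC mul0r add0r => <-.
  by rewrite /S derivD derivM derivX !derivC mul0r add0r addr0 mulr1.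
have N2 : (1 < N)%N.
  have Nn0 : N != 0%N by apply: contraNneq HN => ->; rewrite H00.
  have Nn1 : N != 1%N by apply: contraNneq HN => ->; rewrite H10.
  by case: (N) Nn0 Nn1 => [|[|]].
have [M NE] : exists M, N = M.+2 by case: (N) N2 => [|[|M]] // _; exists M.
have Y0 : Y != 0 by rewrite polyC_eq0 polyX_eq0.
pose W := (U \Po S) * Y * G1 + (V \Po S) * G1^`().
have WD : Y ^+ M.+1 * W = D%:P.
  apply: (mulfI Y0); have := congr1 (fun P => Y * (P \Po S)) UV.
  rewrite /= comp_polyD !comp_polyM comp_polyC GS => <-.
  rewrite [RHS]mulrDr [Y * ((V \Po S) * _)](_ : _ = (V \Po S) * ((G^`() \Po S) * Y)).
    by rewrite GS' NE !exprS /W; ring.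
  by ring.
have D0E : D = 'X^(M.+1) * W`_0.
  have := congr1 (fun P : {poly {poly C}} => P`_0) WD.
  by rewrite /Y -polyC_exp coefCM coefC eqxx.
have WE : W = (W`_0)%:P.
  apply: (@mulfI _ (Y ^+ M.+1)); first by rewrite expf_neq0.
  by rewrite WD {1}D0E polyCM polyC_exp.
have W00 : W`_0 != 0 by apply: contraNneq D0 => w0; rewrite D0E w0 mulr0.
apply: (IH G1 ((U \Po S) * Y) (V \Po S) W`_0) => //.
  move: sD; rewrite D0E size_monicM ?monicXn // size_polyXn => sD.
  by rewrite -ltnS; apply: leq_trans sD; rewrite !addSn ltnS leq_addl.
move: rG; apply: filterS => y rG yr y0 u Gu.
have : a + y * u \is Num.real by apply: rG => //; rewrite GG1 Gu mulr0.
move=> au; rewrite -[u](mulKf y0) -[y * u](addKr a) realM ?realV //.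
by rewrite realD // realN.
Qed.

(** Induction on the degree in x. A nontrivial gcd d of G and its derivative gives c G = q d with c
    depending on y alone; q and d have smaller degree and real roots away from the zeros of c. A
    trivial gcd gives a Bezout identity with right-hand side in y only. *)
Theorem real_rooted_local_branches G : G != 0 -> real_rooted G -> forall a, local_branches G a.
Proof.
have [n sG] := ubnP (size G); elim: n G sG => // n IH G0 sG G00 rG0 a.
have [k [G [GE Gs]]] := polyY_factor G00.
have G0E y x : G0.[x, y] = y ^+ k * G.[x, y].
  by rewrite GE hornerM hornerC hornerM hornerXn.
have Gn0 : G != 0 by apply: contraNneq Gs => ->; rewrite /slice rmorph0.
have rG : real_rooted G.
  move: rG0; apply: filterS => y rG yr y0 x Gx; apply: rG => //.
  by rewrite G0E Gx mulr0.
have {}sG : (size G < n.+1)%N.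
  by move: sG; rewrite GE size_Cmul // expf_neq0 // polyX_eq0.
suff GL : local_branches G a.
  apply: (local_branchesM _ GL GL); apply: near0W => y y0 x; rewrite G0E.
  split=> [/eqP|]; last by case=> ->; rewrite mulr0.
  by rewrite mulf_eq0 expf_eq0 (negPf y0) andbF => /eqP; left.
pose d := gcdp G G^`().
have d0 : d != 0 by rewrite gcdp_eq0 (negPf Gn0).
have [sd|sd] := leqP (size d) 1.
  have [[u v] /= /eqpP[[c1 c2] /= /andP[c10 c20] cE]] := Bezoutp G G^`().
  rewrite -/d (size1_polyC sd) in cE d0.
  apply: (@local_branches_separable (size (c2 * d`_0)) G (c1 *: u) (c1 *: v) (c2 * d`_0)) => //.
    by rewrite mulf_neq0 //; move: d0; rewrite polyC_eq0.
  by rewrite -!scalerAl -scalerDr cE -mul_polyC polyCM.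
have G'0 : G^`() != 0.
  apply: contraTneq sd => G'0; rewrite -leqNgt.
  apply: leq_trans (dvdp_leq Gn0 (dvdp_gcdl _ _)) _.
  apply/leq_sizeP => -[//|j] _; have := congr1 (fun P : {poly {poly C}} => P`_j) G'0.
  by rewrite coef_deriv coef0 -mulr_natr => /eqP; rewrite mulf_eq0 -polyC_natr polyC_eq0 pnatr_eq0 orbF => /eqP.
have [[c q] /= c0 cE] := Pdiv.WeakIdomain.dvdpP _ _ (dvdp_gcdl G G^`()); rewrite -/d in cE.
have sdG : (size d < size G)%N.
  by apply: leq_ltn_trans (dvdp_leq G'0 (dvdp_gcdr _ _)) (lt_size_deriv Gn0).
have q0 : q != 0.
  by apply: contraNneq Gn0 => q0; move/eqP: cE; rewrite q0 mul0r -mul_polyC mulf_eq0 polyC_eq0 (negPf c0).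
have sqG : (size q < size G)%N.
  have := congr1 (fun P : {poly {poly C}} => size P) cE.
  rewrite /= size_scale // size_mul // => ->; move: sd.
  by case: (size d) => [|[|s]] // _; rewrite !addnS /= ltnS leq_addr.
have zE x y : c.[y] != 0 -> G.[x, y] = 0 <-> q.[x, y] = 0 \/ d.[x, y] = 0.
  move=> cy; have : c.[y] * G.[x, y] = q.[x, y] * d.[x, y].
    by rewrite -!hornerM -cE hornerZ.
  move=> E; split=> [Gx|qd].
    by move/eqP: E; rewrite Gx mulr0 eq_sym mulf_eq0 => /orP[]/eqP; [left|right].
  apply/eqP; rewrite -(mulrI_eq0 _ (mulfI cy)) E.
  by case: qd => ->; rewrite ?mul0r ?mulr0.
have nc := near_horner_neq0 c0.
have rr (P : {poly {poly C}}) : P = q \/ P = d -> real_rooted P.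
  move=> Pqd; move: rG nc; apply: filterS2 => y rG cy yr y0 x Px; apply: rG => //.
  by apply/(zE x y (cy y0)); case: Pqd => <-; [left|right].
apply: (@local_branchesM _ G q d).
- by move: nc; apply: filterS => y cy y0 x; exact: zE (cy y0).
- by apply: IH => //; [exact: leq_trans sqG _|apply: rr; left].
- by apply: IH => //; [exact: leq_trans sdG _|apply: rr; right].
Qed.

End Rellich.

(** * Stable polynomials and the Cayley transform *)

Section Stability.
Variable C : numClosedFieldType.
Implicit Types (p : {poly {poly C}}) (q : {poly C}) (t : C).

(** Factor by factor: for |r| >= 1 and |t| < 1, |t - r|^2 - |1 - t^* r|^2 = (|r|^2 - 1)(1 - |t|^2)
    >= 0. A d above the degree only helps, as |t| < 1. *)
Lemma horner_reciprocal_le q d t : (size q <= d.+1)%N -> (forall x, `|x| < 1 -> q.[x] != 0) ->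
  t != 0 -> `|t| < 1 -> `|t| ^+ d * `|q.[(t^*)^-1]| <= `|q.[t]|.
Proof.
move=> sq q0 t0 t1; have [rs qE] := closed_field_poly_normal q.
have qn0 : q != 0 by apply: contraTneq (q0 0 _) => [->|]; rewrite ?normr0 // horner0 eqxx.
have rs1 : {in rs, forall r, 1 <= `|r|}.
  move=> r rrs; rewrite real_leNgt ?normr_real //; apply/negP => /q0.
  by rewrite -/(root q r) qE rootZ ?lead_coef_eq0 // root_prod_XsubC rrs.
have srs : (size rs <= d)%N.
  by rewrite -ltnS; apply: leq_trans sq; rewrite qE size_scale ?lead_coef_eq0 // size_prod_XsubC.
rewrite qE !hornerZ !normrM mulrCA; apply: ler_wpM2l => //.
apply: (@le_trans _ _ (`|t| ^+ size rs * `|(\prod_(z <- rs) ('X - z%:P)).[(t^*)^-1]|)).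
  by rewrite ler_wpM2r // ler_wiXn2l // ltW.
elim: rs rs1 {srs qE} => [_|r rs IH rs1]; first by rewrite !big_nil !hornerC normr1 mulr1.
rewrite !big_cons !hornerM !hornerXsubC !normrM exprS mulrACA; apply: ler_pM; rewrite ?mulr_ge0 ?exprn_ge0 //; last first.
  by apply: IH => z zrs; apply: rs1; rewrite inE zrs orbT.
rewrite -[`|t|]norm_conjC -normrM mulrBr mulfV ?conjC_eq0 //.
have r1 : 1 <= `|r| by apply: rs1; rewrite mem_head.
rewrite -(ler_pXn2r (ltn0Sn 1)) ?nnegrE // !normCK !rmorphB !rmorphM rmorph1 /= !conjCK -subr_ge0.
rewrite (_ : _ - _ = (r * r^* - 1) * (1 - t * t^*)); last by ring.
rewrite mulr_ge0 // subr_ge0 -normCK ?exprn_ege1 //.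
by rewrite exprn_ile1 // ltW.
Qed.

Lemma size_exp_affine (a b : C) k : (size ((a *: 'X + b%:P) ^+ k) <= k.+1)%N.
Proof.
apply: leq_trans (size_poly_exp_leq _ _) _; rewrite ltnS -[X in (_ <= X)%N]mul1n leq_mul2r.
rewrite -subn1 leq_subLR; apply/orP; right; apply: leq_trans (size_polyD _ _) _.
by rewrite geq_max (leq_trans (size_scale_leq _ _)) ?size_polyX // (leq_trans (size_polyC_leq1 _)).
Qed.

(* The one-variable estimate applies to p restricted to the graph of the disc
   automorphism that maps z2 to z1. *)
Lemma reflection_le p x y : (forall x y, `|x| < 1 -> `|y| < 1 -> p.[x, y] != 0) ->
  x != 0 -> y != 0 -> `|x| < 1 -> `|y| < 1 -> `|(reflection p).[x, y]| <= `|p.[x, y]|.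
Proof.
move=> stable x0 y0 x1 y1; rewrite reflectionE //.
set m := (size p).-1; set n := (sizeY p).-1.
have p0 : p != 0 by apply: contraTneq (stable 0 0 _ _) => [->||]; rewrite ?normr0 ?ltr01 // !horner0 eqxx.
have sp : size p = m.+1 by rewrite /m prednK // lt0n size_poly_eq0.
have spY : sizeY p = n.+1 by rewrite /n prednK // sizeYE lt0n size_poly_eq0 swapXY_eq0.
(* The quotient N / D is the disc automorphism that takes y to x, and by symmetry 1 / y^* to 1 /
   x^*. Q is p on its graph with denominators cleared, hence without zeros in the disc. *)
pose al := 1 - x * y^*; pose be := x - y.
pose N := al *: 'X + be%:P; pose D := be^* *: 'X + (al^*)%:P.
pose Q := \sum_(i < size p) p`_i * N ^+ i * D ^+ (m - i).
have im (i : 'I_(size p)) : (i <= m)%N by rewrite -ltnS -sp.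
have QE t : D.[t] != 0 -> Q.[t] = D.[t] ^+ m * p.[N.[t] / D.[t], t].
  move=> Dt; rewrite (horner_coef p) !horner_sum big_distrr; apply: eq_bigr => i _ /=.
  rewrite !hornerM !horner_exp hornerC expr_div_n -[in RHS](subnK (im i)) exprD.
  by move: (D.[t] ^+ i) (expf_neq0 i Dt) => u u0; field => //.
have sQ : (size Q <= (m + n).+1)%N.
  apply: (leq_trans (size_sum _ _ _)); apply/bigmax_leqP => i _.
  apply: leq_trans (size_polyMleq _ _) _; rewrite -subn1 leq_subLR add1n.
  have s1 : (size (p`_i * N ^+ i)%R <= n + i.+1)%N.
    apply: leq_trans (size_polyMleq _ _) _; rewrite -subn1 leq_subLR add1n -addSn -spY.
    by apply: leq_add; [exact: max_size_coefXY|exact: size_exp_affine].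
  apply: leq_trans (leq_add s1 (size_exp_affine _ _ _)) _.
  by move: (im i); lia.
have al2 : `|al| ^+ 2 - `|be| ^+ 2 = (1 - `|x| ^+ 2) * (1 - `|y| ^+ 2).
  by rewrite !normCK /al /be !rmorphB !rmorphM rmorph1 /= !conjCK; ring.
have c1 (z : C) : `|z| < 1 -> 0 < 1 - `|z| ^+ 2 by move=> z1; rewrite subr_gt0 exprn_ilt1.
have NE t : N.[t] = al * t + be by rewrite /N !hornerE.
have DE t : D.[t] = be^* * t + al^* by rewrite /D !hornerE.
have ND t : `|t| < 1 -> `|N.[t]| < `|D.[t]|.
  move=> t1; rewrite -(ltr_pXn2r (ltn0Sn 1)) ?nnegrE // -subr_gt0.
  suff -> : `|D.[t]| ^+ 2 - `|N.[t]| ^+ 2 = (`|al| ^+ 2 - `|be| ^+ 2) * (1 - `|t| ^+ 2).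
    by rewrite al2 !mulr_gt0 ?c1.
  rewrite NE DE; move: al be {al2 N D Q QE sQ NE DE} => a b.
  by rewrite !normCK !rmorphD !rmorphM /= !conjCK; ring.
have D0 t : `|t| < 1 -> D.[t] != 0.
  by move=> /ND; apply: contraTneq => ->; rewrite normr0 -real_leNgt ?normr_real ?real0.
have Qs t : `|t| < 1 -> Q.[t] != 0.
  move=> t1; rewrite QE ?D0 // mulf_neq0 ?expf_neq0 ?D0 // stable //.
  by rewrite normf_div ltr_pdivrMr ?mul1r ?ND // normr_gt0 D0.
have := horner_reciprocal_le sQ Qs y0 y1.
pose s := 1 - y * y^*.
have Ny : N.[y] = x * s by rewrite NE /al /be /s; ring.
have Dy : D.[y] = s by rewrite DE /al /be /s !rmorphB !rmorphM rmorph1 /= !conjCK; ring.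
have s0 : s != 0 by rewrite -Dy D0.
have sc : s^* = s by rewrite /s rmorphB rmorphM rmorph1 /= conjCK mulrC.
have yc0 : y^* != 0 by rewrite conjC_eq0.
have xc0 : x^* != 0 by rewrite conjC_eq0.
have Nr : N.[(y^*)^-1] = s / y^*.
  by rewrite NE /al /be /s; field.
have Dr : D.[(y^*)^-1] = x^* * s / y^*.
  by rewrite DE /al /be /s !rmorphB !rmorphM rmorph1 /= conjCK; field.
have Dr0 : D.[(y^*)^-1] != 0 by rewrite Dr !mulf_neq0 ?invr_eq0.
rewrite (QE y) ?D0 // (QE _ Dr0) Ny Dy Nr Dr [x * s / s]mulfK //.
have -> : s / y^* / (x^* * s / y^*) = (x^*)^-1 by field; rewrite ?s0 ?xc0 ?yc0.
rewrite !(normrM, normrX, normfV, norm_conjC) => H.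
have sm : 0 < `|s| ^+ m by rewrite exprn_gt0 // normr_gt0.
rewrite -(ler_pM2l sm); apply: le_trans H; rewrite le_eqVlt; apply/orP; left; apply/eqP.
have ym : `|y| ^+ m != 0 by rewrite expf_neq0 // normr_eq0.
rewrite exprMn exprMn exprVn exprD; move: (`|y| ^+ m) ym => u u0; field => //.
Qed.

End Stability.

(** * The Cayley transform of a stable polynomial *)

Section CayleyTransform.
Variable R : realType.
Local Notation C := (CC R).
Implicit Types (p F : {poly {poly C}}) (q : {poly C}).

(** The formula for the reflection requires x != 0; at x = 0 the inequality follows by continuity
    along small positive x. *)
Lemma reflection_le_disc p x y : (forall x y, `|x| < 1 -> `|y| < 1 -> p.[x, y] != 0) ->
  y != 0 -> `|x| < 1 -> `|y| < 1 -> `|(reflection p).[x, y]| <= `|p.[x, y]|.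
Proof.
move=> stable y0 x1 y1; have [->|x0] := eqVneq x 0; last exact: reflection_le.
rewrite -!horner_slice real_leNgt ?normr_real //; apply/negP => lt.
set q1 := slice (reflection p) y in lt; set q2 := slice p y in lt.
pose e := (`|q2.[0]| + `|q1.[0]|) / 2.
have er : e \is Num.real by rewrite realM ?realD ?normr_real ?realV ?realn.
have [e1 e2] := (midf_lt lt).
have h1 := near_horner_norm_gt er e2.
have h2 := near_horner_norm_lt e1.
have h3 := near0_mul_lt (ltr01 : 0 < 1 :> C) (ltr01 : 0 < 1 :> C).
have [t [t0 [t1 [t2 t3]] _]] := near0_pos (filterI h1 (filterI h2 h3)) h1 (normr1 C).
have tn0 : t != 0 by rewrite gt_eqF.
rewrite mul1r in t3; have := reflection_le stable tn0 y0 t3 y1.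
rewrite -!horner_slice -/q1 -/q2; apply/negP; rewrite -real_ltNge ?normr_real //.
exact: lt_trans t2 t1.
Qed.

Definition ii : C := (0 +i* 1)%C.

Lemma ii2 : ii * ii = -1.
Proof. by rewrite /ii /GRing.mul /GRing.opp /=; congr (_ +i* _)%C; ring. Qed.

Lemma conj_ii : ii^* = - ii.
Proof. by rewrite /ii /GRing.opp /=; congr (_ +i* _)%C; rewrite oppr0. Qed.

Lemma upper_norm_lt (x : C) : 0 < complex.Im (x : R[i]) -> `|1 + ii * x| < `|1 - ii * x|.
Proof.
case: x => a b /= b0; rewrite /ii !normc_def ltcR /=.
rewrite (_ : _ + _ = (1 - b) ^+ 2 + a ^+ 2); last by ring.
rewrite (_ : (1 - _) ^+ 2 + (0 - _) ^+ 2 = (1 + b) ^+ 2 + a ^+ 2); last by ring.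
have b1 : 0 < (1 + b) ^+ 2 + a ^+ 2.
  by rewrite ltr_pwDl ?sqr_ge0 // exprn_gt0 // addr_gt0.
rewrite ltr_sqrt // ltrD2r -subr_gt0.
by rewrite (_ : _ - _ = 4 * b) ?mulr_gt0 //; ring.
Qed.

Lemma one_sub_ii_neq0 (x : C) : 0 <= complex.Im (x : R[i]) -> 1 - ii * x != 0.
Proof.
case: x => a b /= b0; apply/negP => /eqP /(congr1 (fun z : R[i] => complex.Re z)) /=.
by lra.
Qed.

(** F at the Cayley images of x and y, with denominators cleared. The degrees are parameters because
    p~ may have smaller bidegree than p but is to be cleared with that of p. *)
Definition cayley_sum F m n (x y : C) : C := \sum_(i < m.+1) \sum_(j < n.+1)
  F`_i`_j * ((1 + ii * x) ^+ i * (1 - ii * x) ^+ (m - i)) *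
            ((1 + ii * y) ^+ j * (1 - ii * y) ^+ (n - j)).

Definition cayley_poly F m n : {poly {poly C}} := \sum_(i < m.+1) \sum_(j < n.+1)
  (F`_i`_j)%:P%:P * ((1 + ii%:P%:P * 'X) ^+ i * (1 - ii%:P%:P * 'X) ^+ (m - i)) *
     ((1 + ii%:P * 'X) ^+ j * (1 - ii%:P * 'X) ^+ (n - j))%:P.

Lemma horner_cayley_poly F m n x y : (cayley_poly F m n).[x, y] = cayley_sum F m n x y.
Proof.
rewrite /cayley_poly /cayley_sum !horner_sum; apply: eq_bigr => i _.
rewrite !horner_sum; apply: eq_bigr => j _.
by rewrite !(hornerM, hornerC, horner_exp, hornerD, hornerN, hornerX).
Qed.

Lemma horner_coef_wide2 F m n x y : (size F <= m.+1)%N -> (sizeY F <= n.+1)%N ->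
  F.[x, y] = \sum_(i < m.+1) \sum_(j < n.+1) F`_i`_j * x ^+ i * y ^+ j.
Proof.
move=> sm sn; rewrite (horner_coef_wide _ sm) horner_sum; apply: eq_bigr => i _.
rewrite hornerM horner_exp hornerC (@horner_coef_wide _ n.+1); last first.
  exact: leq_trans (max_size_coefXY _ _) sn.
by rewrite big_distrl; apply: eq_bigr => j _; rewrite mulrAC.
Qed.

(** Sends the upper half-plane into the unit disc, the real axis into the circle, and 0 to 1. *)
Definition cayley (x : C) : C := (1 + ii * x) / (1 - ii * x).

Lemma cayley_sumE F m n x y : (size F <= m.+1)%N -> (sizeY F <= n.+1)%N ->
  1 - ii * x != 0 -> 1 - ii * y != 0 ->
  cayley_sum F m n x y = (1 - ii * x) ^+ m * (1 - ii * y) ^+ n * F.[cayley x, cayley y].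
Proof.
move=> sm sn x0 y0; rewrite (horner_coef_wide2 _ _ sm sn) big_distrr; apply: eq_bigr => i _.
rewrite big_distrr; apply: eq_bigr => j _ /=.
have im : (i <= m)%N by rewrite -ltnS.
have jn : (j <= n)%N by rewrite -ltnS.
have em : (1 - ii * x) ^+ m = (1 - ii * x) ^+ (m - i) * (1 - ii * x) ^+ i.
  by rewrite -exprD subnK.
have en : (1 - ii * y) ^+ n = (1 - ii * y) ^+ (n - j) * (1 - ii * y) ^+ j.
  by rewrite -exprD subnK.
rewrite /cayley !expr_div_n em en.
move: ((1 - ii * x) ^+ i) (expf_neq0 i x0) => u u0.
by move: ((1 - ii * y) ^+ j) (expf_neq0 j y0) => v v0; field; rewrite ?u0 ?v0.
Qed.

(** Reversing the indices exchanges the powers of 1 + i x and 1 - i x, and so does conjugation: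
    after the Cayley transform, reflecting amounts to conjugating the coefficients. *)
Lemma cayley_sum_reflection p x y : p != 0 -> let m := (size p).-1 in let n := (sizeY p).-1 in
  cayley_sum (reflection p) m n x y = (cayley_sum p m n x^* y^*)^*.
Proof.
move=> p0 m n.
have sp : size p = m.+1 by rewrite /m prednK // lt0n size_poly_eq0.
have spY : sizeY p = n.+1 by rewrite /n prednK // sizeYE lt0n size_poly_eq0 swapXY_eq0.
rewrite /cayley_sum rmorph_sum (reindex_inj rev_ord_inj); apply: eq_bigr => i _ /=.
rewrite rmorph_sum (reindex_inj rev_ord_inj); apply: eq_bigr => j _ /=.
have im : (i <= m)%N by rewrite -ltnS.
have jn : (j <= n)%N by rewrite -ltnS.
rewrite !subSS !subKn // !rmorphM !rmorphXn !rmorphD !rmorphN !rmorphM rmorph1 /= !conjCK conj_ii.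
rewrite /reflection coef_poly sp ltnS leq_subr coef_poly spY ltnS leq_subr -/m -/n !subKn //.
by rewrite !mulNr !opprK [in RHS](mulrC ((1 - ii * x) ^+ i)) [in RHS](mulrC ((1 - ii * y) ^+ j)).
Qed.

Lemma horner_map_comp F q x e : (map_poly (fun c => c \Po q) F).[x, e] = F.[x, q.[e]].
Proof.
rewrite -!horner_slice; congr _.[x]; apply/polyP => i; rewrite !coef_slice.
by rewrite coef_map_id0 ?comp_poly0 // horner_comp.
Qed.

Lemma size_reflection p : (size (reflection p) <= size p)%N.
Proof. exact: size_poly. Qed.

Lemma sizeY_reflection p : (sizeY (reflection p) <= sizeY p)%N.
Proof.
apply/bigmax_leqP => i _; rewrite coef_poly; case: ifP => _; last by rewrite size_poly0.
exact: size_poly.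
Qed.

Lemma near_slice_neq0 F : F != 0 -> \forall y \near (0 : C), y != 0 -> slice F y != 0.
Proof.
move=> F0; have l0 : lead_coef F != 0 by rewrite lead_coef_eq0.
move: (near_horner_neq0 l0); apply: filterS => y yF y0; apply: contraNneq (yF y0) => s0.
by rewrite lead_coefE -coef_slice s0 coef0.
Qed.

(** On the product of two upper half-planes, |p~| <= |p| excludes p~ = nu p as soon as |nu| > 1. A
    root with Im x > 0 over a real y would persist under a perturbation into this region. *)
Lemma real_rooted_cayley p mu : (forall x y, `|x| < 1 -> `|y| < 1 -> p.[x, y] != 0) ->
  `|mu| = 1 -> let m := (size p).-1 in let n := (sizeY p).-1 in
  let H := cayley_poly (reflection p) m n - mu%:P%:P * cayley_poly p m n in
  H != 0 -> real_rooted H.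
Proof.
move=> stable mu1 m n H H0.
have p0 : p != 0 by apply: contraTneq (stable 0 0 _ _) => [->||]; rewrite ?normr0 ?ltr01 // !horner0 eqxx.
have sp : size p = m.+1 by rewrite /m prednK // lt0n size_poly_eq0.
have spY : sizeY p = n.+1 by rewrite /n prednK // sizeYE lt0n size_poly_eq0 swapXY_eq0.
have HE x y : H.[x, y] = cayley_sum (reflection p) m n x y - mu * cayley_sum p m n x y.
  by rewrite /H !(hornerD, hornerN, hornerM, hornerC) !horner_cayley_poly.
have noroot x y (nu : C) : 0 < complex.Im (x : R[i]) -> 0 < complex.Im (y : R[i]) ->
    1 + ii * y != 0 -> 1 < `|nu| ->
    cayley_sum (reflection p) m n x y != nu * cayley_sum p m n x y.
  move=> x0 y0 yi nu1.
  have cx := one_sub_ii_neq0 (ltW x0); have cy := one_sub_ii_neq0 (ltW y0).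
  have lt1 (z : C) : 1 - ii * z != 0 -> 0 < complex.Im (z : R[i]) -> `|cayley z| < 1.
    by move=> z0 /upper_norm_lt; rewrite normf_div ltr_pdivrMr ?normr_gt0 // mul1r.
  rewrite !cayley_sumE ?sp ?spY //; last first.
  - by rewrite -spY; exact: sizeY_reflection.
  - by rewrite -sp; exact: size_reflection.
  rewrite [X in _ != X]mulrCA (inj_eq (mulfI _)) ?mulf_neq0 ?expf_neq0 //.
  have pn := stable _ _ (lt1 _ cx x0) (lt1 _ cy y0).
  have yc : cayley y != 0 by rewrite mulf_neq0 ?invr_eq0.
  have := reflection_le_disc stable yc (lt1 _ cx x0) (lt1 _ cy y0).
  apply: contraTneq => ->; rewrite normrM -real_ltNge ?realM ?normr_real //.
  by rewrite ltr_pMl // normr_gt0.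
have upper y x : y \is Num.real -> slice H y != 0 -> H.[x, y] = 0 -> complex.Im (x : R[i]) <= 0.
  move=> yr sy Hxy; rewrite leNgt; apply/negP => x0.
  (* K(u, e) is the level equation at height y + i e with mu (1 + e) in place of mu; at e = 0 it is
     H(., y). For small e > 0 a nearby root still has positive imaginary part. *)
  pose K := map_poly (fun c => c \Po (y%:P + ii *: 'X)) (cayley_poly (reflection p) m n)
    - (mu *: (1 + 'X))%:P * map_poly (fun c => c \Po (y%:P + ii *: 'X)) (cayley_poly p m n).
  have KE u e : K.[u, e] = cayley_sum (reflection p) m n u (y + ii * e)
      - mu * (1 + e) * cayley_sum p m n u (y + ii * e).
    rewrite /K !(hornerD, hornerN, hornerM) !horner_map_comp !horner_cayley_poly.
    by rewrite !(hornerC, hornerZ, hornerD, hornerX).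
  have K0 : slice K 0 != 0.
    apply: contraNneq sy => k0; apply/eqP/horner_inj => u.
    by rewrite horner_slice HE horner0 -(horner0 u) -k0 horner_slice KE mulr0 !addr0 mulr1.
  have Kx : K.[x, 0] = 0 by rewrite KE mulr0 !addr0 mulr1 -HE.
  have r0 : 0 < ((complex.Im (x : R[i]))%:C%C : C) by rewrite (_ : 0 = 0%:C%C :> C) // ltcR.
  have nr := near_root r0 K0 Kx.
  have l1 := near0_mul_lt (ltr01 : 0 < 1 :> C) (ltr01 : 0 < 1 :> C).
  have [e [e0 [[u ux Ku] e1] _]] := near0_pos (filterI nr l1) l1 (normr1 C).
  have Iu : 0 < complex.Im (u : R[i]).
    move: ux; case: (u) (x) x0 => [u1 u2] [x1 x2] /= x0.
    rewrite normc_def ltcR /= => h; have : `|u2 - x2| < x2.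
      by apply: le_lt_trans h; rewrite -sqrtr_sqr ler_wsqrtr // lerDr sqr_ge0.
    by rewrite ltr_norml => /andP[h1 _]; lra.
  have [e' e'0 eE] := pos_complexE e0.
  have Iy : complex.Im (y + ii * e : R[i]) = e'.
    move: yr; rewrite complex_realE eE; case: (y) => [y1 y2] /= /eqP ->; ring.
  have e1' : e < 1 by move: e1; rewrite mul1r gtr0_norm.
  have yi : 1 + ii * (y + ii * e) != 0.
    apply/negP => /eqP /(congr1 (fun z : R[i] => complex.Re z)).
    move: yr; rewrite complex_realE => /eqP; move: e1'; rewrite eE.
    case: (y) => [y1 y2]; rewrite (_ : 1 = 1%:C%C :> C) // ltcR /= => e1'' ->.
    by move=> h1; clear -e1'' h1 e'0; lra.
  have := noroot u (y + ii * e) (mu * (1 + e)) Iu; rewrite Iy => /(_ e'0 yi) nn.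
  have : 1 < `|mu * (1 + e)|.
    by rewrite normrM mu1 mul1r gtr0_norm ?ltrDl // addr_gt0.
  by move/nn; rewrite -subr_eq0 -KE Ku eqxx.
have mum : mu * mu^* = 1 by rewrite -normCK mu1 expr1n.
move: (near_slice_neq0 H0); apply: filterS => y sy yr y0 x Hxy.
have yc : y^* = y by apply/CrealP.
(* For real y and |mu| = 1, conjugation exchanges the two terms of H up to a unimodular factor, so a
   root in the lower half-plane would yield one in the upper. *)
have Hc : H.[x^*, y] = 0.
  move: Hxy; rewrite !HE !(cayley_sum_reflection _ _ p0) yc conjCK => /eqP; rewrite subr_eq0 => /eqP E.
  rewrite -{1}[cayley_sum p m n x y]conjCK -[cayley_sum p m n x^* y]conjCK E.
  by rewrite rmorphM /= mulrA mum mul1r conjCK subrr.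
rewrite complex_realE eq_le (upper y x) ?sy //=.
have := upper y x^* yr (sy y0) Hc; case: (x) => [x1 x2] /=; rewrite oppr_le0 //.
Qed.

End CayleyTransform.

(** * Branches of the level set at (1, 1) *)

Section LevelBranches.
Variable R : realType.
Local Notation C := (CC R).
Implicit Types (c d : nat -> C) (p F : {poly {poly C}}).

Lemma analytic_geometric (a r : C) : analytic (fun k => a * r ^+ k).
Proof.
exists (1 + `|a|), (1 + `|r|); split; rewrite ?ltr_wpDr // => k.
rewrite normrM normrX ler_pM ?exprn_ge0 // ?lerDr // lerXn2r ?nnegrE ?addr_ge0 //.
by rewrite lerDr.
Qed.

Lemma pval_geometric (a r : C) :
  \forall y \near (0 : C), pval (fun k => a * r ^+ k) y = a / (1 - r * y).
Proof.
have r0 : 0 < 1 + `|r| by rewrite ltr_wpDr.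
have := near0_mul_lt r0 (ltr01 : 0 < 1 :> C); apply: filterS => y ry.
have ry1 : `|r * y| < 1.
  by rewrite normrM; apply: le_lt_trans ry; rewrite ler_wpM2r // lerDr.
have n0 : 1 - r * y != 0.
  by apply: contraTneq ry1 => /eqP; rewrite subr_eq0 => /eqP <-; rewrite normr1 ltxx.
apply: pvalP; apply/cvgrPdist_le => e e0.
have := @cvg_geometric0 R `|a / (1 - r * y)| `|r * y| (normr_ge0 _) ry1.
move=> /(cvgr_dist_le _ _)/(_ e e0); apply: filterS => n; rewrite sub0r normrN.
rewrite normrM normr_id normrX normr_id -normrX -normrM; apply: le_trans.
rewrite le_eqVlt; apply/orP; left; apply/eqP; congr `|_|.
have -> : psum (fun k => a * r ^+ k) y n = a * \sum_(i < n) (r * y) ^+ i.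
  by rewrite psumE big_distrr; apply: eq_bigr => i _; rewrite /= exprMn mulrA.
apply: (mulfI n0); rewrite mulrBr [X in _ - X]mulrCA -[1 - r * y in X in _ - X]opprB mulNr -subrX1.
by field.
Qed.

Lemma near_comp_pval d (P : set C) : analytic d -> d 0 = 0 ->
  (\forall y \near (0 : C), P y) -> \forall s \near (0 : C), P (pval d s).
Proof. by move=> ad d0; have := analytic_cvg0 ad; rewrite d0 => H; exact: H. Qed.

Lemma comp_series0 c d : comp_series c d 0 = c 0.
Proof. by rewrite /comp_series /comp_trunc big_ord1 expr0 coefZ coef1 mulr1. Qed.

Definition icayley (z : C) : C := ii R * (1 - z) / (1 + z).

(* The expansions of icayley (1 + s) at s = 0 and of cayley x at x = 0. *)
Definition icayley_series : nat -> C := cons_series 0 (fun k => - ii R / 2 * (- 2^-1) ^+ k).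
Definition cayley_series : nat -> C := cons_series 1 (fun k => 2 * ii R * ii R ^+ k).

Lemma pval_icayley : \forall s \near (0 : C), pval icayley_series s = icayley (1 + s).
Proof.
have h := near0_mul_lt (ltr01 : 0 < 1 :> C) (ltr01 : 0 < 1 :> C).
move: h (pval_cons 0 (analytic_geometric (- ii R / 2) (- 2^-1))) (pval_geometric (- ii R / 2) (- 2^-1)).
apply: filterS3 => s; rewrite mul1r => s1 -> ->; rewrite add0r /icayley.
have n2 : 1 + (1 + s) != 0.
  apply: contraTneq s1 => /eqP; rewrite addrA -[1 + 1]/(2%:R) addr_eq0 => /eqP s2.
  by rewrite -normrN -s2 normr_nat -real_leNgt ?real1 ?realn // ler1n.
by field.
Qed.

Lemma pval_cayley : \forall x \near (0 : C), pval cayley_series x = cayley x.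
Proof.
have h := near0_mul_lt (ltr01 : 0 < 1 :> C) (ltr01 : 0 < 1 :> C).
move: h (pval_cons 1 (analytic_geometric (2 * ii R) (ii R))) (pval_geometric (2 * ii R) (ii R)).
apply: filterS3 => x; rewrite mul1r => x1 -> ->; rewrite /cayley.
have n0 : 1 - ii R * x != 0.
  apply: contraTneq x1 => /eqP; rewrite subr_eq0 => /eqP E.
  have : `|ii R * x| = 1 by rewrite -E normr1.
  by rewrite normrM /ii normc_def /= expr0n expr1n add0r sqrtr1 mul1r => ->; rewrite ltxx.
by field.
Qed.

Lemma one_sub_ii_icayley (z : C) : 1 + z != 0 -> 1 - ii R * icayley z = 2 / (1 + z).
Proof.
move=> z0; rewrite /icayley mulrA mulrA ii2; by field.
Qed.

Lemma icayleyK (z : C) : 1 + z != 0 -> cayley (icayley z) = z.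
Proof.
move=> z0; rewrite /cayley one_sub_ii_icayley // /icayley mulrA mulrA ii2; by field.
Qed.

Lemma near1_add1_norm (z : C) : `|z - 1| < 1 -> 1 <= `|1 + z|.
Proof.
move=> z1; have := ler_distD (- z) 1 1 .
have : 2 <= `|1 + z| + `|z - 1|.
  by rewrite -(normr_nat C 2) (_ : 2%:R = (1 + z) - (z - 1)) ?ler_normB //; ring.
rewrite -lerBlDr => h _; apply: le_trans h.
by rewrite lerBrDl -[X in _ <= X]/(1 + 1) lerD2r ltW.
Qed.

(** Composing with 1 + X moves z2 = 1 to s = 0, while z1 stays centred at 1. A branch c of H at the
    origin becomes cayley(c(icayley(1 + s))), analytic because both inner series vanish at 0. *)
Lemma local_branches_level p mu : (forall x y, `|x| < 1 -> `|y| < 1 -> p.[x, y] != 0) ->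
  `|mu| = 1 -> let F := reflection p - mu%:P%:P * p in F != 0 ->
  local_branches (map_poly (fun q : {poly C} => q \Po (1 + 'X)) F) 1.
Proof.
move=> stable mu1 F F0.
have p0 : p != 0 by apply: contraTneq (stable 0 0 _ _) => [->||]; rewrite ?normr0 ?ltr01 // !horner0 eqxx.
set m := (size p).-1; set n := (sizeY p).-1.
have sp : size p = m.+1 by rewrite /m prednK // lt0n size_poly_eq0.
have spY : sizeY p = n.+1 by rewrite /n prednK // sizeYE lt0n size_poly_eq0 swapXY_eq0.
pose H := cayley_poly (reflection p) m n - mu%:P%:P * cayley_poly p m n.
have srp : (size (reflection p) <= m.+1)%N by rewrite -sp; exact: size_reflection.
have srY : (sizeY (reflection p) <= n.+1)%N by rewrite -spY; exact: sizeY_reflection.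
have sp' : (size p <= m.+1)%N by rewrite sp.
have spY' : (sizeY p <= n.+1)%N by rewrite spY.
have HE x y : 1 - ii R * x != 0 -> 1 - ii R * y != 0 ->
    H.[x, y] = (1 - ii R * x) ^+ m * (1 - ii R * y) ^+ n * F.[cayley x, cayley y].
  move=> x0 y0. have -> : H.[x, y] = cayley_sum (reflection p) m n x y - mu * cayley_sum p m n x y.
    by rewrite /H !(hornerD, hornerN, hornerM, hornerC) !horner_cayley_poly.
  have -> : F.[cayley x, cayley y] = (reflection p).[cayley x, cayley y] - mu * p.[cayley x, cayley y].
    by rewrite /F !(hornerD, hornerN, hornerM, hornerC).
  rewrite (cayley_sumE srp srY x0 y0).
  rewrite (cayley_sumE sp' spY' x0 y0).
  move: (_ ^+ m) (_ ^+ n) ((reflection p).[_, _]) (p.[_, _]) => e f u v.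
  by ring.
have HF x y : 1 - ii R * x != 0 -> 1 - ii R * y != 0 ->
    (H.[x, y] = 0) <-> (F.[cayley x, cayley y] = 0).
  move=> x0 y0; rewrite HE //; split=> [/eqP|->]; last by rewrite mulr0.
  by rewrite !mulf_eq0 !expf_eq0 (negPf x0) (negPf y0) !andbF => /eqP.
clear HE; clearbody F.
have icn (z : C) : 1 + z != 0 -> 1 - ii R * icayley z != 0.
  by move=> z0; rewrite one_sub_ii_icayley // mulf_neq0 ?invr_eq0.
(* [cayley] takes every value except -1, so H = 0 would make F vanish off the lines x = -1 and y =
   -1; the factor (x + 1)(y + 1) removes the exception. *)
have H0 : H != 0.
  apply: contra_neq F0 => H0.
  have : F * (('X + 1%:P%:P) * ('X + 1%:P)%:P) = 0.
    apply: horner2_inj => x y.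
    have -> : (F * (('X + 1%:P%:P) * ('X + 1%:P)%:P)).[x, y] = F.[x, y] * ((1 + x) * (1 + y)).
      rewrite hornerM hornerM; congr (_ * _).
      by rewrite hornerM hornerM hornerD hornerX !hornerC !hornerD !hornerC hornerX ![1 + _]addrC.
    rewrite !horner0.
    have [->|x0] := eqVneq (1 + x) 0; first by rewrite mul0r mulr0.
    have [->|y0] := eqVneq (1 + y) 0; first by rewrite !mulr0.
    rewrite -[x in F.[x, _]]icayleyK // -[y in F.[_, y]]icayleyK //.
    suff -> : F.[cayley (icayley x), cayley (icayley y)] = 0 by rewrite mul0r.
    by apply/(HF _ _ (icn _ x0) (icn _ y0)); rewrite H0 !horner0.
  move/eqP; rewrite !mulf_eq0 => /or3P[/eqP //||].
    move/eqP/(congr1 (fun q : {poly {poly C}} => q.[0, 0])).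
    by rewrite !(hornerD, hornerC, hornerX) ?horner0 add0r => /eqP; rewrite oner_eq0.
  rewrite polyC_eq0 => /eqP/(congr1 (fun q : {poly C} => q.[0])).
  by rewrite !(hornerD, hornerC, hornerX) ?horner0 add0r => /eqP; rewrite oner_eq0.
have [B [Bf Bc [r r0 Br]]] := real_rooted_local_branches H0 (real_rooted_cayley stable mu1 H0) 0.
pose psi c := comp_series cayley_series (comp_series c icayley_series).
have aY : analytic icayley_series by apply: analytic_cons; exact: analytic_geometric.
have aM : analytic cayley_series by apply: analytic_cons; exact: analytic_geometric.
have psiP c : B c -> analytic (psi c) /\
    \forall s \near (0 : C), pval (psi c) s = cayley (pval c (icayley (1 + s))).
  move=> /Bc[ac c0 _]; have [a1 e1] := analytic_comp ac aY erefl.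
  have c10 : comp_series c icayley_series 0 = 0 by rewrite comp_series0.
  have [a2 e2] := analytic_comp aM a1 c10; split=> //.
  have e3 : \forall s \near (0 : C), pval cayley_series (pval (comp_series c icayley_series) s)
      = cayley (pval (comp_series c icayley_series) s).
    exact: near_comp_pval a1 c10 pval_cayley.
  have e4 : \forall s \near (0 : C), pval (comp_series c icayley_series) s =
      pval c (pval icayley_series s) /\ pval icayley_series s = icayley (1 + s).
    exact: filterI e1 pval_icayley.
  move: e2 e3 e4; apply: filterS3 => s e2 e3 [e1' e4].
  exact: (etrans e2 (etrans e3 (congr1 (@cayley R) (etrans e1' (congr1 (pval c) e4))))).
exists (psi @` B); split; first exact: finite_image.
  move=> _ [c Bcc <-]; have [a e] := psiP c Bcc; have [ac c0 cH] := Bc c Bcc.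
  split=> //; first by rewrite /psi comp_series0.
  have cH' := near_comp_pval aY erefl cH.
  have cs : \forall y \near (0 : C), 1 - ii R * pval c y != 0.
    have l := near0_mul_lt (ltr01 : 0 < 1 :> C) (ltr01 : 0 < 1 :> C).
    have := near_comp_pval ac c0 l; apply: filterS => y; rewrite mul1r => y1.
    apply: contraTneq y1 => /eqP; rewrite subr_eq0 => /eqP E.
    have : `|ii R * pval c y| = 1 by rewrite -E normr1.
    by rewrite normrM /ii normc_def /= expr0n expr1n add0r sqrtr1 mul1r => ->; rewrite ltxx.
  have cs' := near_comp_pval aY erefl cs.
  have l := near0_mul_lt (ltr01 : 0 < 1 :> C) (ltr01 : 0 < 1 :> C).
  have f1 : \forall s \near (0 : C), (pval icayley_series s != 0 ->
      H.[pval c (pval icayley_series s), pval icayley_series s] = 0) /\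
      pval icayley_series s = icayley (1 + s) by exact: filterI cH' pval_icayley.
  have f2 : \forall s \near (0 : C), 1 - ii R * pval c (pval icayley_series s) != 0 /\
      1 * `|s| < 1 by exact: filterI cs' l.
  move: e f1 f2; apply: filterS3 => s -> [h1 h2] [h3 h4] s0.
  rewrite h2 in h1 h3; rewrite mul1r in h4.
  have n2 : 1 + (1 + s) != 0.
    rewrite -normr_gt0; apply: lt_le_trans (near1_add1_norm _) => //.
    by rewrite addrAC subrr add0r.
  rewrite horner_map_comp !(hornerD, hornerC, hornerX).
  rewrite -[X in F.[_, X]](icayleyK n2); apply/HF => //; first exact: icn.
  apply: h1; rewrite /icayley !mulf_neq0 ?invr_eq0 //; last by rewrite opprD addrA subrr add0r oppr_eq0.
  by apply: contra_eq_neq (ii2 R) => ->; rewrite mul0r eq_sym oppr_eq0 oner_eq0.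
have hB : \forall s \near (0 : C), forall c, B c -> pval (psi c) s = cayley (pval c (icayley (1 + s))).
  by apply: near_finite_set => // c /psiP[].
(* Below 1, so that |1 + z| >= 1 and z is the Cayley image of [icayley z]; below r, so that |icayley
   z| <= |1 - z| < r. *)
exists (r / (1 + r)); first by rewrite divr_gt0 // addr_gt0.
have rr : r / (1 + r) < 1 by rewrite ltr_pdivrMr ?addr_gt0 // mul1r ltrDr.
have rr' : r / (1 + r) <= r by rewrite ler_pdivrMr ?addr_gt0 // ler_peMr ?lerDl // ltW.
have l := near0_mul_lt (ltr01 : 0 < 1 :> C) (ltr01 : 0 < 1 :> C).
have f1 : \forall s \near (0 : C), (pval icayley_series s != 0 ->
    forall x, `|x - 0| < r -> H.[x, pval icayley_series s] = 0 ->
      exists2 c, B c & x = pval c (pval icayley_series s)) /\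
    pval icayley_series s = icayley (1 + s).
  exact: filterI (near_comp_pval aY erefl Br) pval_icayley.
move: hB f1 l; apply: filterS3 => s hB [h1 h2] h4 s0 z zr; rewrite h2 in h1; rewrite mul1r in h4.
rewrite horner_map_comp !(hornerD, hornerC, hornerX) => Fz.
have n2 : 1 + (1 + s) != 0.
  rewrite -normr_gt0; apply: lt_le_trans (near1_add1_norm _) => //.
  by rewrite addrAC subrr add0r.
have z1 := near1_add1_norm (lt_trans zr rr).
have n1 : 1 + z != 0 by rewrite -normr_gt0; apply: lt_le_trans z1.
have [|||c Bcc cE] := h1 _ (icayley z).
- rewrite /icayley !mulf_neq0 ?invr_eq0 //; last by rewrite opprD addrA subrr add0r oppr_eq0.
  by apply: contra_eq_neq (ii2 R) => ->; rewrite mul0r eq_sym oppr_eq0 oner_eq0.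
- rewrite subr0 /icayley !normrM normfV /ii normc_def /= expr0n expr1n add0r sqrtr1 mul1r.
  rewrite ltr_pdivrMr ?normr_gt0 // distrC; apply: lt_le_trans (lt_le_trans zr rr') _.
  by rewrite ler_peMr // ltW.
- by apply/HF; rewrite ?icn // !icayleyK.
by exists (psi c); [exists c|rewrite hB // -cE icayleyK].
Qed.

End LevelBranches.

(** * Boundary behaviour at (1, 1) along the line z2 = 1 *)

Section BoundaryContact.
Variable R : realType.
Local Notation C := (CC R).
Local Notation Re z := (complex.Re (z : R[i])).
Implicit Types (p F : {poly {poly C}}) (q : {poly C}).

(** Expanding the squared norms gives 2 Re (P^* e) + |e|^2 <= 0. *)
Lemma Re_conj_le0 (P e : C) : `|P + e| <= `|P| -> Re (P^* * e) <= 0.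
Proof.
case: P e => [p1 p2] [e1 e2]; rewrite !normc_def lecR /= ler_sqrt ?addr_ge0 ?sqr_ge0 //.
by nra.
Qed.

Lemma Re_limit_le0 q : (\forall y \near (0 : C), 0 < y -> Re q.[y] <= 0) -> Re q.[0] <= 0.
Proof.
move=> qy; rewrite leNgt; apply/negP => q0.
have e0 : 0 < ((Re q.[0])%:C%C : C) by rewrite (_ : 0 = 0%:C%C :> C) // ltcR.
have h1 : \forall y \near (0 : C), `|q.[0] - q.[y]| < ((Re q.[0])%:C%C : C).
  exact: cvgr_dist_lt _ _ (@cvg_horner _ q C (nbhs (0 : C)) _ id 0 cvg_id) _ e0.
have [y [y0 [h2 /(_ y0) h3] _]] := near0_pos (filterI h1 qy) h1 (normr1 C).
move: h2 h3; case: (q.[y]) (q.[0]) => [a b] [c d] /= h2 h3.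
have : `|c - a| < c.
  by rewrite -ltcR; apply: le_lt_trans h2; rewrite normc_def lecR /= -sqrtr_sqr ler_wsqrtr // lerDl sqr_ge0.
by rewrite ltr_norml => /andP[_]; lra.
Qed.

Lemma horner_conj_poly q (b : C) : b \is Num.real -> (map_poly Num.conj q).[b] = (q.[b])^*.
Proof. by move=> br; rewrite -[b in LHS](CrealP br) horner_map. Qed.

Lemma Re_pos_mul (b z : C) : 0 < b -> (Re (b * z) <= 0) = (Re z <= 0).
Proof.
move=> /pos_complexE[r r0 ->]; case: z => x y /=.
by rewrite mul0r subr0 pmulr_rle0.
Qed.

(** A direction - v with Re v > 0 points into the disc at 1: |1 - b v|^2 = 1 - b (2 Re v - b
    |v|^2). *)
Lemma near_in_disc (v : C) : 0 < Re v -> \forall b \near (0 : C), 0 < b -> `|1 - b * v| < 1.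
Proof.
case: v => v1 v2 /= v0.
have e0 : 0 < ((v1 / (v1 ^+ 2 + v2 ^+ 2))%:C%C : C).
  by rewrite (_ : 0 = 0%:C%C :> C) // ltcR divr_gt0 // ltr_pwDl ?sqr_ge0 // exprn_gt0.
have := near0_mul_lt (ltr01 : 0 < 1 :> C) e0; apply: filterS => b + b0.
rewrite mul1r gtr0_norm //; have [r r0 ->] := pos_complexE b0; rewrite ltcR => rv.
rewrite normc_def (_ : 1 = 1%:C%C :> C) // ltcR /=.
have v20 : 0 < v1 ^+ 2 + v2 ^+ 2 by rewrite ltr_pwDl ?sqr_ge0 // exprn_gt0.
rewrite ltr_pdivlMr // in rv.
rewrite -[X in _ < X]sqrtr1 ltr_sqrt //.
rewrite (_ : _ + _ = 1 - r * (2 * v1 - r * (v1 ^+ 2 + v2 ^+ 2))); last by ring.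
by rewrite gtrBl mulr_gt0 // subr_gt0 (lt_trans rv) // ltr_pMl // ltr1n.
Qed.

Lemma conj_expi (t : R) : (expi t)^* = expi (- t).
Proof. by rewrite /expi cosN sinN. Qed.

(** With u = exp(- i t / N) and v = exp(i t / k) the product is exp(2 i t), where |t| < pi / 2. The
    angles 2 t = 0, pi / 2, - pi / 2 and 3 pi / 4 already force Re A <= 0, Im A = 0 and Re A >=
    0. *)
Lemma no_half_plane (A : C) N k : (0 < N)%N -> (0 < k)%N ->
  (forall u v : C, 0 < Re u -> 0 < Re v -> Re (A * (u^* ^+ N * v ^+ k)) <= 0) -> A = 0.
Proof.
move=> N0 k0 H.
have sector (t : R) n : (0 < n)%N -> `|t| < pi / 2 -> 0 < Re (expi (t / n%:R)).
  move=> n0 tp; have n1 : 1 <= n%:R :> R by rewrite ler1n.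
  have : `|t / n%:R| < pi / 2.
    rewrite normrM normfV normr_nat; apply: le_lt_trans tp.
    by rewrite ler_pdivrMr ?ltr0n // ler_peMr.
  by rewrite ltr_norml => ?; apply: cos_gt0_pihalf.
have turn (t : R) : `|t| < pi / 2 -> Re (A * expi (t + t)) <= 0.
  move=> tp; have := H (expi (- t / N%:R)) (expi (t / k%:R)).
  rewrite !sector ?normrN // => /(_ isT isT).
  rewrite conj_expi !expi_exp -expiD -mulNr opprK -[_ / _ *+ N]mulr_natr -[_ / _ *+ k]mulr_natr.
  by rewrite !mulfVK ?pnatr_eq0 -?lt0n.
have pi0 := pi_gt0 R.
have lt1 : `|pi / 4 : R| < pi / 2 by rewrite gtr0_norm; lra.
have lt3 : `|pi / 4 + pi / 8 : R| < pi / 2 by rewrite gtr0_norm; lra.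
have := turn _ lt1; have := turn (- (pi / 4)); rewrite normrN => /(_ lt1).
have := turn _ lt3; have := turn (- (pi / 4 + pi / 8)); rewrite normrN => /(_ lt3).
have := turn 0; rewrite normr0 => /(_ _); rewrite divr_gt0 // => /(_ isT).
rewrite -!opprD -!conj_expi.
have -> : pi / 4 + pi / 4 = pi / 2 :> R by lra.
have -> : pi / 4 + pi / 8 + (pi / 4 + pi / 8) = pi / 4 + pi / 2 :> R by lra.
have s4 : 0 < sin (pi / 4 : R) by apply: sin_gt0_pi; lra.
rewrite addr0 /expi cosDpihalf sinDpihalf cos_pihalf sin_pihalf cos0 sin0.
case: A {H turn} => a b /= h1 h2 h3 h4 h5.
have b0 : b = 0 by lra.
have a0 : a = 0 by rewrite b0 in h1 h2 h3 h4 h5; nra.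
by rewrite a0 b0.
Qed.

Lemma slice_factor F (a : C) : slice F a = 0 -> exists G, F = ('X - a%:P)%:P * G.
Proof.
move=> Fa; exists (\poly_(i < size F) (F`_i %/ ('X - a%:P))); apply/polyP => i.
rewrite coefCM coef_poly; case: ltnP => [iF|Fi]; last by rewrite mulr0 nth_default.
by rewrite mulrC divpK // dvdp_XsubCl /root -coef_slice Fa coef0.
Qed.

(** Vanishing on the line z2 = a means divisibility by z2 - a, which would be a nonconstant common
    factor. *)
Lemma no_common_slice p F (a : C) : no_common_factor p F -> slice p a = 0 -> slice F a = 0 -> False.
Proof.
move=> nc /slice_factor[u pE] /slice_factor[v FE].
have [c cE] := nc _ _ _ pE FE; have := congr1 (fun P : {poly {poly C}} => size P`_0) cE.
by rewrite !coefC eqxx size_XsubC => s; have := size_polyC_leq1 c; rewrite -s.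
Qed.

Lemma reflection_11 p : p.[1, 1] = 0 -> (reflection p).[1, 1] = 0.
Proof. by move=> p1; rewrite reflectionE ?oner_neq0 // conjC1 invr1 p1 rmorph0 mulr0. Qed.

(* |p + e| <= |p| makes Re (p^* e) <= 0 for e = (z2 - 1)^k G; letting z2 -> 1 and then
   z1 -> 1 leaves Re (A u^*^N v^k) <= 0 on two half-planes, so that A = 0. *)
Lemma level_root_11 p mu k G : (forall x y, `|x| < 1 -> `|y| < 1 -> p.[x, y] != 0) ->
  no_common_factor p (reflection p) -> p.[1, 1] = 0 -> `|mu| = 1 ->
  map_poly (fun q : {poly C} => q \Po (1 + 'X)) (reflection p - mu%:P%:P * p) = ('X^k)%:P * G ->
  G.[1, 0] = 0.
Proof.
move=> stable nc p11 mu1 GE.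
have FG z s : (reflection p).[z, 1 + s] - mu * p.[z, 1 + s] = s ^+ k * G.[z, s].
  have := congr1 (fun P : {poly {poly C}} => P.[z, s]) GE.
  rewrite horner_map_comp !(hornerD, hornerN, hornerM, hornerC, hornerX) hornerXn => <-.
  by [].
have [k0|k0] := posnP k.
  by have := FG 1 0; rewrite k0 expr0 mul1r addr0 reflection_11 // p11 mulr0 subrr.
(* For k > 0 the level equation gives p~ = mu p on the line z2 = 1, so p and p~ would both vanish
   there. *)
have q0 : slice p 1 != 0.
  apply/negP => /eqP q0; apply: (no_common_slice nc q0); apply: horner_inj => x.
  rewrite horner_slice horner0; have := FG x 0.
  by rewrite addr0 -(horner_slice p) q0 horner0 mulr0 subr0 expr0n eqn0Ngt k0 mul0r.
have [N [q2]] := multiplicity_XsubC (slice p 1) 1; rewrite q0 /= => q21 qE.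
have N0 : (0 < N)%N.
  rewrite lt0n; apply: contraNneq q21 => n0; rewrite /root.
  by rewrite -[q2]mulr1 -(expr0 ('X - 1%:P)) -n0 -qE horner_slice p11.
have mu0 : mu != 0 by rewrite -normr_gt0 mu1.
apply/eqP; apply: contraT => G10.
have step1 (z v : C) : `|z| < 1 -> 0 < Re v ->
    Re ((mu * (slice p 1).[z])^* * ((- v) ^+ k * G.[z, 0])) <= 0.
  move=> z1 v0.
  (* Here z2 = 1 - b v and b^k is divided out. Conjugating coefficients makes the expression
     polynomial in b for real b, so that b can tend to 0. *)
  pose Phi := map_poly Num.conj (mu *: (p.[z%:P] \Po (1 - v *: 'X)))
     * ((- v) ^+ k *: (G.[z%:P] \Po (- v *: 'X))).
  have PhiE b : b \is Num.real ->
      Phi.[b] = (mu * p.[z, 1 - b * v])^* * ((- v) ^+ k * G.[z, - (b * v)]).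
    move=> br; rewrite /Phi hornerM horner_conj_poly // !hornerZ !horner_comp.
    by rewrite !(hornerD, hornerN, hornerC, hornerZ, hornerX) ![v * b]mulrC mulNr [v * b]mulrC.
  have := PhiE 0 (real0 _); rewrite mul0r oppr0 addr0 horner_slice => <-.
  apply: Re_limit_le0.
  have hv := near_in_disc v0.
  have hw : \forall b \near (0 : C), b * v != 1.
    have e0 : 0 < 1 + `|v| by rewrite ltr_wpDr.
    have := near0_mul_lt e0 (ltr01 : 0 < 1 :> C); apply: filterS => b bv.
    apply: contraTneq bv => bv; rewrite -real_leNgt ?realM ?realD ?real1 ?normr_real //.
    by rewrite mulrDl mul1r -normrM mulrC bv normr1 lerDr.
  move: hv hw; apply: filterS2 => b hv hw b0.
  rewrite PhiE ?gtr0_real // -(Re_pos_mul _ (exprn_gt0 k b0)).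
  rewrite mulrCA; have -> : b ^+ k * ((- v) ^+ k * G.[z, - (b * v)]) = (- (b * v)) ^+ k * G.[z, - (b * v)].
    by rewrite mulrA -exprMn mulrN.
  rewrite -FG; apply: Re_conj_le0; rewrite addrC subrK normrM mu1 mul1r.
  by apply: reflection_le_disc => //; [rewrite subr_eq0 eq_sym|exact: hv].
move/negP: G10; case; apply/eqP.
pose A := (mu * (- 1) ^+ N * q2.[1])^* * ((- 1) ^+ k * G.[1, 0]).
suff /eqP : A = 0.
  rewrite mulf_eq0 conjC_eq0 !mulf_eq0 (negPf mu0) !signr_eq0 /= => /orP[q2r|/eqP //].
  by move: q21; rewrite /root q2r.
apply: (no_half_plane N0 k0) => u v u0 v0.
(* The same device with z1 = 1 - b u: p(., 1) vanishes at 1 to order exactly N, and b^N is divided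
   out. *)
pose Phi := map_poly Num.conj ((mu * (- u) ^+ N) *: (q2 \Po (1 - u *: 'X)))
   * ((- v) ^+ k *: (slice G 0 \Po (1 - u *: 'X))).
have PhiE b : b \is Num.real ->
    Phi.[b] = (mu * (- u) ^+ N * q2.[1 - b * u])^* * ((- v) ^+ k * G.[1 - b * u, 0]).
  move=> br; rewrite /Phi hornerM horner_conj_poly // !hornerZ !horner_comp horner_slice.
  by rewrite !(hornerD, hornerN, hornerC, hornerZ, hornerX) ![u * b]mulrC.
have -> : A * (u^* ^+ N * v ^+ k) = Phi.[0].
  rewrite PhiE ?real0 // mul0r subr0 /A !rmorphM !rmorphXn !rmorphN /= rmorph1.
  rewrite [(- u^*) ^+ N]exprNn [(- v) ^+ k]exprNn; ring.
apply: Re_limit_le0; have := near_in_disc u0; apply: filterS => b hu b0.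
have br : b \is Num.real by rewrite gtr0_real.
rewrite PhiE // -(Re_pos_mul _ (exprn_gt0 N b0)).
have := step1 (1 - b * u) v (hu b0) v0; rewrite qE hornerM horner_exp hornerXsubC.
rewrite addrAC subrr add0r.
suff -> : b ^+ N * ((mu * (- u) ^+ N * q2.[1 - b * u])^* * ((- v) ^+ k * G.[1 - b * u, 0])) =
  (mu * (q2.[1 - b * u] * (- (b * u)) ^+ N))^* * ((- v) ^+ k * G.[1 - b * u, 0]) by [].
rewrite -[- (b * u)]mulrN exprMn !rmorphM !rmorphXn /= (CrealP br); ring.
Qed.

End BoundaryContact.

(** * Irreducible components *)

Section Components.

(** B meets P in a relatively clopen set: the other pieces are finitely many and relatively closed,
    and they meet P at most in o, which B avoids. *)
Lemma connected_in_piece (T : topologicalType) (V B : set T) (PS : set (set T)) (o : T) :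
  finite_set PS -> (forall P, PS P -> closure P `&` V `<=` P) ->
  (forall P Q, PS P -> PS Q -> P <> Q -> P `&` Q `<=` [set o]) ->
  connected B -> B `<=` V -> B `<=` \bigcup_(P in PS) P -> ~ B o ->
  forall P x, PS P -> P x -> B x -> B `<=` P.
Proof.
move=> PSf Pcl Pdisj cB BV BPS Bo P x PSP Px Bx.
have clBP y Q : PS Q -> B y -> closure Q y -> Q y.
  by move=> PSQ By Qy; apply: Pcl => //; split=> //; exact: BV.
suff <- : B `&` P = B by move=> y [].
apply: cB; first by exists x.
  exists (~` \bigcup_(Q in [set Q | PS Q /\ Q <> P]) closure Q).
    apply/closed_openC; apply: closed_bigcup => [|Q _]; last exact: closed_closure.
    by apply: sub_finite_set PSf => Q [].
  apply/seteqP; split=> [y [By Py]|y [By nQ]]; split=> //.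
    case=> Q [PSQ QP] Qy; apply: Bo; rewrite -(Pdisj Q P PSQ PSP QP y) //.
    by split=> //; exact: clBP Qy.
  have [Q PSQ Qy] := BPS y By; have [<- //|QP] := pselect (Q = P).
  by case: nQ; exists Q => //; exact: subset_closure.
exists (closure P); first exact: closed_closure.
apply/seteqP; split=> [y [By Py]|y [By Py]]; split=> //; first exact: subset_closure.
exact: clBP Py.
Qed.

Variable R : realType.
Local Notation C := (CC R).

(** A piece P without o is a connected set of regular points, so a component of the regular points
    that meets P lies between P minus o and P, and its closure restores o. A regular o could join
    several pieces, which the last hypothesis rules out. *)
Lemma irreducible_components_pieces (V A : set (C * C)) (PS : set (set (C * C))) (o : C * C) :
  finite_set PS -> A = \bigcup_(P in PS) P ->
  (forall P, PS P -> [/\ P `<=` V, closure P `&` V `<=` P, P o,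
     closure (P `\ o) o & connected P /\ connected (P `\ o)]) ->
  (forall P Q, PS P -> PS Q -> P <> Q -> P `&` Q `<=` [set o]) ->
  (forall x, A x -> x <> o -> regular_point A x) ->
  (regular_point A o -> forall P Q, PS P -> PS Q -> P = Q) ->
  forall S, irreducible_component V A S <-> PS S.
Proof.
move=> PSf AE PSP Pdisj reg rego.
have comp P x : PS P -> P x -> regular_point A x ->
    closure (connected_component (regular_point A) x) `&` V = P.
  move=> PP Px rx; have [PV Pcl Po Poc [cP cPo]] := PSP P PP.
  set K := connected_component (regular_point A) x.
  have Kreg : K `<=` regular_point A by exact: connected_component_sub.
  have KA : K `<=` A by move=> y /Kreg[].
  have PA : P `<=` A by move=> y Py; rewrite AE; exists P.
  have KP : K `<=` P.
    have [Ko|Ko] := pselect (K o).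
      move=> y /KA; rewrite AE => -[Q PQ Qy].
      by rewrite (rego (Kreg _ Ko) P Q PP PQ).
    apply: (connected_in_piece PSf _ Pdisj _ _ _ Ko PP Px).
    - by move=> Q /PSP[_ H _ _ _]; exact: H.
    - exact: component_connected.
    - by move=> y /KA; rewrite AE => -[Q /PSP[QV _ _ _ _]] /QV.
    - by move=> y /KA; rewrite AE.
    - exact: connected_component_refl.
  have PK : P `\ o `<=` K.
    have [xo|xo] := pselect (x = o).
      apply: (@subset_trans _ P); first by move=> y [].
      apply: connected_component_max => // y Py.
      have [yo|yo] := pselect (y = o); first by rewrite yo -xo.
      by apply: reg => //; exact: PA.
    apply: connected_component_max => // [y [Py yo]]; apply: reg => //; exact: PA.
  apply/seteqP; split=> [y [/(closureS KP) Py Vy]|y Py]; first exact: Pcl.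
  split; last exact: PV.
  have [->|yo] := pselect (y = o); first by apply: (closureS PK).
  by apply: subset_closure; exact: PK.
move=> S; split=> [[x rx ->]|PSS].
  have [P PP Px] : (\bigcup_(P in PS) P) x by rewrite -AE; case: rx.
  by rewrite (comp P).
have [SV Scl So Soc _] := PSP S PSS.
have [x [[Sx xo] _]] : exists x, (S `\ o) x /\ setT x by exact: (Soc setT filterT).
have rx : regular_point A x by apply: reg => //; rewrite AE; exists S.
by exists x => //; rewrite (comp S).
Qed.

Lemma segment_component (D : set C) (a b : C) :
  (forall t : R, 0 <= t <= 1 -> D (a + t%:C%C * (b - a))) -> connected_component D a b.
Proof.
move=> Dt; pose g (t : R) : C := a + t%:C%C * (b - a).
exists (g @` `[0, 1]%classic); last first.
  by exists 1; rewrite /= ?in_itv /= ?ler01 ?lexx // /g mul1r addrC subrK.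
split.
- by exists 0; rewrite /= ?in_itv /= ?ler01 ?lexx // /g mul0r addr0.
- by move=> _ [t /= + <-]; rewrite in_itv /= => /Dt.
apply: connected_continuous_connected; first exact: segment_connected.
apply: continuous_subspaceT => t.
exact: (cvgD (cvg_cst a) (cvgM (cvg_real_complex _ (@cvg_id R (nbhs t))) (cvg_cst (b - a)))).
Qed.

Lemma segment_norm_lt (a b d : C) (t : R) : `|a| < d -> `|b| < d -> 0 <= t <= 1 ->
  `|a + t%:C%C * (b - a)| < d.
Proof.
move=> ad bd /andP[t0 t1].
have T0 : 0 <= (t%:C%C : C) by rewrite (_ : 0 = 0%:C%C :> C) // lecR.
have T1 : 0 <= 1 - (t%:C%C : C) by rewrite subr_ge0 (_ : 1 = 1%:C%C :> C) // lecR.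
have -> : a + t%:C%C * (b - a) = (1 - t%:C%C) * a + t%:C%C * b by ring.
apply: le_lt_trans (ler_normD _ _) _; rewrite !normrM (ger0_norm T0) (ger0_norm T1).
have -> : d = (1 - t%:C%C) * d + t%:C%C * d by ring.
have [T10|T10] := eqVneq (t%:C%C : C) 1.
  by rewrite T10 subrr !mul0r !mul1r !add0r.
apply: ltr_leD; last by rewrite ler_wpM2l // ltW.
by rewrite ltr_pM2l // lt_neqAle eq_sym subr_eq0 eq_sym T10 T1.
Qed.

Lemma connected_from (D : set C) b : (forall x, D x -> connected_component D b x) -> connected D.
Proof.
move=> Db; have [x Dx|D0] := pselect (exists x, D x); last first.
  by have -> : D = set0 by [apply/seteqP; split=> // y Dy; apply: D0; exists y]; exact: connected0.
suff -> : D = connected_component D b by exact: component_connected.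
by apply/seteqP; split=> y; [exact: Db|exact: connected_component_sub].
Qed.

Lemma connected_disc (d : C) : connected [set s : C | `|s| < d].
Proof.
apply: (@connected_from _ 0) => s /= sd; apply: segment_component => t t01 /=.
by apply: segment_norm_lt => //; rewrite normr0; apply: le_lt_trans sd.
Qed.

(** Segments from the positive point [b1] reach everything except the negative real axis, which is
    reached from [b2] on the imaginary axis. *)
Lemma connected_punctured_disc (d : C) : connected [set s : C | `|s| < d /\ s != 0].
Proof.
have [d0|d0] := boolP (0 < d); last first.
  have -> : [set s : C | `|s| < d /\ s != 0] = set0; last exact: connected0.
  apply/seteqP; split=> // s /= [sd _]; move/negP: d0; apply.
  by apply: le_lt_trans sd.
have [r r0 dE] := pos_complexE d0; set D := [set s : C | _].
have r20 : 0 < r / 2 by rewrite divr_gt0.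
have rd : r / 2 < r by rewrite ltr_pdivrMr // ltr_pMr // ltr1n.
pose b1 : C := (r / 2)%:C%C; pose b2 : C := (0 +i* (r / 2))%C.
have n1 : `|b1| < d.
  by rewrite dE normc_def ltcR /= expr0n addr0 sqrtr_sqr gtr0_norm.
have n2 : `|b2| < d.
  by rewrite dE normc_def ltcR /= expr0n add0r sqrtr_sqr gtr0_norm.
have eq0 (z : C) : z != 0 -> complex.Re (z : R[i]) != 0 \/ complex.Im (z : R[i]) != 0.
  case: z => x y; rewrite eq_complex /= negb_and => /orP[]; by [left|right].
have seg (a b : C) : `|a| < d -> `|b| < d ->
   (forall t : R, 0 <= t <= 1 -> a + t%:C%C * (b - a) != 0) -> connected_component D a b.
  move=> ad bd nz; apply: segment_component => t t01; split; last exact: nz.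
  exact: segment_norm_lt.
have nzE (z : C) : complex.Re (z : R[i]) != 0 \/ complex.Im (z : R[i]) != 0 -> z != 0.
  by case: z => x y; rewrite eq_complex /= negb_and => -[] ->; rewrite ?orbT.
have b12 : connected_component D b1 b2.
  apply: seg => // t /andP[t0 t1]; apply: nzE.
  have [->|tn0] := eqVneq t 0; [left|right] => /=.
    by rewrite !mul0r subr0 addr0 gt_eqF.
  have tp : 0 < t by rewrite lt_neqAle eq_sym tn0.
  rewrite gt_eqF //; have := mulr_gt0 tp r20; lra.
apply: (@connected_from _ b1) => s [sd s0].
have [sR|sR] := boolP ((complex.Im (s : R[i]) == 0) && (complex.Re (s : R[i]) < 0)).
  apply: connected_component_trans b12 _; apply: connected_component_sym.
  apply: seg => // t /andP[t0 t1]; apply: nzE.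
  move: sR; case: (s) => [x y] /= /andP[/eqP -> x0].
  have [->|tn0] := eqVneq t 0; [left|right] => /=.
    by rewrite !mul0r subr0 addr0 lt_eqF.
  have tp : 0 < t by rewrite lt_neqAle eq_sym tn0.
  rewrite gt_eqF //; have := mulr_gt0 tp r20; lra.
apply: connected_component_sym; apply: seg => // t /andP[t0 t1]; apply: nzE.
move: sR s0; rewrite negb_and; case: (s) => [x y] /= sR.
rewrite eq_complex /= => s0.
have [y0|y0] := eqVneq y 0.
  left; move: sR s0; rewrite y0 eqxx /= -leNgt andbT => x0 xn0.
  have xp : 0 < x by rewrite lt_neqAle eq_sym xn0.
  have [->|tn0] := eqVneq t 0; first by rewrite !mul0r subr0 addr0 gt_eqF.
  have tp : 0 < t by rewrite lt_neqAle eq_sym tn0.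
  rewrite gt_eqF //; have := mulr_gt0 tp r20; have : 0 <= (1 - t) * x by rewrite mulr_ge0 ?subr_ge0 // ltW.
  lra.
have [t1'|t1'] := eqVneq t 1.
  by left; rewrite t1' /= mul1r mul0r subr0 addrC subrK gt_eqF.
right; have -> : y + (t * (0 - y) + 0 * (r / 2 - x)) = (1 - t) * y by ring.
by rewrite mulf_neq0 // subr_eq0 eq_sym.
Qed.

End Components.

(** * Pieces parametrised by discs *)

Section LevelComponents.
Variable R : realType.
Local Notation C := (CC R).
Implicit Types (c d : nat -> C) (F G : {poly {poly C}}).

(** Since phi takes the value o only at s = 0, P minus o is the image of the punctured disc. *)
Lemma param_piece (phi : C -> C * C) (e : C) (o : C * C) : 0 < e -> phi 0 = o ->
  (forall s, `|s| < e -> phi s = o -> s = 0) ->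
  (forall s, `|s| < e -> {for s, continuous phi}) ->
  let P := phi @` [set s | `|s| < e] in
  [/\ P o, closure (P `\ o) o & connected P /\ connected (P `\ o)].
Proof.
move=> e0 phi0 phio cphi P.
have within (D : set C) : D `<=` [set s | `|s| < e] -> {within D, continuous phi}.
  by move=> De; apply: continuous_in_subspaceT => s; rewrite inE => /De; exact: cphi.
have Po : P `\ o = phi @` [set s | `|s| < e /\ s != 0].
  apply/seteqP; split=> [y [[s /= se <-] so]|y [s /= [se s0] <-]].
    by exists s => //=; split=> //; apply/eqP => s0; apply: so; rewrite s0.
  by split; [exists s|move/(phio _ se)/eqP; rewrite (negPf s0)].
split.
- by exists 0; rewrite //= normr0.
- move=> B oB; have c0 : {for 0, continuous phi} by apply: cphi; rewrite normr0.
  have nB : \forall s \near (0 : C), B (phi s) by apply: c0; rewrite phi0.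
  have l := near0_mul_lt (ltr01 : 0 < 1 :> C) e0.
  have [s [s0 [sB se] _]] := near0_pos (filterI nB l) l (normr1 C).
  exists (phi s); split=> //; rewrite Po; exists s => //=.
  by move: se; rewrite mul1r gt_eqF.
split; last rewrite Po; apply: connected_continuous_connected.
- exact: connected_disc.
- exact: within.
- exact: connected_punctured_disc.
- by apply: within => s [].
Qed.

(** The image of tau is connected and covers A minus o near o. It meets every piece, because o is a
    limit of each, hence lies in every piece; but distinct pieces share at most o. *)
Lemma single_piece (V A : set (C * C)) (PS : set (set (C * C))) (o : C * C)
    (tau : C -> C * C) (r : C) :
  finite_set PS -> A = \bigcup_(P in PS) P -> A `<=` V ->
  (forall P, PS P -> closure P `&` V `<=` P /\ closure (P `\ o) o) ->
  (forall P Q, PS P -> PS Q -> P <> Q -> P `&` Q `<=` [set o]) ->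
  (forall s, `|s| < r -> s != 0 -> A (tau s) /\ tau s <> o) ->
  (forall s, `|s| < r -> {for s, continuous tau}) ->
  (\forall y \near o, A y -> y <> o -> exists2 s, `|s| < r /\ s != 0 & tau s = y) ->
  forall P Q, PS P -> PS Q -> P = Q.
Proof.
move=> PSf AE AV PSP Pdisj tauA taucont cover P Q PP PQ.
pose T := tau @` [set s | `|s| < r /\ s != 0].
have TA : T `<=` A by move=> _ [s /= [sr s0] <-]; have [] := tauA s sr s0.
have cT : connected T.
  apply: connected_continuous_connected; first exact: connected_punctured_disc.
  by apply: continuous_in_subspaceT => s; rewrite inE => -[/= sr _]; exact: taucont.
have To : ~ T o by move=> [s /= [sr s0] so]; have [_] := tauA s sr s0.
have meet S : PS S -> exists2 y, (S `\ o) y & T y.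
  move=> PSS; have [_ Soc] := PSP S PSS; have [y [[Sy yo] Ty]] := Soc _ cover.
  by exists y => //; apply: Ty => //; rewrite AE; exists S.
have sub S : PS S -> T `<=` S.
  move=> PSS; have [y [Sy _] Ty] := meet S PSS.
  apply: (connected_in_piece PSf _ Pdisj cT _ _ To PSS Sy Ty).
  - by move=> Z /PSP[H _]; exact: H.
  - by move=> z Tz; apply: AV; exact: TA.
  - by rewrite -AE.
apply: contrapT => nPQ; have [y [Py yo] Ty] := meet P PP.
by apply: yo; apply: (Pdisj P Q PP PQ nPQ); split=> //; exact: sub Ty.
Qed.

Lemma continuous_pair_at (u v : C -> C) (s : C) : {for s, continuous u} ->
  {for s, continuous v} -> {for s, continuous (fun y => (u y, v y))}.
Proof. by move=> cu cv; exact: (cvg_pair cu cv). Qed.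

Lemma continuous_add_cst (a s : C) : {for s, continuous (fun y : C => a + y)}.
Proof.
have c1 : (fun=> a) @ nbhs s --> a by exact: cvg_cst.
have c2 : id @ nbhs s --> s by exact: cvg_id.
exact: (cvgD c1 c2).
Qed.

Lemma continuous_cst_at (a s : C) : {for s, continuous (fun _ : C => a)}.
Proof.
have c1 : (fun=> a) @ nbhs s --> a by exact: cvg_cst.
exact: c1.
Qed.

Lemma differentiable_comp_sub (f : C -> C) (a w : C) : differentiable f (w - a) ->
  differentiable (fun w : C => f (w - a) : C) w.
Proof.
have d1 : differentiable (@id C) w by exact: ex_diff.
have d2 : differentiable (fun _ : C => a : C) w by exact: differentiable_cst.
have d3 : differentiable (fun w : C => w - a : C) w by exact: (differentiableB d1 d2).
by move=> df; exact: (differentiable_comp d3 df).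
Qed.

Lemma ball_pair (x z : C * C) (e : C) : ball x e z <-> `|x.1 - z.1| < e /\ `|x.2 - z.2| < e.
Proof. by []. Qed.

End LevelComponents.

(** * Components of the level set in a small bidisc *)

Section LevelComponentsTheorem.
Variable R : realType.
Local Notation C := (CC R).
Implicit Types (c d : nat -> C) (F G : {poly {poly C}}).

Lemma isolated_root (q : {poly C}) (a : C) : q != 0 ->
  exists2 r : C, 0 < r & forall z, `|z - a| < r -> q.[z] = 0 -> z = a.
Proof.
move=> q0; have q1 : q \Po ('X + a%:P) != 0 by rewrite comp_poly_eq0 // size_XaddC.
have [r /= r0 rP] := (nbhs_ballP _ _).1 (near_horner_neq0 q1).
exists r => // z za qz; apply: contrapT => /eqP; rewrite -subr_eq0 => z0.
have := rP (z - a); rewrite /ball /= sub0r normrN => /(_ za z0).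
by rewrite horner_comp !hornerE subrK qz eqxx.
Qed.

(** F is written in s = z2 - 1. The bidisc V is so thin that every branch stays in |z1 - 1| < rho
    over the whole disc |s| < dl; each graph is then the image of a full disc, and two graphs meet
    only over s = 0. *)
Lemma level_components F k G (A0 : set (C * C)) :
  (forall z, A0 z <-> F.[z.1, z.2 - 1] = 0) -> F = ('X^k)%:P * G -> slice G 0 != 0 ->
  G.[1, 0] = 0 -> local_branches F 1 ->
  exists (L : nat) (a : 'I_L -> nat -> C) (V : set (C * C)),
    [/\ (0 < L)%N, (forall j, analytic (a j) /\ a j 0 = 1),
      open V /\ V (1, 1),
      (forall z j, V z -> psum (a j) (z.2 - 1) @ \oo --> pval (a j) (z.2 - 1)) &
      forall S, irreducible_component V (A0 `&` V) S <->
        (exists j, S = [set z | z.1 = pval (a j) (z.2 - 1)] `&` V) \/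
        (slice F 0 = 0 /\ S = [set z | z.2 = 1] `&` V)].
Proof.
move=> A0E FE G0 G10 [B [Bf Bc [rho0 rho00 Brho]]].
have FG x y : F.[x, y] = y ^+ k * G.[x, y] by rewrite FE hornerM hornerC hornerM hornerXn.
have F10 : F.[1, 0] = 0 by rewrite FG G10 mulr0.
(* Unless the line z2 = 1 belongs to the level set, [rho] isolates z1 = 1 among the points over z2 =
   1. *)
have [rho [rhop rho_le rho_iso]] : exists rho : C, [/\ 0 < rho, rho <= rho0 &
    slice F 0 != 0 -> forall z, `|z - 1| < rho -> F.[z, 0] = 0 -> z = 1].
  have [F00|F00] := eqVneq (slice F 0) 0; first by exists rho0.
  have [r r0 rP] := isolated_root 1 F00; have rr : 0 < r + rho0 by rewrite addr_gt0.
  exists (r * rho0 / (r + rho0)); split; first by rewrite divr_gt0 ?mulr_gt0.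
    by rewrite ler_pdivrMr // mulrC ler_pM2l // lerDl ltW.
  move=> _ z zr; rewrite -horner_slice; apply: rP; apply: lt_le_trans zr _.
  by rewrite ler_pdivrMr // ler_pM2l // lerDr ltW.
have ana c : B c -> analytic c by case/Bc.
have c01 c : B c -> pval c 0 = 1 by case/Bc => _ <- _; rewrite pval0.
have nfin (P : (nat -> C) -> set C) : (forall c, B c -> \forall s \near (0 : C), P c s) ->
    \forall s \near (0 : C), forall c, B c -> P c s.
  by move=> H; apply: near_finite_set.
have n1 : \forall s \near (0 : C), forall c, B c -> differentiable (pval c : C -> C) s.
  by apply: nfin => c /ana; exact: differentiable_pval.
have n2 : \forall s \near (0 : C), forall c, B c -> psum c s @ \oo --> pval c s.
  by apply: nfin => c /ana; exact: analytic_near_cvg.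
have n3 : \forall s \near (0 : C), forall c, B c -> s != 0 -> F.[pval c s, s] = 0.
  by apply: nfin => c /Bc[].
have n4 : \forall s \near (0 : C), forall c, B c -> `|pval c s - 1| < rho.
  apply: nfin => c /Bc[ac c0 _]; have /cvg_at_dist_le := analytic_cvg0 ac.
  move=> /(_ (rho / 2)); rewrite divr_gt0 // c0 => /(_ isT); apply: filterS => s.
  rewrite distrC => /le_lt_trans; apply; by rewrite ltr_pdivrMr // ltr_pMr // ltr1n.
have n5 : \forall s \near (0 : C), forall c, B c -> forall d, B d -> c <> d -> s != 0 ->
    pval c s != pval d s.
  apply: (nfin _) => c Bcc; apply: (nfin _) => d Bd.
  have [cd|cd] := pselect (c = d); first by apply: near0W => s [].
  have := near_pval_neq (ana c Bcc) (ana d Bd) cd; apply: filterS => s H _.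
  exact: H.
have [dl /= dl0 dlP] := (nbhs_ballP _ _).1
  (filterI (filterI n1 n2) (filterI (filterI n3 n4) (filterI n5 Brho))).
have {n1 n2 n3 n4 n5 Brho dlP} disc s : `|s| < dl -> [/\
    forall c, B c -> differentiable (pval c : C -> C) s,
    forall c, B c -> psum c s @ \oo --> pval c s,
    forall c, B c -> F.[pval c s, s] = 0,
    forall c, B c -> `|pval c s - 1| < rho &
    (forall c d, B c -> B d -> pval c s = pval d s -> c = d \/ s = 0) /\
    (forall z, `|z - 1| < rho -> F.[z, s] = 0 -> s = 0 \/ exists2 c, B c & z = pval c s)].
  move=> sd; have := dlP s; rewrite /ball /= sub0r normrN => /(_ sd).
  move=> [[m1 m2] [[m3 m4] [m5 m6]]]; split=> //.
    move=> c Bcc; have [->|s0] := eqVneq s 0; first by rewrite c01.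
    exact: m3.
  split=> [c d Bcc Bd cd|z zr Fz].
    have [->|s0] := eqVneq s 0; [by right|left]; apply: contrapT => ncd.
    by have := m5 c Bcc d Bd ncd s0; rewrite cd eqxx.
  have [->|s0] := eqVneq s 0; [by left|right].
  exact: (m6 s0 z (lt_le_trans zr rho_le) Fz).
(* The root 1 of G(., 0) persists over some s > 0, and a branch must pass through it: the reason why
   L > 0. *)
have [c0 Bc0] : exists c, B c.
  have nr := near_root rhop G0 G10; have l := near0_mul_lt (ltr01 : 0 < 1 :> C) dl0.
  have [s [s0 [[x xr Gx] sd] _]] := near0_pos (filterI nr l) l (normr1 C).
  rewrite mul1r in sd; have [_ _ _ _ [_ /(_ x xr)]] := disc s sd.
  rewrite FG Gx mulr0 => /(_ erefl)[s00|[c Bcc _]]; last by exists c.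
  by move: s0; rewrite s00 ltxx.
have Bc1 c : B c -> analytic c /\ c 0 = 1 by case/Bc.
(* From here on only [c01] and [disc] are used about the sums, which become an abstract function. *)
clear Bc nfin ana; move: c01 disc; move: (@pval R) => pv c01 disc.
pose V : set (C * C) := [set z | `|z.1 - 1| < rho /\ `|z.2 - 1| < dl].
have VE (z : C * C) : V z -> exists2 e : C, 0 < e & forall y, ball z e y -> V y.
  move=> [v1 v2]; have w1 : 0 < rho - `|z.1 - 1| by rewrite subr_gt0.
  have w2 : 0 < dl - `|z.2 - 1| by rewrite subr_gt0.
  have w12 : 0 < rho - `|z.1 - 1| + (dl - `|z.2 - 1|) by rewrite addr_gt0.
  exists ((rho - `|z.1 - 1|) * (dl - `|z.2 - 1|) / (rho - `|z.1 - 1| + (dl - `|z.2 - 1|))).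
    by rewrite divr_gt0 ?mulr_gt0.
  move=> y /ball_pair[y1 y2]; split.
    apply: le_lt_trans (ler_distD z.1 _ _) _; rewrite addrC -ltrBrDl distrC.
    apply: lt_le_trans y1 _; rewrite ler_pdivrMr // ler_pM2l // lerDr ltW //.
  apply: le_lt_trans (ler_distD z.2 _ _) _; rewrite addrC -ltrBrDl distrC.
  by apply: lt_le_trans y2 _; rewrite ler_pdivrMr // mulrC ler_pM2l // lerDl ltW.
have Vnbhs z : V z -> \forall y \near z, V y.
  by move=> /VE[e e0 eV]; apply/nbhs_ballP; exists e.
have oV : open V by rewrite openE => z /Vnbhs.
have V11 : V (1, 1) by rewrite /V /= subrr normr0.
pose Gr c := [set z | z.1 = pv c (z.2 - 1)] `&` V.
pose Ln : set (C * C) := [set z | z.2 = 1] `&` V.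
pose PS : set (set (C * C)) := [set P | (exists2 c, B c & P = Gr c) \/ (slice F 0 = 0 /\ P = Ln)].
pose o : C * C := (1, 1).
pose A := A0 `&` V.
have PSf : finite_set PS.
  apply: (@sub_finite_set _ _ ((Gr @` B) `|` [set Ln])).
    by move=> P [[c Bcc ->]|[_ ->]]; [left; exists c|right].
  by rewrite finite_setU; split; [exact: finite_image|exact: finite_set1].
have PSV P : PS P -> P `<=` V by case=> [[c _ ->]|[_ ->]] z [].
have AE : A = \bigcup_(P in PS) P.
  apply/seteqP; split=> [z [/A0E Fz Vz]|z [P PP Pz]].
    have [z1 z2] := Vz; have [_ _ _ _ [_ /(_ _ z1 Fz)]] := disc _ z2.
    case=> [/eqP|[c Bcc zc]]; last by exists (Gr c) => //; left; exists c.
    rewrite subr_eq0 => /eqP z21; rewrite z21 subrr in Fz.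
    have [F0|F0] := eqVneq (slice F 0) 0; first by exists Ln => //; right.
    (* Over s = 0, when the line is absent, only (1, 1) is left, and it lies on every graph. *)
    exists (Gr c0); first by left; exists c0.
    by split=> //=; rewrite z21 subrr c01 // (rho_iso F0 _ z1 Fz).
  split; last exact: PSV Pz.
  apply/A0E; case: PP Pz => [[c Bcc ->]|[F0 ->]] [/= zE Vz].
    by have [_ z2] := Vz; have [_ _ m3 _ _] := disc _ z2; rewrite zE m3.
  by rewrite zE subrr -horner_slice F0 horner0.
have AV : A `<=` V by move=> z [].
have ccont c (s : C) : B c -> `|s| < dl -> {for s, continuous (pv c : C -> C)}.
  by move=> Bcc /disc[/(_ c Bcc) + _ _ _ _] => /differentiable_continuous.
have near_ne c (z : C * C) : B c -> V z -> z.1 <> pv c (z.2 - 1) ->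
    \forall y \near z, y.1 <> pv c (y.2 - 1).
  move=> Bcc [_ z2] zc.
  have cv : (fun y : C * C => y.1 - pv c (y.2 - 1)) @ nbhs z --> z.1 - pv c (z.2 - 1).
    have p1 : (fun y : C * C => y.1) @ nbhs z --> z.1.
      exact: (@cvg_fst _ _ (nbhs z.1) (nbhs z.2) _).
    have p2 : (fun y : C * C => y.2) @ nbhs z --> z.2.
      exact: (@cvg_snd _ _ (nbhs z.1) (nbhs z.2) _).
    have c2 : (fun y : C * C => y.2 - 1) @ nbhs z --> z.2 - 1.
      exact: (cvgB p2 (@cvg_cst _ (1 : C) _ (nbhs z) _)).
    have c3 : (fun y : C * C => pv c (y.2 - 1)) @ nbhs z --> pv c (z.2 - 1).
      have cc : pv c @ nbhs (z.2 - 1) --> pv c (z.2 - 1) by exact: ccont.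
      exact: (@cvg_comp _ _ _ _ _ (nbhs z) _ _ c2 cc).
    exact: (cvgB p1 c3).
  have e0 : 0 < `|z.1 - pv c (z.2 - 1)| by rewrite normr_gt0 subr_eq0; apply/eqP.
  have H : \forall y \near z, `|z.1 - pv c (z.2 - 1) - (y.1 - pv c (y.2 - 1))| <
      `|z.1 - pv c (z.2 - 1)| by exact: cvgr_dist_lt _ _ cv _ e0.
  move: H; move: (z.1 - pv c (z.2 - 1)) => w; apply: filterS => y + yc.
  have -> : y.1 - pv c (y.2 - 1) = 0 by apply/eqP; rewrite subr_eq0; apply/eqP.
  by rewrite subr0 ltxx.
have Pcl P : PS P -> closure P `&` V `<=` P.
  case=> [[c Bcc ->]|[F0 ->]] z [zcl Vz]; split=> //=.
    apply: contrapT => /(near_ne c z Bcc Vz) nz.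
    by have [y [[/= yE _] yn]] := zcl _ nz.
  apply: contrapT => /eqP; rewrite -subr_eq0 -normr_gt0 => z1.
  have nz : \forall y \near z, y.2 <> 1.
    have p2 : (fun y : C * C => y.2) @ nbhs z --> z.2.
      exact: (@cvg_snd _ _ (nbhs z.1) (nbhs z.2) _).
    have cv : \forall y \near z, `|z.2 - y.2| < `|z.2 - 1| by exact: cvgr_dist_lt _ _ p2 _ z1.
    by move: cv; apply: filterS => y /= + yE; rewrite yE ltxx.
  by have [y [[/= yE _] yn]] := zcl _ nz.
have Pdisj P Q : PS P -> PS Q -> P <> Q -> P `&` Q `<=` [set o].
  move=> PP PQ PQn z [Pz Qz].
  suff z21 : z.2 = 1.
    have /A0E Fz : A0 z by have [] : A z by rewrite AE; exists P.
    case: PP PQ Pz Qz PQn => [[c Bcc ->]|[F0 ->]] [[d Bd ->]|[F0' ->]] [/= zE _] [/= zE' _] //.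
    - by move=> _; rewrite /o [z]surjective_pairing zE z21 subrr c01.
    - by move=> _; rewrite /o [z]surjective_pairing zE z21 subrr c01.
    - by move=> _; rewrite /o [z]surjective_pairing zE' z21 subrr c01.
  case: PP PQ Pz Qz PQn => [[c Bcc ->]|[F0 ->]] [[d Bd ->]|[F0' ->]] [/= zE [_ z2]] [/= zE' _] //.
  have [_ _ _ _ [inj _]] := disc _ z2; move=> cd.
  have [cdE|/eqP] := inj c d Bcc Bd (etrans (esym zE) zE'); first by rewrite cdE in cd.
  by rewrite subr_eq0 => /eqP.
have PSP P : PS P -> [/\ P o, closure (P `\ o) o & connected P /\ connected (P `\ o)].
  case=> [[c Bcc ->]|[F0 ->]].
    pose phi (s : C) : C * C := (pv c s, 1 + s).
    have -> : Gr c = phi @` [set s | `|s| < dl].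
      apply/seteqP; split=> [z [/= zE [z1 z2]]|_ [s /= sd <-]].
        exists (z.2 - 1) => //=; rewrite /phi -zE addrC subrK.
        by rewrite -surjective_pairing.
      have [_ _ _ m4 _] := disc s sd.
      have sE : 1 + s - 1 = s by rewrite addrAC subrr add0r.
      by split=> /=; rewrite ?sE //; split; rewrite /= ?sE //; exact: m4.
    apply: param_piece => //.
    - by rewrite /phi c01 // addr0.
    - by move=> s _ [_ /eqP]; rewrite -subr_eq0 addrAC subrr add0r => /eqP.
    - move=> s sd; apply: continuous_pair_at; first exact: ccont.
      exact: continuous_add_cst.
  pose phi (s : C) : C * C := (1 + s, 1).
  have -> : Ln = phi @` [set s | `|s| < rho].
    apply/seteqP; split=> [z [/= zE [z1 z2]]|_ [s /= sd <-]].
      exists (z.1 - 1) => //=; rewrite /phi -zE addrC subrK.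
      by rewrite -surjective_pairing.
    have sE : 1 + s - 1 = s by rewrite addrAC subrr add0r.
    by split=> //=; split; rewrite /= ?sE // subrr normr0.
  apply: param_piece => //.
  - by rewrite /phi addr0.
  - by move=> s _ [/eqP]; rewrite -subr_eq0 addrAC subrr add0r => /eqP.
  - move=> s sd; apply: continuous_pair_at; last exact: continuous_cst_at.
    exact: continuous_add_cst.
have Ao : A o by rewrite AE; exists (Gr c0); [left; exists c0|have [] := PSP (Gr c0) (or_introl (ex_intro2 _ _ c0 Bc0 erefl))].
have near_snd (z : C * C) : z.2 <> 1 -> \forall y \near z, y.2 <> 1.
  move=> /eqP; rewrite -subr_eq0 -normr_gt0 => z1.
  have p2 : (fun y : C * C => y.2) @ nbhs z --> z.2.
    exact: (@cvg_snd _ _ (nbhs z.1) (nbhs z.2) _).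
  have cv : \forall y \near z, `|z.2 - y.2| < `|z.2 - 1| by exact: cvgr_dist_lt _ _ p2 _ z1.
  by move: cv; apply: filterS => y /= + yE; rewrite yE ltxx.
have ballU (z : C * C) (W : set (C * C)) : (\forall y \near z, W y) ->
    exists U, [/\ open U, U z, U `<=` W & exists2 e : C, 0 < e & U = ball z e].
  move=> /nbhs_ballP[e e0 eW]; exists (ball z e); split=> //; [exact: ball_open|exact: ballxx|].
  by exists e.
have pairE (z : C * C) : z.1 = 1 -> z.2 = 1 -> z = o.
  by move=> z1 z2; rewrite [z]surjective_pairing z1 z2.
(* Away from o a point lies on one piece only, and a small ball avoids the others: a graph is
   regular over z2, the line over z1. *)
have reg x : A x -> x <> o -> regular_point A x.
  move=> Ax xo; split=> //; have Vx := AV x Ax.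
  have [P PP Px] : (\bigcup_(P in PS) P) x by rewrite -AE.
  case: PP Px => [[c Bcc ->]|[F0 ->]] [/= xE _].
    have x21 : x.2 <> 1 by move=> x2; apply: xo; apply: pairE => //; rewrite xE x2 subrr c01.
    have nd : \forall y \near x, forall d, B d -> d <> c -> y.1 <> pv d (y.2 - 1).
      apply: near_finite_filter => // d Bd; have [dc|dc] := pselect (d = c).
        by move: (Vnbhs x Vx); apply: filterS => y _ [].
      have xd : x.1 <> pv d (x.2 - 1).
        have [_ x2] := Vx; have [_ _ _ _ [inj _]] := disc _ x2.
        rewrite xE => /esym/(inj d c Bd Bcc)[//|/eqP].
        by rewrite subr_eq0 => /eqP.
      by move: (near_ne d x Bd Vx xd); apply: filterS.
    have [U [oU Ux UW _]] := ballU x _ (filterI (Vnbhs x Vx) (filterI nd (near_snd x x21))).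
    exists U; split=> //; apply: Or42; exists (fun w => pv c (w - 1)); split.
      move=> _ [y /UW[[_ y2] _] <-]; have [dc _ _ _ _] := disc _ y2.
      exact: differentiable_comp_sub (dc c Bcc).
    apply/seteqP; split=> y [+ Uy]; have [Vy [nd' ny]] := UW y Uy; split=> //=; last first.
      by rewrite AE; exists (Gr c) => //; left; exists c.
    have [Q QP Qy] : (\bigcup_(P in PS) P) y by rewrite -AE.
    case: QP Qy => [[d Bd ->]|[_ ->]] [/= yE _]; last by [].
    by have [<- //|dc] := pselect (d = c); case: (nd' d Bd dc).
  have x11 : x.1 <> 1 by move=> x1; apply: xo; apply: pairE.
  have nd : \forall y \near x, forall d, B d -> y.1 <> pv d (y.2 - 1).
    apply: near_finite_filter => // d Bd; apply: near_ne => //.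
    by rewrite xE subrr c01.
  have [U [oU Ux UW _]] := ballU x _ (filterI (Vnbhs x Vx) nd).
  exists U; split=> //; apply: Or43; exists (fun=> 1); split.
    by move=> z _; exact: differentiable_cst.
  apply/seteqP; split=> y [+ Uy]; have [Vy nd'] := UW y Uy; split=> //=; last first.
    by rewrite AE; exists Ln => //; right.
  have [Q QP Qy] : (\bigcup_(P in PS) P) y by rewrite -AE.
  by case: QP Qy => [[d Bd ->]|[_ ->]] [/= yE _] //; case: (nd' d Bd).
have PSP' P : PS P -> closure P `&` V `<=` P /\ closure (P `\ o) o.
  by move=> PP; split; [exact: Pcl|have [] := PSP P PP].
have rego : regular_point A o -> forall P Q, PS P -> PS Q -> P = Q.
  move=> [_ [U [oU Uo cases]]].
  have nU : nbhs o U by apply: open_nbhs_nbhs.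
  have [e /= e0 eU] := (nbhs_ballP _ _).1 nU.
  have l := near0_mul_lt (ltr01 : 0 < 1 :> C) e0.
  (* When A is a graph over one coordinate near o, that coordinate, centred at 1, parametrises A
     minus o near o by a punctured disc. *)
  have single (f : C -> C) (tau : C -> C * C) :
      (forall s : C, `|s| < e -> differentiable f (1 + s)) -> f 1 = 1 ->
      (forall s : C, `|s| < e -> `|f (1 + s) - 1| < e -> s != 0 -> A (tau s) /\ tau s <> o) ->
      (forall s : C, {for s, continuous (fun s : C => f (1 + s))} -> {for s, continuous tau}) ->
      (forall r : C, 0 < r -> \forall y \near o, A y -> y <> o ->
         exists2 s : C, `|s| < r /\ s != 0 & tau s = y) ->
      forall P Q, PS P -> PS Q -> P = Q.
    move=> fd f1 tauA tauc cover.
    have fc (s : C) : `|s| < e -> {for s, continuous (fun s : C => f (1 + s))}.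
      move=> se; have c1 : (fun s : C => 1 + s) @ nbhs s --> 1 + s by exact: continuous_add_cst.
      have c2 : f @ nbhs (1 + s) --> f (1 + s) by have /differentiable_continuous := fd s se.
      exact: (@cvg_comp _ _ _ _ _ (nbhs s) _ _ c1 c2).
    have fe : \forall s \near (0 : C), `|f (1 + s) - 1| < e.
      have c0' : (fun s : C => f (1 + s)) @ nbhs (0 : C) --> (1 : C).
        by have := fc 0; rewrite normr0 => /(_ e0); rewrite /prop_for /continuous_at addr0 f1.
      have H : \forall s \near (0 : C), `|1 - f (1 + s)| < e by exact: cvgr_dist_lt _ _ c0' _ e0.
      by move: H; apply: filterS => s; rewrite distrC.
    have [r /= r0 rP] := (nbhs_ballP _ _).1 (filterI fe l).
    have rP' s : `|s| < r -> `|f (1 + s) - 1| < e /\ `|s| < e.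
      by have := rP s; rewrite /ball /= sub0r normrN mul1r.
    apply: (@single_piece R V A PS o tau r PSf AE AV PSP' Pdisj).
    - by move=> s /rP'[fs se]; exact: tauA.
    - by move=> s /rP'[_ se]; apply: tauc; exact: fc.
    - exact: cover.
  have inball (y : C * C) : `|y.1 - 1| < e -> `|y.2 - 1| < e -> U y.
    by move=> y1 y2; apply: eU; apply/ball_pair; split; rewrite distrC.
  have sE s : 1 + s - 1 = s :> C by rewrite addrAC subrr add0r.
  have nball (r : C) : 0 < r -> \forall y \near o, U y /\ (`|y.1 - 1| < r /\ `|y.2 - 1| < r).
    move=> r0; have br : nbhs o (ball o r) by apply: nbhsx_ballx.
    move: nU br; apply: filterS2 => y Uy /ball_pair[y1 y2]; split=> //.
    by rewrite distrC [`|y.2 - _|]distrC.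
  case: cases => [AU|[f [fh AU]]|[f [fh AU]]|UA].
  - move=> P Q PP _; exfalso; have [_ Poc] := PSP' P PP.
    have [y [[Py yo] Uy]] := Poc U nU; apply: yo.
    by have : (A `&` U) y by [split=> //; rewrite AE; exists P]; rewrite AU.
  - have f1 : f 1 = 1.
      have : (A `&` U) o by []; by rewrite AU => -[/= <-].
    apply: (single f (fun s => (f (1 + s), 1 + s))) => //.
    + move=> s se; apply: fh; exists (1, 1 + s) => //=.
      by apply: inball; rewrite /= ?sE // subrr normr0.
    + move=> s se fs s0; split.
        have : ([set x | x.1 = f x.2] `&` U) (f (1 + s), 1 + s).
          by split=> //; apply: inball; rewrite /= ?sE.
        by rewrite -AU => -[].
      by move=> [_ /eqP]; rewrite -subr_eq0 sE (negPf s0).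
    + by move=> s fc; exact: (continuous_pair_at fc (@continuous_add_cst _ 1 s)).
    + move=> r r0; move: (nball r r0); apply: filterS => y [Uy [y1 y2]] Ay yo.
      have yE : y.1 = f y.2 by have : (A `&` U) y by []; rewrite AU => -[].
      exists (y.2 - 1); last by rewrite addrC subrK -yE -surjective_pairing.
      split=> //; rewrite subr_eq0; apply/eqP => y21; apply: yo; apply: pairE => //.
      by rewrite yE y21.
  - have f1 : f 1 = 1.
      have : (A `&` U) o by []; by rewrite AU => -[/= <-].
    apply: (single f (fun s => (1 + s, f (1 + s)))) => //.
    + move=> s se; apply: fh; exists (1 + s, 1) => //=.
      by apply: inball; rewrite /= ?sE // subrr normr0.
    + move=> s se fs s0; split.
        have : ([set x | x.2 = f x.1] `&` U) (1 + s, f (1 + s)).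
          by split=> //; apply: inball; rewrite /= ?sE.
        by rewrite -AU => -[].
      by move=> [/eqP + _]; rewrite -subr_eq0 sE (negPf s0).
    + by move=> s fc; exact: (continuous_pair_at (@continuous_add_cst _ 1 s) fc).
    + move=> r r0; move: (nball r r0); apply: filterS => y [Uy [y1 y2]] Ay yo.
      have yE : y.2 = f y.1 by have : (A `&` U) y by []; rewrite AU => -[].
      exists (y.1 - 1); last by rewrite addrC subrK -yE -surjective_pairing.
      split=> //; rewrite subr_eq0; apply/eqP => y11; apply: yo; apply: pairE => //.
      by rewrite yE y11.
  (* A has no interior at o: over a suitable small s > 0 the slice of F is a nonzero polynomial,
     with no root other than 1 close to 1. *)
  - exfalso; have Fn0 : F != 0.
      rewrite FE mulf_neq0 // ?polyC_eq0 ?expf_neq0 ?polyX_eq0 //.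
      by apply: contraNneq G0 => ->; rewrite /slice rmorph0.
    have [s [s0 [sF se] _]] := near0_pos (filterI (near_slice_neq0 Fn0) l) l (normr1 C).
    have sn0 : s != 0 by rewrite gt_eqF.
    have [r r0 rP] := isolated_root 1 (sF sn0).
    have lr := near0_mul_lt (ltr01 : 0 < 1 :> C) r0.
    have [h [h0 [hr he] _]] := near0_pos (filterI lr l) l (normr1 C).
    rewrite mul1r in se; rewrite mul1r in hr; rewrite mul1r in he.
    have /UA[/A0E /= Fh _] : U (1 + h, 1 + s) by apply: inball; rewrite /= sE.
    rewrite sE -horner_slice in Fh.
    have := rP (1 + h); rewrite sE => /(_ hr Fh)/eqP.
    by rewrite -subr_eq0 sE gt_eqF.
have [l Bl] := (finite_seqP B).1 Bf.
have nthB j : (j < size l)%N -> B (nth c0 l j) by move=> jl; rewrite Bl /= mem_nth.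
have c0l : c0 \in l by move: Bc0; rewrite Bl.
exists (size l), (fun j => nth c0 l j), V; split.
- by rewrite -has_predT; apply/hasP; exists c0.
- by move=> j; have /Bc1[] := nthB j (ltn_ord j).
- by [].
- by move=> z j [_ z2]; have [_ cv _ _ _] := disc _ z2; apply: cv; exact: nthB.
move=> S.
have main := irreducible_components_pieces PSf AE _ Pdisj reg rego S.
rewrite -/A; split=> [/main|H].
  case=> [P PP|[c Bcc ->]|[F0 ->]]; [| |by right].
    by have [h1 h2 h3] := PSP P PP; split=> //; [exact: PSV|exact: Pcl].
  left; have cl : c \in l by move: Bcc; rewrite Bl.
  by exists (Ordinal (etrans (index_mem c l) cl)); rewrite /= nth_index.
apply/main; first by move=> P PP; have [h1 h2 h3] := PSP P PP; split=> //; [exact: PSV|exact: Pcl].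
case: H => [[j ->]|[F0 ->]]; [left|by right].
by exists (nth c0 l j) => //; exact: nthB.
Qed.

End LevelComponentsTheorem.

(** * The exceptional value of mu and the final choice of branches *)

Theorem theorem2p9 (R : realType) (p : {poly {poly CC R}}) (hp : A1 p) :
  exists E : set (CC R), is_subset1 E /\
  forall mu : CC R, `|mu| = 1 ->
  exists (L : nat) (a : 'I_L -> nat -> CC R) (V : set (CC R * CC R)),
    [/\ (0 < L)%N,
        (forall j, \forall w \near (1 : CC R), cvgn (pseries_at1 (a j) w)),
        (forall j, pseries_at1 (a j) 1 @ \oo --> (1 : CC R)),
        open V /\ V (1, 1) &
        forall S : set (CC R * CC R),
          irreducible_component V (level_set p mu `&` V) S <->
          (exists j, S = pseries_graph (a j) `&` V) \/
          (E mu /\ S = [set z | z.2 = 1] `&` V)].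

Proof.
case: hp => _ [stab [nc [p11 _]]].
have stable (x y : CC R) : `|x| < 1 -> `|y| < 1 -> p.[x, y] != 0.
  by move=> x1 y1; exact: (stab (x, y)).
have p0 : p != 0.
  by apply: contraTneq (stable 0 0 _ _) => [->||]; rewrite ?normr0 ?ltr01 // !horner0 eqxx.
(* These are the mu whose level set contains the line z2 = 1. Two of them would force p and then p~
   to vanish on that line. *)
pose E : set (CC R) := [set mu | forall x, (reflection p).[x, 1] = mu * p.[x, 1]].
exists E; split.
  move=> mu nu Emu Enu; apply: contrapT => /eqP mn.
  have ps : slice p 1 = 0.
    apply: horner_inj => x; rewrite horner_slice horner0.
    have : (mu - nu) * p.[x, 1] = 0 by rewrite mulrBl -(Emu x) -(Enu x) subrr.
    by move/eqP; rewrite mulf_eq0 subr_eq0 (negPf mn) => /eqP.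
  apply: (no_common_slice nc ps); apply: horner_inj => x.
  by rewrite horner_slice horner0 (Emu x) -horner_slice ps horner0 mulr0.
move=> mu mu1; pose F0 := reflection p - mu%:P%:P * p.
have F0E x y : F0.[x, y] = (reflection p).[x, y] - mu * p.[x, y].
  by rewrite /F0 !(hornerD, hornerN, hornerM, hornerC).
(* If p~ = mu p, then p is itself a common factor, hence constant, and p(1, 1) = 0 makes it 0. *)
have F0n : F0 != 0.
  apply/negP; rewrite subr_eq0 => /eqP rE.
  have [|c pE] := nc p 1 mu%:P%:P (esym (mulr1 p)); first by rewrite rE mulrC.
  by move: p0 p11; rewrite pE !hornerC !polyC_eq0 => /eqP.
pose F := map_poly (fun q : {poly CC R} => q \Po (1 + 'X)) F0.
have FE x s : F.[x, s] = F0.[x, 1 + s].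
  by rewrite horner_map_comp !(hornerD, hornerC, hornerX).
have Fn : F != 0.
  apply: contra_neq F0n => Fz; apply: horner2_inj => x y.
  by rewrite -[y](subrK 1) [y - 1 + 1]addrC -FE Fz !horner0.
have [k [G [FG G0]]] := polyY_factor Fn.
have G10 := level_root_11 stable nc p11 mu1 FG.
have A0E (z : CC R * CC R) : level_set p mu z <-> F.[z.1, z.2 - 1] = 0.
  rewrite FE addrC subrK F0E /level_set /=.
  by split=> [->|/eqP]; [rewrite subrr|rewrite subr_eq0 => /eqP].
have [L [a [V [L0 aP VP cv comps]]]] :=
  level_components A0E FG G0 G10 (local_branches_level stable mu1 F0n).
exists L, a, V; split=> //.
- move=> j; have [e /= e0 eP] := (nbhs_ballP _ _).1 (analytic_near_cvg (aP j).1).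
  suff H w : ball (1 : CC R) e w -> cvgn (pseries_at1 (a j) w) by apply/nbhs_ballP; exists e.
  move=> we; have wb : ball (0 : CC R) e (w - 1).
    by move: we; rewrite /ball /= sub0r normrN distrC.
  have H : psum (a j) (w - 1) @ \oo --> pval (a j) (w - 1) by exact: eP.
  exact: (cvgP (pval (a j) (w - 1)) H).
- by move=> j; rewrite -[X in _ --> X](aP j).2 /pseries_at1 subrr; exact: cvg_psum0.
(* [pseries_graph] is a statement of convergence; on V the series converges, so it amounts to z1
   being the sum. *)
have graphE j : pseries_graph (a j) `&` V = [set z | z.1 = pval (a j) (z.2 - 1)] `&` V.
  apply/seteqP; split=> z [zE Vz]; split=> //=; first by rewrite (pvalP zE).
  by rewrite /pseries_graph /= zE; exact: cv.
have EF : E mu <-> slice F 0 = 0.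
  split=> [Emu|s0 x].
    by apply: horner_inj => x; rewrite horner_slice FE addr0 F0E (Emu x) subrr horner0.
  by apply/eqP; rewrite -subr_eq0 -F0E -[1](addr0 (1 : CC R)) -FE -horner_slice s0 horner0.
move=> S; split=> [/comps[[j ->]|[/EF Emu ->]]|H]; [left|by right|apply/comps].
  by exists j; rewrite graphE.
by case: H => [[j ->]|[/EF s0 ->]]; [left; exists j; rewrite graphE|right].
Qed.
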